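(* Every $C^*$-algebra $\mathcal{A}$ has a universal $\sigma$-completion $j\colon\mathcal{A}\to\mathcal{A}^\sigma$. Moreover, for every $\sigma C^*$-algebra $\mathcal{B}$, every $\sigma$-normal completely positive unital map $\phi\colon\mathcal{A}\to\mathcal{B}$ extends uniquely to a $\sigma$-normal completely positive unital map $\tilde\phi\colon\mathcal{A}^\sigma\to\mathcal{B}$ with $\tilde\phi\circ j=\phi$.
   Context: All $C^*$-algebras and $*$-homomorphisms are unital. A $\sigma C^*$-algebra is a $C^*$-algebra in which every norm-bounded increasing sequence of self-adjoint elements has a supremum in the self-adjoint poset. A positive unital map between $C^*$-algebras is $\sigma$-normal if it preserves suprema of bounded increasing self-adjoint sequences whenever these exist in the domain; a $\sigma$-$*$-homomorphism is a $\sigma$-normal $*$-homomorphism. A $\sigma$-subspace is a $*$-subspace closed under suprema of bounded increasing self-adjoint sequences; the $\sigma$-closure of a $*$-subspace is the smallest $\sigma$-subspace containing it. A $\sigma$-completion of $\mathcal{A}$ is a pair $(\mathcal{B},j)$ with $\mathcal{B}$ a $\sigma C^*$-algebra and $j\colon\mathcal{A}\to\mathcal{B}$ an injective $\sigma$-$*$-homomorphism such that the $\sigma$-closure of $j(\mathcal{A})$ in $\mathcal{B}$ is $\mathcal{B}$. Preorder: $(\mathcal{B},j)\preceq(\mathcal{C},k)$ if there is a $\sigma$-$*$-homomorphism $\phi\colon\mathcal{B}\to\mathcal{C}$ with $\phi\circ j=k$. The universal $\sigma$-completion is a $\sigma$-completion that is below every $\sigma$-completion with respect to $\preceq$. *)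

(* Defs.v *)
(* Unital C*-algebras over the complex numbers
   C := R[i], where R is Stdlib's real numbers (a realType / rcfType). *)
From HB Require Import structures.
From mathcomp Require Import all_boot all_order all_algebra.
From mathcomp Require Import complex.
From mathcomp Require Import reals Rstruct.

Set Implicit Arguments.
Unset Strict Implicit.
Unset Printing Implicit Defensive.

Import Order.TTheory GRing.Theory Num.Theory.
Local Open Scope ring_scope.

Notation RR := Rdefinitions.R.
Notation CC := (RR[i]).

(* modulus of a complex number, as a real number *)
Definition cabs (c : CC) : RR := @ComplexField.Normc.normc RR c.

(* A unital C*-algebra: a (nonzero) unital complex algebra with an
   involution and a complete submultiplicative norm satisfying the
   C*-identity. *)
Record cstar := CStar {
  cs_car :> algType CC;
  cs_star : cs_car -> cs_car;
  cs_norm : cs_car -> RR;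
  cs_starD : forall a b, cs_star (a + b) = cs_star a + cs_star b;
  cs_starZ : forall (c : CC) a, cs_star (c *: a) = (c^*)%C *: cs_star a;
  cs_starM : forall a b, cs_star (a * b) = cs_star b * cs_star a;
  cs_starK : forall a, cs_star (cs_star a) = a;
  cs_norm_eq0 : forall a, cs_norm a = 0 -> a = 0;
  cs_normD : forall a b, cs_norm (a + b) <= cs_norm a + cs_norm b;
  cs_normZ : forall (c : CC) a, cs_norm (c *: a) = cabs c * cs_norm a;
  cs_normM : forall a b, cs_norm (a * b) <= cs_norm a * cs_norm b;
  cs_cstar_id : forall a, cs_norm (cs_star a * a) = cs_norm a ^+ 2;
  cs_complete : forall u : nat -> cs_car,
    (forall e : RR, 0 < e -> exists N, forall m n, (N <= m)%N -> (N <= n)%N ->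
        cs_norm (u m - u n) < e) ->
    exists l, forall e : RR, 0 < e -> exists N, forall n, (N <= n)%N ->
        cs_norm (u n - l) < e
}.

Section CStarDefs.
Variable A : cstar.

Definition selfadj (a : A) : Prop := cs_star a = a.
(* positive elements: those of the form b^* b *)
Definition posel (a : A) : Prop := exists b : A, a = cs_star b * b.
(* the order on (self-adjoint) elements *)
Definition cle (a b : A) : Prop := posel (b - a).

Definition nbounded (u : nat -> A) : Prop :=
  exists M : RR, forall n, cs_norm (u n) <= M.
Definition incr_sa (u : nat -> A) : Prop :=
  (forall n, selfadj (u n)) /\ (forall n, cle (u n) (u n.+1)).
(* s is the supremum of u in the poset of self-adjoint elements *)
Definition is_sup (u : nat -> A) (s : A) : Prop :=
  [/\ selfadj s, (forall n, cle (u n) s) &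
      (forall t, selfadj t -> (forall n, cle (u n) t) -> cle s t)].

(* sigma C*-algebra *)
Definition sigma_cstar : Prop :=
  forall u : nat -> A, incr_sa u -> nbounded u -> exists s, is_sup u s.

(* *-subspaces, sigma-subspaces, sigma-closure *)
Definition star_subspace (S : A -> Prop) : Prop :=
  [/\ S 0, (forall (c : CC) a b, S a -> S b -> S (c *: a + b)) &
      (forall a, S a -> S (cs_star a))].
Definition sigma_subspace (S : A -> Prop) : Prop :=
  star_subspace S /\
  (forall (u : nat -> A) s, incr_sa u -> nbounded u -> (forall n, S (u n)) ->
      is_sup u s -> S s).
Definition sigma_closure (X : A -> Prop) (b : A) : Prop :=
  forall S, sigma_subspace S -> (forall x, X x -> S x) -> S b.

(* matrix amplification: positivity in M_n(A) *)
Definition mx_adj n (Y : 'M[A]_n) : 'M[A]_n := \matrix_(i, j) cs_star (Y j i).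
Definition mx_pos n (X : 'M[A]_n) : Prop :=
  exists Y : 'M[A]_n, X = mx_adj Y *m Y.

End CStarDefs.

Section Maps.
Variables A B : cstar.

Definition clinear (f : A -> B) : Prop :=
  forall (c : CC) a b, f (c *: a + b) = c *: f a + f b.
Definition unital (f : A -> B) : Prop := f 1 = 1.
Definition positive_map (f : A -> B) : Prop :=
  forall a, posel a -> posel (f a).
Definition completely_positive (f : A -> B) : Prop :=
  forall n (X : 'M[A]_n), mx_pos X -> mx_pos (map_mx f X).
Definition sigma_normal (f : A -> B) : Prop :=
  forall (u : nat -> A) s, incr_sa u -> nbounded u -> is_sup u s ->
    is_sup (fun n => f (u n)) (f s).
Definition star_hom (f : A -> B) : Prop :=
  [/\ clinear f, unital f, (forall a b, f (a * b) = f a * f b) &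
      (forall a, f (cs_star a) = cs_star (f a))].
Definition sigma_star_hom (f : A -> B) : Prop := star_hom f /\ sigma_normal f.
(* sigma-normal completely positive unital (linear) map *)
Definition sncpu (f : A -> B) : Prop :=
  [/\ clinear f, unital f, completely_positive f & sigma_normal f].

(* (B, j) is a sigma-completion of A *)
Definition sigma_completion (j : A -> B) : Prop :=
  [/\ sigma_cstar B, sigma_star_hom j, injective j &
      (forall b : B, sigma_closure (fun x => exists a, x = j a) b)].
End Maps.

(* preorder on sigma-completions *)
Definition completion_le (A B C : cstar) (j : A -> B) (k : A -> C) : Prop :=
  exists phi : B -> C, sigma_star_hom phi /\ (forall a, phi (j a) = k a).

Definition universal_sigma_completion (A B : cstar) (j : A -> B) : Prop :=
  sigma_completion j /\
  (forall (C : cstar) (k : A -> C), sigma_completion k -> completion_le j k).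

(* Main.v *)
Require Import Defs.
From HB Require Import structures.
From mathcomp Require Import all_boot all_order all_algebra.
From mathcomp Require Import complex.
From mathcomp Require Import boolp classical_sets cardinality reals Rstruct.
From mathcomp Require Import ring lra.

Set Implicit Arguments.
Unset Strict Implicit.
Unset Printing Implicit Defensive.

Import Order.TTheory GRing.Theory Num.Theory.
Local Open Scope ring_scope.
Local Open Scope complex_scope.

(* The universal completion is built from formal words in [A]: a term is an
   element of [A], a linear combination or a product of terms, or the limit of
   a sequence of terms.  A term acts on a vector of a Hilbert space on which [A]
   acts, limits being strong limits.  For a sequence decreasing to 0 in [A], a
   vector [xi] is generic when the corresponding forms at [xi] tend to 0; a
   Kelley-Vaught and Hahn-Banach argument gives enough vectors that are generic
   for countably many given sequences to detect positivity in [A].  The terms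
   that act as bounded adjointable operators at all such vectors, modulo
   equality at all sufficiently generic vectors, form a sigma C*-algebra
   containing [A] sigma-normally, in which suprema are strong limits.  The
   sigma-closure of [A] in it is a C*-subalgebra, and is the completion.
   A sigma-normal completely positive [phi : A -> B] dilates, over a generic
   positive functional of [B], to generic vectors for [A]; evaluating elements
   of the completion there defines the extension of [phi].  If [phi] is a
   homomorphism, the graph of the extension is the sigma-closure of the graph
   of [phi], and such a closure is an algebra. *)

(** * Identities in noncommutative algebras *)

(** Strong limits in all representations would not do: the supremum in [A] of a sequence need not be
    its strong limit there, so the embedding would not be sigma-normal. Restricting to vectors at
    which the countably many sequences at hand do tend to 0 repairs this, but in general no vector
    serves all sequences at once. So generic properties form a filter stable under countable
    intersections, and an element of the completion has to make sense in every representation.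
    Limits of terms are controlled together with those of their formal adjoints, since taking
    adjoints is not strongly continuous. Multiplicativity does not pass to suprema one variable at a
    time, because multiplication is not monotone. That the closure of a subalgebra is an algebra is
    therefore proved intrinsically, without a representation: it is applied in a product whose
    second factor is an arbitrary sigma C*-algebra. *)

Section NcAlgebra.
Variables (K : comNzRingType) (A : algType K).

Inductive ncexp :=
  | NcVar of nat | NcZero | NcOne | NcAdd of ncexp & ncexp | NcOpp of ncexp
  | NcMul of ncexp & ncexp | NcScale of K & ncexp.

Fixpoint nceval (env : seq A) (e : ncexp) : A :=
  match e with
  | NcVar i => nth 0 env i
  | NcZero => 0
  | NcOne => 1
  | NcAdd e1 e2 => nceval env e1 + nceval env e2
  | NcOpp e1 => - nceval env e1
  | NcMul e1 e2 => nceval env e1 * nceval env e2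
  | NcScale c e1 => c *: nceval env e1
  end.

Definition ncpoly := seq (K * seq nat).

Fixpoint ncword (env : seq A) (m : seq nat) : A :=
  if m is i :: m' then nth 0 env i * ncword env m' else 1.

Fixpoint ncval (env : seq A) (l : ncpoly) : A :=
  if l is t :: l' then t.1 *: ncword env t.2 + ncval env l' else 0.

(** Private copies of append and map: the tactic [ncalg_core] unfolds a fixed list of names, and
    these can be unfolded without touching library functions inside the coefficients. *)
Fixpoint ncapp T (s t : seq T) : seq T :=
  if s is x :: s' then x :: ncapp s' t else t.

Fixpoint ncmap S T (f : S -> T) (s : seq S) : seq T :=
  if s is x :: s' then f x :: ncmap f s' else [::].

Fixpoint ncprod (l1 l2 : ncpoly) : ncpoly :=
  if l1 is t :: l1' then
    ncapp (ncmap (fun u : K * seq nat => (t.1 * u.1, ncapp t.2 u.2)) l2)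
      (ncprod l1' l2)
  else [::].

Fixpoint ncnorm (e : ncexp) : ncpoly :=
  match e with
  | NcVar i => [:: (1, [:: i])]
  | NcZero => [::]
  | NcOne => [:: (1, [::])]
  | NcAdd e1 e2 => ncapp (ncnorm e1) (ncnorm e2)
  | NcOpp e1 => ncmap (fun t : K * seq nat => (- t.1, t.2)) (ncnorm e1)
  | NcMul e1 e2 => ncprod (ncnorm e1) (ncnorm e2)
  | NcScale c e1 => ncmap (fun t : K * seq nat => (c * t.1, t.2)) (ncnorm e1)
  end.

Lemma ncval_app env l1 l2 : ncval env (ncapp l1 l2) = ncval env l1 + ncval env l2.
Proof. by elim: l1 => [|t l1 IH] /=; rewrite ?add0r // IH addrA. Qed.

Lemma ncword_app env m1 m2 : ncword env (ncapp m1 m2) = ncword env m1 * ncword env m2.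
Proof. by elim: m1 => [|i m1 IH] /=; rewrite ?mul1r // IH mulrA. Qed.

Lemma ncval_prod env l1 l2 : ncval env (ncprod l1 l2) = ncval env l1 * ncval env l2.
Proof.
elim: l1 => [|t l1 IH] /=; first by rewrite mul0r.
rewrite ncval_app IH mulrDl; congr (_ + _).
elim: l2 {IH} => [|u l2 IH] /=; first by rewrite mulr0.
by rewrite IH mulrDr; congr (_ + _); rewrite ncword_app -scalerAl -scalerAr scalerA.
Qed.

Lemma ncval_norm env e : ncval env (ncnorm e) = nceval env e.
Proof.
elim: e => [i| | |e1 IH1 e2 IH2|e1 IH1|e1 IH1 e2 IH2|c e1 IH1] /=.
- by rewrite scale1r mulr1 addr0.
- by [].
- by rewrite scale1r addr0.
- by rewrite ncval_app IH1 IH2.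
- rewrite -IH1; elim: (ncnorm e1) => [|t l IH] /=; first by rewrite oppr0.
  by rewrite IH scaleNr opprD.
- by rewrite ncval_prod IH1 IH2.
- rewrite -IH1; elim: (ncnorm e1) => [|t l IH] /=; first by rewrite scaler0.
  by rewrite IH scalerDr scalerA.
Qed.

Fixpoint nceqn (m n : nat) : bool :=
  match m, n with
  | 0%N, 0%N => true | S m', S n' => nceqn m' n' | _, _ => false end.

Fixpoint nceqm (s t : seq nat) : bool :=
  match s, t with
  | [::], [::] => true
  | x :: s', y :: t' => if nceqn x y then nceqm s' t' else false
  | _, _ => false end.

Lemma nceqnP m n : nceqn m n -> m = n.
Proof. by elim: m n => [|m IH] [|n] //= /IH ->. Qed.

Lemma nceqmP s t : nceqm s t -> s = t.
Proof.
by elim: s t => [|x s IH] [|y t] //=; case E: (nceqn x y) => // /IH ->; rewrite (nceqnP E).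
Qed.

Fixpoint nccoef (m : seq nat) (l : ncpoly) : K :=
  if l is t :: l' then if nceqm m t.2 then t.1 + nccoef m l' else nccoef m l' else 0.

Fixpoint ncrest (m : seq nat) (l : ncpoly) : ncpoly :=
  if l is t :: l' then if nceqm m t.2 then ncrest m l' else t :: ncrest m l' else [::].

(** One scalar equation for each distinct word. [ncrest] does not return a subterm, so the recursion
    runs on a fuel, for which the length of the list is enough. *)
Fixpoint nczero (fuel : nat) (l : ncpoly) : Prop :=
  match fuel, l with
  | _, [::] => True
  | S fuel', t :: l' => t.1 + nccoef t.2 l' = 0 /\ nczero fuel' (ncrest t.2 l')
  | _, _ => False
  end.

Lemma ncval_split env m l :
  ncval env l = nccoef m l *: ncword env m + ncval env (ncrest m l).
Proof.
elim: l => [|t l IH] /=; first by rewrite scale0r addr0.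
case E: (nceqm m t.2) => /=; last by rewrite IH addrCA.
by rewrite IH (nceqmP E) scalerDl addrA.
Qed.

Lemma nczeroP env fuel l : nczero fuel l -> ncval env l = 0.
Proof.
elim: fuel l => [|fuel IH] [|t l] //= [h1 /IH h2].
by rewrite (ncval_split env t.2 l) addrA -scalerDl h1 scale0r add0r h2.
Qed.

Fixpoint nclen (l : ncpoly) : nat := if l is _ :: l' then S (nclen l') else 0%N.

Lemma nc_correct env e1 e2 :
  (let l := ncnorm (NcAdd e1 (NcOpp e2)) in nczero (nclen l) l) ->
  nceval env e1 = nceval env e2.
Proof.
move=> /= /nczeroP h; apply/eqP; rewrite -subr_eq0; apply/eqP.
exact: etrans (esym (ncval_norm env (NcAdd e1 (NcOpp e2)))) (h _).
Qed.

End NcAlgebra.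

Ltac nc_in x env :=
  lazymatch env with
  | nil => false | cons x _ => true | cons _ ?env' => nc_in x env' end.
Ltac nc_index x env :=
  lazymatch env with
  | cons x _ => O | cons _ ?env' => let n := nc_index x env' in constr:(S n) end.
Ltac nc_add x env :=
  let b := nc_in x env in
  lazymatch b with true => env | false => constr:(cons x env) end.
Ltac nc_atoms t env :=
  lazymatch t with
  | (?a + ?b)%R => let env := nc_atoms a env in nc_atoms b env
  | (- ?a)%R => nc_atoms a env
  | (?a * ?b)%R => let env := nc_atoms a env in nc_atoms b env
  | (?c *: ?a)%R => nc_atoms a env
  | (?a ^+ 2)%R => nc_atoms a env
  | 1%R => env
  | 0%R => env
  | _ => nc_add t env
  end.
Ltac nc_reify K t env :=
  lazymatch t with
  | (?a + ?b)%R =>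
      let ea := nc_reify K a env in let eb := nc_reify K b env in constr:(NcAdd ea eb)
  | (- ?a)%R => let ea := nc_reify K a env in constr:(NcOpp ea)
  | (?a * ?b)%R =>
      let ea := nc_reify K a env in let eb := nc_reify K b env in constr:(NcMul ea eb)
  | (?c *: ?a)%R => let ea := nc_reify K a env in constr:(@NcScale K c ea)
  | (?a ^+ 2)%R => let ea := nc_reify K a env in constr:(NcMul ea ea)
  | 1%R => constr:(NcOne K)
  | 0%R => constr:(NcZero K)
  | _ => let n := nc_index t env in constr:(NcVar K n)
  end.
(* Reduces an identity in an algebra over [CC] to identities between the coefficients of the words in its atoms. *)
Ltac ncalg_core :=
  lazymatch goal with
  | |- @eq ?T ?a ?b =>
    let env := nc_atoms a (@nil T) in
    let env := nc_atoms b env in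
    let K := constr:((CC : comNzRingType)) in
    let ea := nc_reify K a env in
    let eb := nc_reify K b env in
    apply: (@nc_correct K _ env ea eb);
    cbv [ncnorm nczero nclen nccoef ncrest nceqm nceqn ncapp ncmap ncprod fst snd];
    repeat (apply: conj); try exact: I
  end.
Ltac ncalg := ncalg_core; try (by ring); try (by field).

Notation "a ^†" := (cs_star a) (at level 2, format "a ^†") : ring_scope.
Notation nm := (@cs_norm _).
Notation "r %:S" := ((r%:C)%C%:A) (at level 2, format "r %:S") : ring_scope.
Notation half := ((2^-1 : RR)%:C)%C.
Notation iC := ('i%C : CC).

Ltac cplx := apply/eqP; rewrite eq_complex /=; apply/andP; split; apply/eqP; (ring || field).

(** * Norms and sequences *)

Section Basics.
Variable A : cstar.
Implicit Types (a b c x y : A) (r : RR).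

Lemma st0 : (0 : A)^† = 0.
Proof. by have := cs_starZ 0 (0 : A); rewrite !scale0r conjc0 scale0r. Qed.
Lemma stN a : (- a)^† = - a^†.
Proof. by rewrite -scaleN1r cs_starZ (_ : (-1)^* = -1) ?scaleN1r //; cplx. Qed.
Lemma stB a b : (a - b)^† = a^† - b^†.
Proof. by rewrite cs_starD stN. Qed.
Lemma st1 : (1 : A)^† = 1.
Proof.
have h : (1 : A)^† * 1 = 1 by rewrite -[X in _ * X]cs_starK -cs_starM mulr1 cs_starK.
by rewrite -[LHS]mulr1.
Qed.
Lemma stR r a : (r%:C *: a)^† = r%:C *: a^†.
Proof. by rewrite cs_starZ conjc_real. Qed.
Lemma stI a : (iC *: a)^† = - (iC *: a^†).
Proof. by rewrite cs_starZ -scaleNr; congr (_ *: _); cplx. Qed.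
Lemma stS r : (r%:S : A)^† = r%:S.
Proof. by rewrite stR st1. Qed.

Definition stE := (cs_starD, cs_starM, stR, stI, stN, st1, st0, cs_starK).

Lemma cabsR r : cabs r%:C = `|r|.
Proof. by rewrite /cabs /ComplexField.Normc.normc /= expr0n addr0 sqrtr_sqr. Qed.
Lemma cabs_ge0 (c : CC) : 0 <= cabs c.
Proof. by case: c => a b; apply: sqrtr_ge0. Qed.

Lemma nm0 : nm (0 : A) = 0.
Proof. by rewrite -(scale0r (0 : A)) cs_normZ (_ : 0 = 0%:C) // cabsR normr0 mul0r. Qed.
Lemma nmZ r a : nm (r%:C *: a) = `|r| * nm a.
Proof. by rewrite cs_normZ cabsR. Qed.
Lemma nmN a : nm (- a) = nm a.
Proof. by rewrite -scaleN1r (_ : -1 = (-1)%:C) ?nmZ ?normrN ?normr1 ?mul1r // rmorphN. Qed.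
Lemma nm_ge0 a : 0 <= nm a.
Proof. by have := cs_normD a (- a); rewrite subrr nm0 nmN; lra. Qed.
Lemma nmB a b : nm (a - b) = nm (b - a).
Proof. by rewrite -nmN opprB. Qed.
Lemma nm_tri b a c : nm (a - c) <= nm (a - b) + nm (b - c).
Proof. by have := cs_normD (a - b) (b - c); rewrite addrA subrK. Qed.

Lemma nm_eq0 a : nm a <= 0 -> a = 0.
Proof. by move=> h; apply: cs_norm_eq0; have := nm_ge0 a; lra. Qed.

Lemma nm_st a : nm a^† = nm a.
Proof.
have le b : nm b <= nm b^†.
  have [->|h] := eqVneq (nm b) 0; first exact: nm_ge0.
  have h0 : 0 < nm b by rewrite lt_def h nm_ge0.
  by rewrite -(ler_pM2r h0) -expr2 -cs_cstar_id cs_normM.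
by apply/eqP; rewrite eq_le le andbT; have := le (a^†); rewrite cs_starK.
Qed.

Lemma nm_sq a : selfadj a -> nm (a * a) = nm a ^+ 2.
Proof. by move=> h; rewrite -cs_cstar_id h. Qed.

Lemma nm1 : nm (1 : A) = 1.
Proof.
have h := nm_sq st1; rewrite mulr1 in h.
have h0 : nm (1 : A) != 0.
  by apply/eqP => /cs_norm_eq0/eqP; rewrite oner_eq0.
by apply: (mulfI h0); rewrite mulr1 -expr2 -h.
Qed.

Lemma nmS r : nm (r%:S : A) = `|r|.
Proof. by rewrite nmZ nm1 mulr1. Qed.

Lemma sa_D a b : selfadj a -> selfadj b -> selfadj (a + b).
Proof. by rewrite /selfadj cs_starD => -> ->. Qed.
Lemma sa_N a : selfadj a -> selfadj (- a).
Proof. by rewrite /selfadj stN => ->. Qed.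
Lemma sa_B a b : selfadj a -> selfadj b -> selfadj (a - b).
Proof. by move=> ha hb; apply: sa_D => //; apply: sa_N. Qed.
Lemma sa_Z r a : selfadj a -> selfadj (r%:C *: a).
Proof. by rewrite /selfadj stR => ->. Qed.
Lemma sa_0 : selfadj (0 : A). Proof. exact: st0. Qed.
Lemma sa_1 : selfadj (1 : A). Proof. exact: st1. Qed.
Lemma sa_S r : selfadj (r%:S : A). Proof. exact: stS. Qed.
Lemma sa_stM a : selfadj (a^† * a).
Proof. by rewrite /selfadj !stE. Qed.
Lemma sa_sq a : selfadj a -> selfadj (a * a).
Proof. by rewrite /selfadj !stE => ->. Qed.
Lemma sa_conj v a : selfadj a -> selfadj (v^† * a * v).
Proof. by rewrite /selfadj !stE mulrA => ->. Qed.
Lemma sa_comm a b : selfadj a -> selfadj b -> a * b = b * a -> selfadj (a * b).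
Proof. by rewrite /selfadj !stE => -> ->. Qed.

Definition rpart a : A := half *: (a + a^†).
Definition ipart a : A := (- iC * half) *: (a - a^†).
Lemma sa_rpart a : selfadj (rpart a).
Proof. by rewrite /selfadj /rpart !stE addrC. Qed.
Lemma sa_ipart a : selfadj (ipart a).
Proof.
rewrite /selfadj /ipart cs_starZ stB cs_starK -opprB scalerN -scaleNr; congr (_ *: _).
cplx.
Qed.

Lemma iC2 : iC * iC = -1.
Proof. by rewrite -expr2 sqr_i. Qed.
Lemma half2 : half + half = 1 :> CC.
Proof. by rewrite -rmorphD /= (_ : 2^-1 + 2^-1 = 1) // ; field. Qed.
Lemma ripart a : a = rpart a + iC *: ipart a.
Proof.
rewrite /rpart /ipart scalerA mulrA mulrN iC2 opprK mul1r -scalerDr.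
by rewrite addrACA subrr addr0 scalerDr -scalerDl half2 scale1r.
Qed.

Definition cvgA (u : nat -> A) l :=
  forall e : RR, 0 < e -> exists N, forall n, (N <= n)%N -> nm (u n - l) < e.
Definition closedA (P : A -> Prop) := forall u l, (forall n, P (u n)) -> cvgA u l -> P l.

Lemma cvgA_cst a : cvgA (fun=> a) a.
Proof. by move=> e e0; exists 0%N => n _; rewrite subrr nm0. Qed.

Lemma cvgAD u v l m : cvgA u l -> cvgA v m -> cvgA (fun n => u n + v n) (l + m).
Proof.
move=> hu hv e e0; have e2 : 0 < e / 2 by lra.
have [N1 h1] := hu _ e2; have [N2 h2] := hv _ e2.
exists (maxn N1 N2) => n; rewrite geq_max => /andP[n1 n2].
have := cs_normD (u n - l) (v n - m); rewrite addrACA -opprD.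
by have := h1 _ n1; have := h2 _ n2; lra.
Qed.

Lemma cvgA_lip (f : A -> A) (C : RR) u l :
  (forall a b, nm (f a - f b) <= C * nm (a - b)) -> cvgA u l -> cvgA (f \o u) (f l).
Proof.
move=> hf hu e e0; have C0 : 0 < `|C| + 1 by have := normr_ge0 C; lra.
have [N h] := hu (e / (`|C| + 1)) (divr_gt0 e0 C0).
exists N => n /h; rewrite ltr_pdivlMr // => hn; apply: le_lt_trans hn.
apply: le_trans (hf _ _) _; rewrite mulrC ler_wpM2l ?nm_ge0 //.
by have := ler_norm C; lra.
Qed.

Lemma cvgAMl a u l : cvgA u l -> cvgA (fun n => a * u n) (a * l).
Proof. by apply: (@cvgA_lip (fun x => a * x) (nm a)) => x y; rewrite -mulrBr cs_normM. Qed.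
Lemma cvgAMr a u l : cvgA u l -> cvgA (fun n => u n * a) (l * a).
Proof. by apply: (@cvgA_lip (fun x => x * a) (nm a)) => x y; rewrite -mulrBl mulrC cs_normM. Qed.
Lemma cvgAZ (c : CC) u l : cvgA u l -> cvgA (fun n => c *: u n) (c *: l).
Proof. by apply: (@cvgA_lip (fun x => c *: x) (cabs c)) => x y; rewrite -scalerBr cs_normZ. Qed.
Lemma cvgAst u l : cvgA u l -> cvgA (fun n => (u n)^†) l^†.
Proof. by apply: (@cvgA_lip (fun x => x^†) 1) => x y; rewrite -stB nm_st mul1r. Qed.
Lemma cvgAN u l : cvgA u l -> cvgA (fun n => - u n) (- l).
Proof. by apply: (@cvgA_lip (fun x => - x) 1) => x y; rewrite -opprD nmN mul1r. Qed.
Lemma cvgA_S u l : cvgA u l -> cvgA (fun n => u n.+1) l.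
Proof. by move=> h e /h[N hN]; exists N => n /leqW; exact: hN. Qed.

Lemma cvgA_unique u l m : cvgA u l -> cvgA u m -> l = m.
Proof.
move=> hl hm; apply/eqP; rewrite -subr_eq0; apply/eqP/nm_eq0; rewrite leNgt; apply/negP => h.
have [N1 h1] := hl _ (divr_gt0 h (ltr0n _ 2)); have [N2 h2] := hm _ (divr_gt0 h (ltr0n _ 2)).
have := nm_tri (u (maxn N1 N2)) l m; rewrite (nmB l (u _)).
by have := h1 _ (leq_maxl N1 N2); have := h2 _ (leq_maxr N1 N2); lra.
Qed.

Lemma cvgA_bounded u l : cvgA u l -> exists M, forall n, nm (u n) <= M.
Proof.
move=> h; have [N hN] := h 1 ltr01.
exists (nm l + 1 + \sum_(i < N) nm (u i)) => n.
have s0 : 0 <= \sum_(i < N) nm (u i) by apply: sumr_ge0 => i _; apply: nm_ge0.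
have [/hN h1|nN] := leqP N n.
  by have := cs_normD (u n - l) l; rewrite subrK; lra.
have : nm (u n) <= \sum_(i < N) nm (u i).
  rewrite (bigD1 (Ordinal nN)) //= lerDl; apply: sumr_ge0 => i _; exact: nm_ge0.
by have := nm_ge0 l; lra.
Qed.

Lemma cvgA_sq u l : cvgA u l -> cvgA (fun n => u n * u n) (l * l).
Proof.
move=> h; have [M hM] := cvgA_bounded h.
have h1 := cvgAMl l h.
have M0 : 0 <= M := le_trans (nm_ge0 _) (hM 0%N).
move=> e e0; have p0 : 0 < M + nm l + 1 by have := nm_ge0 l; lra.
have [N hN] := h (e / (M + nm l + 1)) (divr_gt0 e0 p0).
exists N => n /hN; rewrite ltr_pdivlMr // => hn.
rewrite (_ : u n * u n - l * l = u n * (u n - l) + (u n - l) * l); last by ncalg.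
apply: le_lt_trans hn; apply: le_trans (cs_normD _ _) _.
have a1 := cs_normM (u n) (u n - l); have a2 := cs_normM (u n - l) l.
have a3 : nm (u n) * nm (u n - l) <= M * nm (u n - l) by rewrite ler_wpM2r ?nm_ge0.
have a4 := nm_ge0 (u n - l).
by nra.
Qed.

Lemma closed_sa : closedA (@selfadj A).
Proof.
move=> u l hu hl; apply: cvgA_unique (hl); rewrite (_ : u = fun n => (u n)^†).
  exact: cvgAst.
by apply/funext => n; rewrite (hu n).
Qed.

Lemma closed_ball a r : closedA (fun x => nm (a - x) <= r).
Proof.
move=> u l hu hl; rewrite leNgt; apply/negP => h.
have [N hN] := hl (nm (a - l) - r) ltac:(lra).
by have := hN _ (leqnn N); have := hu N; have := nm_tri (u N) a l; lra.
Qed.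
End Basics.

(** * Square roots, positivity and inverses *)

Lemma real_mono_le (r : nat -> RR) m n :
  (forall n, r n <= r n.+1) -> (n <= m)%N -> r n <= r m.
Proof.
move=> mono /subnK <-; elim: (m - n)%N => [|k IH]; first by rewrite add0n.
by apply: le_trans IH _; rewrite addSn.
Qed.

Lemma real_mono_lim (r : nat -> RR) (M : RR) :
  (forall n, r n <= r n.+1) -> (forall n, r n <= M) ->
  exists l, (forall n, r n <= l) /\
    (forall e, 0 < e -> exists N, forall n, (N <= n)%N -> l - e < r n).
Proof.
move=> mono bd; set E := [set r n | n in setT]%classic.
have hs : has_sup E.
  by split; [exists (r 0%N), 0%N | exists M => _ [n _ <-]].
exists (sup E); split=> [n|e e0].
  by apply: (sup_upper_bound hs); exists n.
have [_ [N _ <-] hN] := sup_adherent e0 hs.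
exists N => n Nn; apply: lt_le_trans hN _.
exact: real_mono_le.
Qed.

Section SquareRoots.
Variable A : cstar.
Implicit Types (a b c x y h k : A) (r M : RR).

(** Closed unital subalgebras, not assumed stable under the adjoint. A conclusion
    [forall P, csub P -> P a -> P y] says that [y] lies in the closed unital algebra generated by
    [a]. It stands in for functional calculus; with [P] a commutant it yields commutation. *)
Record csub (P : A -> Prop) : Prop := Csub {
  csub1 : P 1;
  csubL : forall (c : CC) a b, P a -> P b -> P (c *: a + b);
  csubM : forall a b, P a -> P b -> P (a * b);
  csub_closed : closedA P }.

Lemma csub0 P : csub P -> P 0.
Proof. by case=> h1 hL _ _; have := hL (-1) _ _ h1 h1; rewrite scaleN1r addNr. Qed.
Lemma csubZ P (c : CC) a : csub P -> P a -> P (c *: a).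
Proof. by move=> hP ha; rewrite -[_ *: _]addr0; apply: (csubL hP) => //; apply: csub0. Qed.
Lemma csubD P a b : csub P -> P a -> P b -> P (a + b).
Proof. by move=> hP ha hb; rewrite -[a]scale1r; apply: (csubL hP). Qed.
Lemma csubB P a b : csub P -> P a -> P b -> P (a - b).
Proof. by move=> hP ha hb; rewrite addrC -[- b]scaleN1r; apply: (csubL hP). Qed.

Lemma csub_comm c : csub (fun a => a * c = c * a).
Proof.
split.
- by rewrite mul1r mulr1.
- by move=> k a b ha hb; rewrite mulrDl mulrDr -scalerAl -scalerAr ha hb.
- by move=> a b ha hb; rewrite -mulrA hb mulrA ha mulrA.
- move=> u l hu hl; apply: cvgA_unique (cvgAMr c hl) _.
  by rewrite (_ : (fun _ => _) = (fun n => c * u n)); [apply: cvgAMl | apply/funext => n].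
Qed.

(** A fixed point [y] of [y := (x + y * y) / 2] satisfies [(1 - y) * (1 - y) = 1 - x]. The numbers
    [rit] are the same iteration at [x = 1], where it increases and stays below 1; they dominate it
    whenever [nm x <= 1]. *)
Fixpoint sqit x (n : nat) : A :=
  if n is m.+1 then half *: (x + sqit x m * sqit x m) else 0.

Fixpoint rit (n : nat) : RR := if n is m.+1 then (1 + rit m * rit m) / 2 else 0.

Lemma rit01 n : 0 <= rit n <= 1.
Proof. by elim: n => [|n /andP[h0 h1]] /=; apply/andP; split; nra. Qed.
Lemma rit_mono n : rit n <= rit n.+1.
Proof. by have /andP[h0 h1] := rit01 n; rewrite /=; nra. Qed.

(** Two arguments [x] and [z] are allowed because [Pos_intertwine] needs intertwining; [z = x] is
    commutation. *)
Lemma sqit_comm c x z n : x * c = c * z -> sqit x n * c = c * sqit z n.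
Proof.
move=> h; elim: n => [|n IH] /=; first by rewrite mul0r mulr0.
rewrite -scalerAl -scalerAr mulrDl mulrDr h; congr (_ *: (_ + _)).
by rewrite -mulrA IH mulrA IH mulrA.
Qed.

Lemma nm_half a : nm (half *: a) = nm a / 2.
Proof. rewrite nmZ ger0_norm 1?mulrC; lra. Qed.

Lemma nm_sqit x n : nm x <= 1 -> nm (sqit x n) <= rit n.
Proof.
move=> hx; elim: n => [|n IH] /=; first by rewrite nm0.
rewrite nm_half; have := cs_normD x (sqit x n * sqit x n).
have := cs_normM (sqit x n) (sqit x n); have := nm_ge0 (sqit x n).
by nra.
Qed.

Lemma sqitS x n : sqit x n.+1 = half *: (x + sqit x n * sqit x n).
Proof. by []. Qed.
Lemma ritS n : rit n.+1 = (1 + rit n * rit n) / 2.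
Proof. by []. Qed.

(** The iterates commute, so a difference of consecutive squares factors as a sum times a
    difference; the sum is bounded by the scalar sum and the difference by induction. *)
Lemma nm_sqitS x n : nm x <= 1 -> nm (sqit x n.+1 - sqit x n) <= rit n.+1 - rit n.
Proof.
move=> hx; elim: n => [|n IH].
  by rewrite ritS sqitS /= mulr0 mul0r !addr0 !subr0 nm_half; lra.
have hc : sqit x n.+1 * sqit x n = sqit x n * sqit x n.+1.
  by apply: sqit_comm; rewrite (sqit_comm _ (erefl (x * x))).
have -> : sqit x n.+2 - sqit x n.+1 =
    half *: ((sqit x n.+1 + sqit x n) * (sqit x n.+1 - sqit x n)).
  rewrite sqitS [X in _ - X = _]sqitS -scalerBr; congr (_ *: _).
  transitivity (sqit x n.+1 * sqit x n.+1 - sqit x n * sqit x n); first by ncalg.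
  by rewrite mulrDl !mulrBr hc addrA subrK.
have -> : rit n.+2 - rit n.+1 = (rit n.+1 * rit n.+1 - rit n * rit n) / 2.
  by rewrite ritS [X in _ - X = _]ritS; field.
rewrite nm_half.
have h1 := cs_normM (sqit x n.+1 + sqit x n) (sqit x n.+1 - sqit x n).
have h2 := cs_normD (sqit x n.+1) (sqit x n).
have h3 := nm_sqit n.+1 hx; have h4 := nm_sqit n hx.
have h5 := nm_ge0 (sqit x n.+1 - sqit x n).
have /andP[r0 _] := rit01 n; have h6 := nm_ge0 (sqit x n.+1 + sqit x n).
set p := rit n.+1 in IH h3 *; set q := rit n in IH h4 r0 *.
have h7 : nm (sqit x n.+1 + sqit x n) <= p + q by lra.
have h8 := ler_pM h6 h5 h7 IH; lra.
Qed.

Lemma sqit_diff x m n : nm x <= 1 -> (n <= m)%N -> nm (sqit x m - sqit x n) <= rit m - rit n.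
Proof.
move=> hx /subnK <-; elim: (m - n)%N => [|k IH]; first by rewrite add0n !subrr nm0.
by have := nm_tri (sqit x (k + n)) (sqit x (k + n).+1) (sqit x n); have := nm_sqitS (k + n) hx; rewrite addSn; lra.
Qed.

(** At [nm x = 1] there is no geometric rate. The increments are dominated by those of the bounded
    increasing sequence [rit], which makes the iterates Cauchy. *)
Lemma sqit_cvg x : nm x <= 1 ->
  exists2 y, cvgA (sqit x) y & y = half *: (x + y * y).
Proof.
move=> hx.
have [l [hl1 hl2]] := real_mono_lim rit_mono (fun n => (andP (rit01 n)).2).
have [y hy] : exists y, cvgA (sqit x) y.
  apply: cs_complete => e e0; have [N hN] := hl2 _ e0; exists N.
  have main m n : (N <= n)%N -> (n <= m)%N -> nm (sqit x m - sqit x n) < e.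
    move=> Nn nm; have := sqit_diff hx nm; have := hN _ Nn; have := hl1 m; lra.
  move=> m n Nm Nn; have [nm|/ltnW mn] := leqP n m; first exact: main.
  by rewrite nmB; apply: main.
exists y => //; apply: cvgA_unique (cvgA_S hy) _.
apply: cvgAZ; apply: cvgAD; [exact: cvgA_cst | exact: cvgA_sq].
Qed.

Lemma sqrt1m x : nm x <= 1 -> exists y,
  [/\ cvgA (sqit x) y, nm y <= 1, (1 - y) * (1 - y) = 1 - x,
      selfadj x -> selfadj y & forall P, csub P -> P x -> P y].
Proof.
move=> hx; have [y hy yE] := sqit_cvg hx; exists y; split=> //.
- have := @closed_ball A 0 1 (sqit x) y; rewrite sub0r nmN; apply=> // n.
  by rewrite sub0r nmN; apply: le_trans (nm_sqit n hx) (andP (rit01 n)).2.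
- have -> : (1 - y) * (1 - y) = 1 - (y + y) + y * y by ncalg.
  rewrite [in y + y]yE -scalerDl half2 scale1r; ncalg.
- move=> sx; apply: closed_sa hy => n; elim: n => [|n IH] /=; first exact: sa_0.
  by apply: sa_Z; apply: sa_D => //; apply: sa_sq.
- move=> P hP Px; apply: (csub_closed hP) hy => n; elim: n => [|n IH] /=; first exact: csub0.
  by apply: csubZ => //; apply: csubD => //; apply: csubM.
Qed.

(* Spectral positivity in a form that is visibly stable under sums and limits and does not depend on the ambient algebra. *)
Definition Pos a := selfadj a /\ exists M, nm (M%:S - a) <= M.

Lemma Pos_sa a : Pos a -> selfadj a. Proof. by case. Qed.

Lemma Pos0 : Pos (0 : A).
Proof. by split; [exact: sa_0 | exists 0; rewrite scale0r subr0 nm0]. Qed.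

Lemma rS (r s : RR) : (r%:S : A) * s%:S = (r * s)%:S.
Proof. by rewrite -scalerAl mul1r scalerA -rmorphM. Qed.
Lemma rSD (r s : RR) : (r%:S : A) + s%:S = (r + s)%:S.
Proof. by rewrite -scalerDl -rmorphD. Qed.
Lemma rSM (r : RR) a : r%:S * a = r%:C *: a.
Proof. by rewrite -scalerAl mul1r. Qed.
Lemma rMS (r : RR) a : a * r%:S = r%:C *: a.
Proof. by rewrite -scalerAr mulr1. Qed.

Lemma Pos_D a b : Pos a -> Pos b -> Pos (a + b).
Proof.
move=> [sa [M hM]] [sb [N hN]]; split; first exact: sa_D.
exists (M + N); rewrite -rSD opprD addrACA.
by apply: le_trans (cs_normD _ _) _; apply: lerD.
Qed.

Lemma Pos_Z r a : 0 <= r -> Pos a -> Pos (r%:C *: a).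
Proof.
move=> r0 [sa [M hM]]; split; first exact: sa_Z.
exists (r * M); rewrite -rS rSM -scalerBr nmZ ger0_norm //.
by rewrite ler_wpM2l.
Qed.

(** [u = k + i g] satisfies [u^† * u = M] and has real part [k], so the C*-identity bounds [k]. The
    absolute value is there because the sign of [M] is unknown when [nm_le_Pos] uses this. *)
Lemma nm_unitary_part k g M : selfadj k -> selfadj g -> k * g = g * k ->
  k * k + g * g = M%:S -> nm k ^+ 2 <= `|M|.
Proof.
move=> sk sg kg h; pose u := k + iC *: g.
have uu : u^† * u = M%:S.
  rewrite -h /u cs_starD stI sk sg.
  transitivity (k * k + iC *: (k * g - g * k) - (iC * iC) *: (g * g)); first by ncalg.
  by rewrite kg subrr scaler0 addr0 iC2 scaleN1r opprK.
have -> : k = half *: (u^† + u).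
  by rewrite /u cs_starD stI sk sg addrACA addNr addr0 -[X in X + X]scale1r -scalerDl scalerA mulrDr mulr1 half2 scale1r.
rewrite -(nmS A) -uu cs_cstar_id ler_pXn2r ?nnegrE ?nm_ge0 // nm_half.
by have := cs_normD u^† u; rewrite nm_st; lra.
Qed.

(** After scaling to [nm (g * g) <= 1], the square root [1 - y] of [1 - g * g] is the real part of
    the unitary [(1 - y) + i g]; hence it has norm at most 1, and so has its square. *)
Lemma nm_sqB h M : selfadj h -> nm h ^+ 2 <= M -> nm (M%:S - h * h) <= M.
Proof.
move=> sh hM; have M0 : 0 <= M by apply: le_trans hM; rewrite exprn_ge0 ?nm_ge0.
have [M0'|Mn0] := eqVneq M 0.
  have -> : h = 0.
    apply: cs_norm_eq0; apply/eqP; rewrite -sqrf_eq0 eq_le exprn_ge0 ?nm_ge0 // andbT.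
    by rewrite -M0'.
  by rewrite mul0r subr0 M0' nmS normr0.
have Mp : 0 < M by rewrite lt_def Mn0.
pose s := Num.sqrt M; have s0 : 0 < s by rewrite sqrtr_gt0.
have ss : s * s = M by rewrite -expr2 sqr_sqrtr.
pose g := s^-1%:C *: h; have sg : selfadj g by apply: sa_Z.
have hg : s%:C *: g = h.
  by rewrite /g scalerA -rmorphM /= divff ?gt_eqF // scale1r.
clearbody g; have ng : nm (g * g) <= 1.
  rewrite nm_sq // -(ler_pM2r Mp) mul1r; apply: le_trans hM.
  by rewrite -hg nmZ (gtr0_norm s0) exprMn (expr2 s) ss mulrC.
have [y [_ _ yE sy hP]] := sqrt1m ng.
have skg : (1 - y) * g = g * (1 - y).
  rewrite mulrBl mulrBr mul1r mulr1; congr (_ - _).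
  by apply: (hP _ (csub_comm g)); rewrite mulrA.
have sk : selfadj (1 - y) by apply: sa_B; [exact: sa_1 | apply/sy/sa_sq].
have := @nm_unitary_part (1 - y) g 1 sk sg skg; rewrite yE scale1r subrK normr1 => /(_ (erefl _)) nk.
have -> : M%:S - h * h = M%:C *: (1 - g * g).
  by rewrite -hg -scalerAl -scalerAr scalerA -rmorphM /= ss scalerBr.
rewrite nmZ gtr0_norm // -yE nm_sq // -{2}[M]mulr1.
by rewrite ler_wpM2l // ltW.
Qed.

Lemma Pos_sq h : selfadj h -> Pos (h * h).
Proof. by move=> sh; split; [exact: sa_sq | exists (nm h ^+ 2); apply: nm_sqB]. Qed.

Lemma Pos_sqrt a : Pos a -> exists h,
  [/\ selfadj h, h * h = a, Pos h & forall P, csub P -> P a -> P h].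
Proof.
move=> [sa [M hM]]; have M0 := le_trans (nm_ge0 _) hM.
have [M0'|Mn0] := eqVneq M 0.
  exists 0; split; [exact: sa_0 | | exact: Pos0 | by move=> P hP _; apply: csub0].
  rewrite mul0r; apply/esym/nm_eq0; move: hM; rewrite M0' scale0r sub0r nmN; lra.
have Mp : 0 < M by rewrite lt_def Mn0.
(* Chosen so that [a = M * (1 - x)] with [nm x <= 1], the range where [sqrt1m] applies. *)
pose x := 1 - M^-1%:C *: a.
have sx : selfadj x by apply: sa_B; [exact: sa_1 | exact: sa_Z].
have aE : a = M%:C *: (1 - x).
  by rewrite /x opprB addrC subrK scalerA -rmorphM /= divff // scale1r.
have nx : nm x <= 1.
  rewrite -(ler_pM2l Mp) mulr1; apply: le_trans hM; rewrite aE scalerBr opprB addrC subrK.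
  by rewrite nmZ gtr0_norm.
have [y [_ ny yE /(_ sx) sy hP]] := sqrt1m nx.
pose s := Num.sqrt M; have s0 : 0 < s by rewrite sqrtr_gt0.
have ss : s * s = M by rewrite -expr2 sqr_sqrtr.
have sk : selfadj (1 - y) by apply: sa_B => //; exact: sa_1.
exists (s%:C *: (1 - y)); split.
- exact: sa_Z.
- by rewrite -scalerAl -scalerAr scalerA -rmorphM /= ss yE -aE.
- split; first exact: sa_Z.
  exists s; rewrite scalerBr opprB addrC subrK nmZ gtr0_norm // -{2}[s]mulr1.
  by rewrite ler_wpM2l // ltW.
- move=> P hPs Pa; apply: csubZ => //; apply: csubB => //; first exact: csub1.
  apply: hP => //; apply: csubB => //; [exact: csub1 | exact: csubZ].
Qed.

(** Any bound of the norm can serve as the constant in [Pos]. It can thus be chosen uniformly along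
    a convergent sequence, which makes the cone closed. *)
Lemma Pos_nmB a M : Pos a -> nm a <= M -> nm (M%:S - a) <= M.
Proof.
move=> /Pos_sqrt[h [sh <- _ _]] hM; apply: nm_sqB => //.
by rewrite -nm_sq.
Qed.

Lemma closed_Pos : closedA Pos.
Proof.
move=> u l hu hl; split; first by apply: closed_sa hl => n; case: (hu n).
have [M hM] := cvgA_bounded hl; exists M.
by apply: (closed_ball (u := u)) hl => n; apply: Pos_nmB.
Qed.

Lemma Pos_mul a b : Pos a -> Pos b -> a * b = b * a -> Pos (a * b).
Proof.
move=> /Pos_sqrt[h [sh <- _ ha]] /Pos_sqrt[k [sk <- _ kb]] ab.
have hb : h * (k * k) = (k * k) * h by apply: (ha _ (csub_comm _)).
have hk : k * h = h * k by apply: (kb _ (csub_comm _)).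
have -> : h * h * (k * k) = (h * k) * (h * k).
  by rewrite -!mulrA; congr (_ * _); rewrite mulrA -hk -mulrA hk mulrA.
by apply: Pos_sq; apply: sa_comm.
Qed.

(** With [a = h * h] and [M - a = k * k] for commuting [h] and [k], [nm_unitary_part] applies to
    [h + i k]. *)
Lemma nm_le_Pos a M : Pos a -> Pos (M%:S - a) -> nm a <= M.
Proof.
move=> /Pos_sqrt[h [sh <- _ ha]] /Pos_sqrt[k [sk kE _ kb]].
have kh : k * h = h * k.
  apply: (kb _ (csub_comm _)); rewrite mulrBl mulrBr rSM rMS; congr (_ - _).
  by rewrite mulrA.
have := @nm_unitary_part h k M sh sk (esym kh); rewrite kE addrC subrK => /(_ (erefl _)).
rewrite -nm_sq // => hM.
have : 0 <= M; last by move=> M0; rewrite ger0_norm in hM.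
have [//|M0] := leP 0 M.
(* The scalar [M] is a sum of two squares, hence positive; for [M < 0] this contradicts the norm of
   a scalar. *)
have p : Pos (M%:S : A).
  by rewrite -[M%:S](subrK (h * h)) -kE; apply: Pos_D; apply: Pos_sq.
have [_ [N hN]] := p; have := hN; rewrite -scalerBl -rmorphB /= nmS.
by have := ler_norm (N - M); lra.
Qed.

Lemma Pos_anti a : Pos a -> Pos (- a) -> a = 0.
Proof. by move=> ha hb; apply: nm_eq0; apply: nm_le_Pos => //; rewrite scale0r sub0r. Qed.

Lemma Pos_sum0 a b : Pos a -> Pos b -> a + b = 0 -> a = 0.
Proof. by move=> ha hb h; apply: Pos_anti => //; rewrite -(addrK b a) h sub0r opprK. Qed.

Lemma sq_eq0 h : selfadj h -> h * h = 0 -> h = 0.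
Proof.
move=> sh h0; apply: cs_norm_eq0; apply/eqP; rewrite -sqrf_eq0; apply/eqP.
by rewrite -nm_sq // h0 nm0.
Qed.

End SquareRoots.

(** * Positive and negative parts, and positivity of [b^† * b] *)

Section Decomposition.
Variable A : cstar.
Implicit Types (a b c x y z h k : A) (r M : RR).

Lemma half_dbl a : half *: (a + a) = a.
Proof. by rewrite scalerDr -scalerDl half2 scale1r. Qed.

Lemma nm_1Bsq h : selfadj h -> nm h <= 1 -> nm (1 - h * h) <= 1.
Proof.
move=> sh nh; have := @nm_sqB A h 1 sh; rewrite scale1r; apply.
by rewrite expr_le1 // nm_ge0.
Qed.

Lemma Pos_ball1 a : selfadj a -> nm a <= 1 -> Pos (1 - a).
Proof.
move=> sa na; split; first by apply: sa_B => //; exact: sa_1.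
by exists 1; rewrite scale1r opprB addrC subrK.
Qed.

(* Here [y] is such that [1 - y] is the positive square root of [a * a]. *)
Lemma sqit_abs a y : selfadj a -> nm a <= 1 -> cvgA (sqit (1 - a * a)) y -> Pos (1 - y - a).
Proof.
move=> sa na hy; set x := 1 - a * a in hy.
have na2 : nm (a * a) <= 1 by rewrite nm_sq // expr_le1 // nm_ge0.
have px : Pos x by apply: Pos_ball1 => //; apply: sa_sq.
have xs n : sqit x n * x = x * sqit x n by apply: sqit_comm.
have xa n : sqit x n * a = a * sqit x n.
  by apply: sqit_comm; rewrite /x; ncalg.
have ps n : Pos (sqit x n).
  elim: n => [|n IH] /=; first exact: Pos0.
  apply: Pos_Z; first lra.
  by apply: Pos_D => //; apply: Pos_sq; apply: Pos_sa.
(* With [x = 1 - a * a], the recursion turns [2 (1 - a - sqit x n.+1)] into the product of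
   [1 - a - sqit x n] and [1 - a + sqit x n], which are commuting positive elements. *)
have pn n : Pos (1 - a - sqit x n).
  elim: n => [|n IH] /=; first by rewrite subr0; apply: Pos_ball1.
  have -> : 1 - a - half *: (x + sqit x n * sqit x n) =
     half *: ((1 - a - sqit x n) * (1 - a + sqit x n)).
    have -> : (1 - a - sqit x n) * (1 - a + sqit x n) =
        (1 - a) + (1 - a) - (x + sqit x n * sqit x n) + (sqit x n * a - a * sqit x n).
      by rewrite /x; ncalg.
    by rewrite xa subrr addr0 scalerBr half_dbl.
  apply: Pos_Z; first lra.
  apply: Pos_mul => //; first by apply: Pos_D => //; apply: Pos_ball1.
  have e : (1 - a - sqit x n) * (1 - a + sqit x n) - (1 - a + sqit x n) * (1 - a - sqit x n)
     = (sqit x n * a - a * sqit x n) + (sqit x n * a - a * sqit x n) by ncalg.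
  by apply/eqP; rewrite -subr_eq0 e xa subrr addr0.
rewrite addrAC; apply: (closed_Pos pn).
by apply: cvgAD; [exact: cvgA_cst | exact: cvgAN].
Qed.

(** [p] and [q] are the square roots of [(|a| + a) / 2] and [(|a| - a) / 2], where [|a|] is a
    multiple of the limit [1 - y] of [sqit_abs]. The two halves have product 0, and so have their
    roots because these commute. *)
Lemma Pos_decomp a : selfadj a -> exists p q : A,
  [/\ selfadj p, selfadj q, a = p * p - q * q, p * q = 0 & q * p = 0].
Proof.
move=> sa; pose M := nm a + 1; have M0 : 0 < M by have := nm_ge0 a; rewrite /M; lra.
pose b := M^-1%:C *: a; have sb : selfadj b by apply: sa_Z.
have ab : a = M%:C *: b by rewrite scalerA -rmorphM /= divff ?gt_eqF // scale1r.
have nb : nm b <= 1.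
  by rewrite nmZ gtr0_norm ?invr_gt0 // mulrC ler_pdivrMr // mul1r /M; lra.
clearbody b; have nx : nm (1 - b * b) <= 1.
  exact: nm_1Bsq.
have [y [hy ny yE /(_ _) sy hP]] := sqrt1m nx.
have pm := sqit_abs sb nb hy.
have pp : Pos (1 - y + b).
  by rewrite -[b]opprK; apply: sqit_abs; rewrite ?nmN ?mulrNN //; apply: sa_N.
have yb : y * b = b * y by apply: (hP _ (csub_comm b)); ncalg.
have hc : (1 - y) * b = b * (1 - y) by rewrite mulrBl mulrBr yb mul1r mulr1.
have e1 : (1 - y + b) * (1 - y - b) = 0.
  transitivity ((1 - y) * (1 - y) - b * b + (b * (1 - y) - (1 - y) * b)); first by ncalg.
  by rewrite hc subrr addr0 yE; ncalg.
have e2 : (1 - y - b) * (1 - y + b) = 0.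
  transitivity ((1 - y) * (1 - y) - b * b + ((1 - y) * b - b * (1 - y))); first by ncalg.
  by rewrite hc subrr addr0 yE; ncalg.
have M2 : 0 <= M / 2 by lra.
have [p [sp pE _ hp]] := Pos_sqrt (Pos_Z M2 pp).
have [q [sq qE _ hq]] := Pos_sqrt (Pos_Z M2 pm).
have pq0 : (p * p) * (q * q) = 0 by rewrite pE qE -scalerAl -scalerAr e1 !scaler0.
have c1 : p * (q * q) = (q * q) * p.
  by apply: (hp _ (csub_comm _)); rewrite qE -!scalerAl -!scalerAr e1 e2 !scaler0.
have c2 : q * p = p * q by apply: (hq _ (csub_comm _)); rewrite -qE -c1.
have pq : p * q = 0.
  apply: sq_eq0; first exact: sa_comm.
  by rewrite -mulrA (mulrA q) c2 -mulrA mulrA.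
exists p, q; split=> //; last by rewrite c2.
rewrite ab pE qE -scalerBr.
have -> : 1 - y + b - (1 - y - b) = b + b by ncalg.
rewrite -[X in X + X]scale1r -scalerDl scalerA; congr (_ *: _).
by rewrite rmorphM /= -mulrA mulrDr mulr1 half2 mulr1.
Qed.

(** The positive elements [(h - k)^2 h] and [(h - k)^2 k] have sum 0, so both vanish; their
    difference is [(h - k)^3]. *)
Lemma Pos_sqrt_unique h k : Pos h -> Pos k -> h * k = k * h -> h * h = k * k -> h = k.
Proof.
move=> ph pk hk e; have sh := Pos_sa ph; have sk := Pos_sa pk.
have sd : selfadj (h - k) by apply: sa_B.
have pd := Pos_sq sd.
have ch : (h - k) * h = h * (h - k) by rewrite mulrBl mulrBr hk.
have ck : (h - k) * k = k * (h - k) by rewrite mulrBl mulrBr hk.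
have p1 : Pos ((h - k) * (h - k) * h).
  by apply: Pos_mul => //; rewrite -mulrA ch mulrA ch mulrA.
have p2 : Pos ((h - k) * (h - k) * k).
  by apply: Pos_mul => //; rewrite -mulrA ck mulrA ck mulrA.
have s0 : (h - k) * (h - k) * h + (h - k) * (h - k) * k = 0.
  rewrite -mulrDr -mulrA (_ : (h - k) * (h + k) = 0) ?mulr0 //.
  by rewrite mulrBl !mulrDr e hk; ncalg.
have z1 := Pos_sum0 p1 p2 s0.
have z2 : (h - k) * (h - k) * k = 0 by move: s0; rewrite z1 add0r.
apply/eqP; rewrite -subr_eq0; apply/eqP; apply: sq_eq0 => //; apply: sq_eq0; first exact: sa_sq.
by rewrite (mulrA _ (h - k)) (mulrBr ((h - k) * (h - k))) z1 z2 subrr mul0r.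
Qed.

(** The hypothesis gives [x^2 c = c z^2]. Both roots come from the same iteration, so they are
    intertwined by [c] as well: [x c = c z]. Together with the hypothesis this leaves
    [2 c z = 0]. *)
Lemma Pos_intertwine x z c : Pos x -> Pos z -> x * c = - (c * z) -> c * z = 0.
Proof.
(* A common scale, so that both elements have norm at most 1 and the relation survives division by
   [s]. *)
move=> px pz e; pose s := nm x + nm z + 1.
have nx0 := nm_ge0 x; have nz0 := nm_ge0 z.
have s0 : 0 < s by rewrite /s; lra.
pose sc w : A := s^-1%:C *: w.
have scn w : Pos w -> nm w <= s -> [/\ Pos (sc w) & nm (1 - sc w * sc w) <= 1].
  move=> pw nw; have pw' : Pos (sc w) by apply: Pos_Z => //; rewrite invr_ge0 ltW.
  split=> //; apply: nm_1Bsq; first exact: Pos_sa.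
  rewrite nmZ gtr0_norm ?invr_gt0 //.
  by rewrite mulrC ler_pdivrMr // mul1r.
have [pX nX] : [/\ Pos (sc x) & nm (1 - sc x * sc x) <= 1] by apply: scn => //; rewrite /s; lra.
have [pZ nZ] : [/\ Pos (sc z) & nm (1 - sc z * sc z) <= 1] by apply: scn => //; rewrite /s; lra.
have eX : sc x * c = - (c * sc z) by rewrite /sc -scalerAl e -scalerAr scalerN.
have key w y : Pos w -> nm (1 - w * w) <= 1 -> cvgA (sqit (1 - w * w)) y -> 1 - y = w.
  move=> pw nw hy; have [y' [hy' ny yE _ hP]] := sqrt1m nw.
  rewrite -(cvgA_unique hy' hy); apply: Pos_sqrt_unique => //.
  - apply: Pos_ball1 => //; apply: closed_sa hy' => n.
    elim: n => [|n IH] /=; first exact: sa_0.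
    apply: sa_Z; apply: sa_D; last exact: sa_sq.
    by apply: sa_B; [exact: sa_1 | apply: sa_sq; apply: Pos_sa].
  - rewrite mulrBl mulrBr mul1r mulr1; congr (_ - _).
    by apply: (hP _ (csub_comm w)); ncalg.
  - by rewrite yE opprB addrC subrK.
have [y1 [h1 _ _ _ _]] := sqrt1m nX; have [y2 [h2 _ _ _ _]] := sqrt1m nZ.
have cc : (1 - sc x * sc x) * c = c * (1 - sc z * sc z).
  rewrite mulrBl mulrBr mul1r mulr1; congr (_ - _).
  by rewrite -mulrA eX mulrN mulrA eX mulNr opprK mulrA.
have it n : sqit (1 - sc x * sc x) n * c = c * sqit (1 - sc z * sc z) n. exact: sqit_comm.
have yc : y1 * c = c * y2.
  apply: cvgA_unique (cvgAMr c h1) _; rewrite (_ : (fun _ => _) = (fun n => c * sqit (1 - sc z * sc z) n)).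
    exact: cvgAMl.
  exact/funext.
have eX2 : sc x * c = c * sc z.
  by rewrite -(key _ _ pX nX h1) -(key _ _ pZ nZ h2) mulrBl mulrBr yc mul1r mulr1.
have z0 : c * sc z = 0.
  have : half *: (c * sc z + c * sc z) = 0 by rewrite -{1}eX2 eX addNr scaler0.
  by rewrite scalerDr -scalerDl half2 scale1r.
have -> : z = s%:C *: sc z by rewrite /sc scalerA -rmorphM /= divff ?gt_eqF // scale1r.
by rewrite -scalerAr z0 scaler0.
Qed.

(** If [q * q] is the negative part of [b^† * b], then [c = b * q] has [c^† * c = - z] with
    [z = q^4], while [c * c^†] is twice the sum of the squares of the real and imaginary parts of
    [c], plus [z], hence positive. [Pos_intertwine] for [x = c * c^†] plays the role of comparing
    the spectra of [c * c^†] and [c^† * c]. *)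
Lemma Pos_stM b : Pos (b^† * b).
Proof.
have [p [q [sp sq e pq qp]]] := Pos_decomp (sa_stM b).
pose c := b * q; pose z := (q * q) * (q * q).
have pz : Pos z by apply: Pos_sq; apply: sa_sq.
have cc : c^† * c = - z.
  rewrite /c cs_starM sq -mulrA (mulrA b^†) e.
  transitivity ((q * p) * (p * q) - z); first by rewrite /z; ncalg.
  by rewrite pq qp mul0r sub0r.
have px : Pos (c * c^†).
  set h := rpart c; set k := ipart c.
  have -> : c * c^† = (h * h + h * h) + (k * k + k * k) + z.
    rewrite -[z]opprK -cc; apply/eqP; rewrite -subr_eq0 opprB addrA -subr_eq0; apply/eqP.
    rewrite subr0 {1 2 3 4}[c]ripart -/h -/k cs_starD stI (sa_rpart c : h^† = h) (sa_ipart c : k^† = k).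
    ncalg_core; by rewrite -?mulrA -?[in LHS]mulrA ?iC2; ring: iC2.
  have sh := sa_rpart c; have sk := sa_ipart c.
  by apply: Pos_D => //; apply: Pos_D; apply: Pos_D; apply: Pos_sq.
have cz : c * z = 0.
  by apply: Pos_intertwine px pz _; rewrite -mulrA cc mulrN.
have z0 : z = 0.
  apply: sq_eq0; first exact: Pos_sa.
  by rewrite -[X in X * _]opprK -cc mulNr -mulrA cz mulr0 oppr0.
have q0 : q = 0 by apply: sq_eq0 => //; apply: sq_eq0 => //; exact: sa_sq.
by rewrite e q0 mul0r subr0; apply: Pos_sq.
Qed.

Lemma poselP a : posel a <-> Pos a.
Proof.
split=> [[b ->]|]; first exact: Pos_stM.
by case/Pos_sqrt => h [sh <- _ _]; exists h; rewrite sh.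
Qed.
End Decomposition.

(** * The order *)

Section Order.
Variable A : cstar.
Implicit Types (a b c d e f v x y z h k : A) (r M : RR).

Lemma posel_sa a : posel a -> selfadj a.
Proof. by case=> b ->; apply: sa_stM. Qed.
Lemma posel_sq h : selfadj h -> posel (h * h).
Proof. by move=> sh; exists h; rewrite sh. Qed.
Lemma posel_D a b : posel a -> posel b -> posel (a + b).
Proof. by move=> /poselP ha /poselP hb; apply/poselP; apply: Pos_D. Qed.
Lemma posel_Z r a : 0 <= r -> posel a -> posel (r%:C *: a).
Proof. by move=> r0 /poselP ha; apply/poselP; apply: Pos_Z. Qed.
Lemma posel0 : posel (0 : A).
Proof. by exists 0; rewrite mulr0. Qed.
Lemma posel_conj v a : posel a -> posel (v^† * a * v).
Proof. by case=> b ->; exists (b * v); rewrite !stE !mulrA. Qed.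
Lemma posel_anti a : posel a -> posel (- a) -> a = 0.
Proof. by move=> /poselP ha /poselP hb; apply: Pos_anti. Qed.
Lemma closed_posel : closedA (@posel A).
Proof. by move=> u l hu hl; apply/poselP; apply: closed_Pos hl => n; apply/poselP. Qed.

Lemma cle_refl a : cle a a. Proof. by rewrite /cle subrr; apply: posel0. Qed.
Lemma cle_trans b a c : cle a b -> cle b c -> cle a c.
Proof. by move=> h1 h2; have := posel_D h2 h1; rewrite addrA subrK. Qed.
Lemma cle_anti a b : cle a b -> cle b a -> a = b.
Proof.
by move=> h1; rewrite /cle -opprB => h2; apply/eqP; rewrite eq_sym -subr_eq0; apply/eqP/posel_anti.
Qed.
Lemma cle_D a b c d : cle a b -> cle c d -> cle (a + c) (b + d).
Proof. by move=> h1 h2; rewrite /cle opprD addrACA; apply: posel_D. Qed.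
Lemma cle_Dr c a b : cle a b -> cle (a + c) (b + c).
Proof. by move=> h; apply: cle_D => //; apply: cle_refl. Qed.
Lemma cle_N a b : cle a b -> cle (- b) (- a).
Proof. by rewrite /cle opprK addrC. Qed.
Lemma cle_Z r a b : 0 <= r -> cle a b -> cle (r%:C *: a) (r%:C *: b).
Proof. by move=> r0 h; rewrite /cle -scalerBr; apply: posel_Z. Qed.
Lemma cle_conj v a b : cle a b -> cle (v^† * a * v) (v^† * b * v).
Proof. by move=> /(posel_conj v); rewrite mulrBr mulrBl. Qed.
Lemma cleN0 a : cle a 0 <-> posel (- a).
Proof. by rewrite /cle sub0r. Qed.
Lemma cle_ZP r s a : r <= s -> posel a -> cle (r%:C *: a) (s%:C *: a).
Proof. by move=> rs ha; rewrite /cle -scalerBl -rmorphB; apply: posel_Z; rewrite ?subr_ge0. Qed.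

Lemma cle_nm a : selfadj a -> cle a (nm a)%:S.
Proof.
move=> sa; apply/poselP; split; first by apply: sa_B => //; apply: sa_S.
by exists (nm a); rewrite opprB addrC subrK.
Qed.
Lemma posel1 : posel (1 : A).
Proof. by exists 1; rewrite st1 mulr1. Qed.
Lemma cle_nmM a M : selfadj a -> nm a <= M -> cle a M%:S.
Proof. by move=> sa h; apply: cle_trans (cle_nm sa) _; apply: cle_ZP => //; apply: posel1. Qed.
Lemma cle_nmN a : selfadj a -> cle (- (nm a)%:S) a.
Proof. by move=> /sa_N/cle_nm; rewrite nmN => /cle_N; rewrite opprK. Qed.
Lemma nm_cleS a M : posel a -> cle a M%:S -> nm a <= M.
Proof. by move=> /poselP ha /poselP hb; apply: nm_le_Pos. Qed.
Lemma nm_mono a b : posel a -> cle a b -> nm a <= nm b.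
Proof.
move=> ha h; apply: nm_cleS => //; apply: cle_trans (h) (cle_nm _).
by rewrite -[b](subrK a); apply: sa_D; apply: posel_sa.
Qed.
Lemma nm_cle2 a M : selfadj a -> cle (- M%:S) a -> cle a M%:S -> nm a <= 2 * M.
Proof.
move=> sa h1 h2; have h3 : posel (a + M%:S) by rewrite -[M%:S]opprK.
have h4 : nm (a + M%:S) <= 2 * M.
  apply: nm_cleS => //; rewrite (_ : 2 * M = M + M); last lra.
  by rewrite -rSD; apply: cle_Dr.
have h5 : posel (M%:S - a) by [].
have h6 : nm (M%:S - a) <= 2 * M.
  apply: nm_cleS => //; rewrite (_ : 2 * M = M + M); last lra.
  by rewrite -rSD addrC; apply: cle_Dr; rewrite -[X in cle _ X]opprK; apply: cle_N.
have e : a = half *: ((a + M%:S) - (M%:S - a)).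
  by rewrite (_ : _ - _ = a + a) ?half_dbl //; ncalg.
by rewrite {1}e nm_half; have := cs_normD (a + M%:S) (- (M%:S - a)); rewrite nmN; lra.
Qed.

Lemma stM_le v : cle (v^† * v) (nm v ^+ 2)%:S.
Proof. by rewrite -cs_cstar_id; apply: cle_nm; apply: sa_stM. Qed.

Lemma conj_le v a : selfadj a -> cle (v^† * a * v) ((nm a)%:C *: (v^† * v)).
Proof.
by move=> /cle_nm/(cle_conj v); rewrite rMS scalerAl.
Qed.

(** For [e = h * h] this is [conj_le] at [v = h], as [h * e * h = e * e]. *)
Lemma sq_le e : posel e -> cle (e * e) ((nm e)%:C *: e).
Proof.
move=> /poselP pe; have [h [sh hh _ hP]] := Pos_sqrt pe.
have := conj_le h (Pos_sa pe); rewrite sh hh; congr cle.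
by rewrite -hh !mulrA.
Qed.

Lemma cvgA_dom (u : nat -> A) (r : nat -> RR) M :
  (forall n, nm (u n.+1 - u n) <= r n.+1 - r n) -> (forall n, r n <= M) ->
  exists l, cvgA u l.
Proof.
move=> hu hM.
have mono n : r n <= r n.+1 by rewrite -subr_ge0; apply: le_trans (nm_ge0 _) (hu n).
have [l [hl1 hl2]] := real_mono_lim mono hM.
apply: cs_complete => e e0; have [N hN] := hl2 _ e0; exists N.
have diff m n : (n <= m)%N -> nm (u m - u n) <= r m - r n.
  move=> /subnK <-; elim: (m - n)%N => [|k IH]; first by rewrite add0n !subrr nm0.
  by have := nm_tri (u (k + n)%N) (u (k + n)%N.+1) (u n); have := hu (k + n)%N; rewrite addSn; lra.
have main m n : (N <= n)%N -> (n <= m)%N -> nm (u m - u n) < e.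
  move=> Nn nm; have := diff _ _ nm; have := hN _ Nn; have := hl1 m; lra.
move=> m n Nm Nn; have [nm|/ltnW mn] := leqP n m; first exact: main.
by rewrite nmB; apply: main.
Qed.

Lemma Pos_inv a : Pos a -> exists v,
  [/\ v * (1 + a) = 1, (1 + a) * v = 1, Pos v, cle v 1 & forall P, csub P -> P a -> P v].
Proof.
move=> pa; pose M := nm a; have M0 : 0 <= M := nm_ge0 a.
have M1 : 0 < 1 + M by lra.
(* [1 + a = (1 + M) * (1 - x)] with [nm x < 1]: the inverse is a Neumann series in [x], with partial
   sums [u] dominated by the geometric sums [r]. *)
pose x := (1 + M)^-1%:C *: (M%:S - a).
have px : Pos x.
  by apply: Pos_Z; [rewrite invr_ge0 ltW | apply/poselP; exact: cle_nm (Pos_sa pa)].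
have aE : 1 + a = (1 + M)%:C *: (1 - x).
  rewrite /x scalerBr scalerA -rmorphM /= divff ?gt_eqF // scale1r.
  by rewrite -rSD scale1r; ncalg.
pose rho := nm x.
have rho0 : 0 <= rho := nm_ge0 x.
have rho1 : rho < 1.
  have : nm (M%:S - a) <= M by apply: Pos_nmB.
  rewrite /rho /x nmZ gtr0_norm ?invr_gt0 // mulrC ltr_pdivrMr //; lra.
pose u := fix u n : A := if n is m.+1 then 1 + x * u m else 0.
pose r := fix r n : RR := if n is m.+1 then 1 + rho * r m else 0.
have hr n : r n <= (1 - rho)^-1.
  have i0 : 0 < 1 - rho by lra.
  have := @mulVf RR (1 - rho); rewrite gt_eqF // => /(_ isT) ie.
  elim: n => [|n IH] /=; first by rewrite invr_ge0 ltW.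
  set i := (1 - rho)^-1 in IH ie *; have : rho * r n <= rho * i by rewrite ler_wpM2l.
  by rewrite mulrBr mulr1 in ie; rewrite mulrC in ie; lra.
have hu n : nm (u n.+1 - u n) <= r n.+1 - r n.
  elim: n => [|n IH]; first by rewrite /= !mulr0 !addr0 !subr0 nm1.
  rewrite (_ : u n.+2 - u n.+1 = x * (u n.+1 - u n)); last by rewrite /=; ncalg.
  rewrite (_ : r n.+2 - r n.+1 = rho * (r n.+1 - r n)); last by rewrite /=; ring.
  by apply: le_trans (cs_normM _ _) _; rewrite ler_wpM2l.
have [l hl] := cvgA_dom hu hr.
have lE : l = 1 + x * l.
  apply: cvgA_unique (cvgA_S hl) _; apply: cvgAD; [exact: cvgA_cst | exact: cvgAMl].
have hP P : csub P -> P x -> P l.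
  move=> hP Px; apply: (csub_closed hP) hl; elim=> [|n IH] /=; first exact: csub0.
  by apply: csubD => //; [exact: csub1 | exact: csubM].
have xl : l * x = x * l by apply: (hP _ (csub_comm x)).
have pl : Pos l.
  apply: (@closed_Pos A u) hl; elim=> [|n IH] /=; first exact: Pos0.
  apply: Pos_D; first by apply/poselP; apply: posel1.
  apply: Pos_mul => //; elim: n {IH} => [|n IH] /=; first by rewrite mulr0 mul0r.
  by rewrite mulrDr mulrDl mulr1 mul1r -mulrA -IH.
pose v := (1 + M)^-1%:C *: l.
have v1 : v * (1 + a) = 1.
  rewrite aE /v -scalerAl -scalerAr scalerA -rmorphM /= mulVf ?gt_eqF // scale1r.
  by rewrite mulrBr mulr1 xl {1}lE addrK.
have v2 : (1 + a) * v = 1.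
  rewrite aE /v -scalerAl -scalerAr scalerA -rmorphM /= divff ?gt_eqF // scale1r.
  by rewrite mulrBl mul1r {1}lE addrK.
have pv : Pos v by apply: Pos_Z => //; rewrite invr_ge0 ltW.
exists v; split=> //.
- apply/poselP; rewrite -v1 mulrDr mulr1 addrC addKr; apply: Pos_mul => //.
  by have := etrans v1 (esym v2); rewrite mulrDr mulrDl mulr1 mul1r => /addrI.
- move=> P Ps Pa; apply: csubZ => //; apply: hP => //; apply: csubZ => //.
  by apply: csubB => //; apply: csubZ => //; apply: csub1.
Qed.

(** With [d = b - a], the resolvent identity used on both sides gives [v - w = w * d * w + (d * w)^†
    * v * (d * w)], a sum of two positive conjugates. *)
Lemma inv_antitone a b v w : cle a b -> posel v -> selfadj w ->
  v * (1 + a) = 1 -> (1 + a) * v = 1 -> w * (1 + b) = 1 -> (1 + b) * w = 1 -> cle w v.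
Proof.
move=> ab pv sw va av wb bw; pose d := b - a.
have sd : selfadj d by apply: posel_sa ab.
have e1 : v = w + w * d * v.
  have -> : w * d * v = w * (1 + b) * v - w * ((1 + a) * v) by rewrite /d; ncalg.
  by rewrite wb av mul1r mulr1 addrC subrK.
have e2 : v = w + v * d * w.
  have -> : v * d * w = v * ((1 + b) * w) - v * (1 + a) * w by rewrite /d; ncalg.
  by rewrite bw va mul1r mulr1 addrC subrK.
rewrite /cle {1}e1 addrC addKr {1}e2.
have -> : w * d * (w + v * d * w) = w^† * d * w + (d * w)^† * v * (d * w).
  by rewrite cs_starM sw sd; ncalg.
by apply: posel_D; apply: posel_conj.
Qed.

(** * Sequences decreasing to zero *)

(** Suprema are handled as infima: for increasing [u], a self-adjoint [s] is the supremum when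
    [s - u n] decreases to 0 in this sense. The infimum is that of the poset of self-adjoint
    elements; no convergence in norm or in a representation is implied. *)
Definition Dec0 (y : nat -> A) : Prop :=
  [/\ forall n, posel (y n), forall n, cle (y n.+1) (y n) &
      forall c, selfadj c -> (forall n, cle c (y n)) -> cle c 0].

Lemma Dec0_mono (y : nat -> A) m n : Dec0 y -> (n <= m)%N -> cle (y m) (y n).
Proof.
move=> [_ h _] /subnK <-; elim: (m - n)%N => [|k IH]; first exact: cle_refl.
by apply: cle_trans IH; rewrite addSn; apply: h.
Qed.

Lemma incr_mono (u : nat -> A) m n : incr_sa u -> (n <= m)%N -> cle (u n) (u m).
Proof.
move=> [_ h] /subnK <-; elim: (m - n)%N => [|k IH]; first exact: cle_refl.
by apply: cle_trans IH _; rewrite addSn; apply: h.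
Qed.

Lemma Dec0_sup (u : nat -> A) s : incr_sa u -> is_sup u s -> Dec0 (fun n => s - u n).
Proof.
move=> [su mu] [ss us ls]; split=> [n|n|c sc hc]; first exact: us.
  have := mu n; congr posel; ncalg.
have : cle s (s - c).
  apply: ls => [|n]; first exact: sa_B.
  by have := hc n; rewrite /cle addrAC.
by rewrite cleN0 /cle addrAC subrr add0r.
Qed.

Lemma sup_Dec0 (u : nat -> A) s : selfadj s -> Dec0 (fun n => s - u n) -> is_sup u s.
Proof.
move=> ss [p m h]; split=> // t st ut.
have : cle (s - t) 0.
  apply: h => [|n]; first exact: sa_B.
  by rewrite /cle opprB addrC addrA subrK; apply: ut.
by rewrite cleN0 opprB.
Qed.

(** Separate the indices: by monotonicity a lower bound [c] satisfies [c - y n <= z m] for all [m]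
    and [n]. Letting [m] vary gives [c <= y n], then [n] varies. *)
Lemma Dec0_add (y z : nat -> A) : Dec0 y -> Dec0 z -> Dec0 (fun n => y n + z n).
Proof.
move=> hy hz; have [py my iy] := hy; have [pz mz iz] := hz; split=> [n|n|c sc hc].
- exact: posel_D.
- exact: cle_D.
apply: iy => // n.
have : cle (c - y n) 0.
  apply: iz => [|m]; first by apply: sa_B => //; apply: posel_sa.
  have h1 : cle (y (maxn m n)) (y n) by apply: Dec0_mono => //; apply: leq_maxr.
  have h2 : cle (z (maxn m n)) (z m) by apply: Dec0_mono => //; apply: leq_maxl.
  have := cle_trans (hc (maxn m n)) (cle_D h1 h2).
  by rewrite /cle opprB addrCA addrA.
by rewrite cleN0 opprB.
Qed.

Lemma Dec0_le (y z : nat -> A) : Dec0 z -> (forall n, posel (y n)) -> (forall n, cle (y n.+1) (y n)) ->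
  (forall n, cle (y n) (z n)) -> Dec0 y.
Proof.
move=> [_ _ h] py my yz; split=> // c sc hc; apply: h => // n.
exact: cle_trans (hc n) (yz n).
Qed.

Lemma Dec0_Z r (y : nat -> A) : 0 <= r -> Dec0 y -> Dec0 (fun n => r%:C *: y n).
Proof.
move=> r0 hy; have [py my iy] := hy; split=> [n|n|c sc hc]; [exact: posel_Z | exact: cle_Z |].
have [r00|rn0] := eqVneq r 0; first by have := hc 0%N; rewrite r00 scale0r.
have rp : 0 < r by rewrite lt_def rn0.
have ri : 0 <= r^-1 by rewrite invr_ge0.
have : cle (r^-1%:C *: c) 0.
  apply: iy => [|n]; first exact: sa_Z.
  by have := cle_Z ri (hc n); rewrite scalerA -rmorphM /= mulVf // scale1r.
by move=> /(cle_Z r0); rewrite scalerA -rmorphM /= divff // scale1r scaler0.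
Qed.

(** Parallelogram law: the difference of the two sides is the conjugate of [a] by [v - w]. *)
Lemma conj2_le v w a : posel a ->
  cle ((v + w)^† * a * (v + w)) (2%:C *: (v^† * a * v + w^† * a * w)).
Proof.
move=> /(posel_conj (v - w)); congr posel.
rewrite stB cs_starD (_ : 2%:C = 1 + 1) ?rmorphD //; ncalg.
Qed.

Lemma Dec0_unitary (u : A) (y : nat -> A) : u^† * u = 1 -> u * u^† = 1 -> Dec0 y -> Dec0 (fun n => u^† * y n * u).
Proof.
move=> uu uu' [py my iy]; split=> [n|n|c sc hc]; [exact: posel_conj | exact: cle_conj |].
have : cle (u * c * u^†) 0.
  apply: iy => [|n]; first by rewrite -{1}[u]cs_starK; apply: sa_conj.
  have := cle_conj u^† (hc n); rewrite cs_starK.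
  by rewrite -!mulrA uu' mulr1 !mulrA uu' mul1r.
move=> /(cle_conj u); rewrite mulr0 mul0r.
by rewrite -!mulrA uu mulr1 mulrA uu mul1r.
Qed.

(** [u = f + i k] with [k] the square root of [1 - f * f]. *)
Lemma sa_unitary f : selfadj f -> nm f <= 1 -> exists u,
  [/\ u^† * u = 1, u * u^† = 1 & f = half *: (u + u^†)].
Proof.
move=> sf nf; have pf : Pos (1 - f * f).
  by apply: Pos_ball1; [exact: sa_sq | rewrite nm_sq // expr_le1 // nm_ge0].
have [k [sk kE _ hk]] := Pos_sqrt pf.
have fk : k * f = f * k by apply: (hk _ (csub_comm f)); ncalg.
have us : (f + iC *: k)^† = f - iC *: k by rewrite cs_starD stI sf sk.
exists (f + iC *: k); rewrite us; split.
- transitivity (f * f - (iC * iC) *: (k * k) + iC *: (f * k - k * f)); first by ncalg.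
  by rewrite fk subrr scaler0 addr0 iC2 scaleN1r opprK kE addrC subrK.
- transitivity (f * f - (iC * iC) *: (k * k) + iC *: (k * f - f * k)); first by ncalg.
  by rewrite fk subrr scaler0 addr0 iC2 scaleN1r opprK kE addrC subrK.
- by rewrite addrACA subrr addr0 half_dbl.
Qed.

(** Conjugation by a unitary is an order automorphism; conjugation by [v] in general is not. A
    self-adjoint contraction is the mean of two unitaries, so [conj2_le] dominates the conjugates by
    it by sequences known to decrease to 0. Scaling and the real and imaginary parts then reach
    every [v]. *)
Lemma Dec0_conj v (y : nat -> A) : Dec0 y -> Dec0 (fun n => v^† * y n * v).
Proof.
move=> hy; have [py my _] := hy.
have s1 f : selfadj f -> nm f <= 1 -> Dec0 (fun n => f^† * y n * f).
  move=> sf nf; have [u [uu uu' fE]] := sa_unitary sf nf.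
  have h := Dec0_Z (ltac:(lra) : 0 <= 2^-1 :> RR)
    (Dec0_add (Dec0_unitary uu uu' hy) (Dec0_unitary (u := u^†) ltac:(by rewrite cs_starK) ltac:(by rewrite cs_starK) hy)).
  apply: Dec0_le h _ _ _ => n; [exact: posel_conj | exact: cle_conj |].
  have := conj2_le (half *: u) (half *: u^†) (py n).
  rewrite -scalerDr -fE; congr cle.
  rewrite !stR cs_starK -!scalerAl -!scalerAr !scalerA -scalerDr scalerA; congr (_ *: _).
  by rewrite -!rmorphM /=; congr (_%:C); field.
have s2 f : selfadj f -> Dec0 (fun n => f^† * y n * f).
  move=> sf; pose M := nm f + 1; have M0 : 0 < M by have := nm_ge0 f; rewrite /M; lra.
  have h : Dec0 (fun n => (M^-1%:C *: f)^† * y n * (M^-1%:C *: f)).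
    apply: s1; first exact: sa_Z.
    by rewrite nmZ gtr0_norm ?invr_gt0 // mulrC ler_pdivrMr // mul1r /M; lra.
  have := Dec0_Z (ltac:(nra) : 0 <= M * M) h; congr Dec0; apply/funext => n.
  rewrite stR -!scalerAl -scalerAr !scalerA -!rmorphM /=.
  by rewrite (_ : M * M * M^-1 * M^-1 = 1) ?scale1r //; field; rewrite gt_eqF.
have h := Dec0_Z (ltac:(lra) : 0 <= 2 :> RR)
  (Dec0_add (s2 _ (sa_rpart v)) (s2 _ (sa_ipart v))).
apply: Dec0_le h _ _ _ => n; [exact: posel_conj | exact: cle_conj |].
have := conj2_le (rpart v) (iC *: ipart v) (py n); rewrite -ripart; congr cle.
congr (_ *: (_ + _)); rewrite stI mulNr mulNr -!scalerAl -scalerAr scalerA iC2.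
by rewrite scaleN1r opprK.
Qed.

Lemma sup_conj v (u : nat -> A) s : incr_sa u -> is_sup u s ->
  incr_sa (fun n => v^† * u n * v) /\ is_sup (fun n => v^† * u n * v) (v^† * s * v).
Proof.
move=> iu us; have [su mu] := iu; split.
  by split=> n; [exact: sa_conj | exact: cle_conj].
apply: sup_Dec0; first by apply: sa_conj; case: us.
have := Dec0_conj v (Dec0_sup iu us); congr Dec0; apply/funext => n.
by rewrite mulrBr mulrBl.
Qed.

Lemma sup_unique (u : nat -> A) s t : is_sup u s -> is_sup u t -> s = t.
Proof.
by move=> [ss us ls] [st ut lt]; apply: cle_anti; [apply: ls | apply: lt].
Qed.
End Order.

(** * Positive functionals *)

Section HahnBanach.
Variable E : lmodType CC.
Implicit Types (p q f : E -> RR) (x y : E).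

Definition sublinear p :=
  (forall x y, p (x + y) <= p x + p y) /\ (forall (r : RR) x, 0 < r -> p (r%:C *: x) <= r * p x).

Lemma sublinear0 p : sublinear p -> p 0 = 0.
Proof.
move=> [pD pZ]; have := pD 0 0; rewrite addr0 => h1.
have := pZ 2^-1 0 ltac:(lra); rewrite scaler0; lra.
Qed.

Lemma sublinearN p x : sublinear p -> - p (- x) <= p x.
Proof. by move=> hp; have := hp.1 x (- x); rewrite subrr sublinear0 //; lra. Qed.

Lemma sublinearZ p (r : RR) x : sublinear p -> 0 < r -> p (r%:C *: x) = r * p x.
Proof.
move=> hp r0; apply/eqP; rewrite eq_le hp.2 //=.
have ri : 0 < r^-1 by rewrite invr_gt0.
have := hp.2 r^-1 (r%:C *: x) ri; rewrite scalerA -rmorphM /= mulVf ?gt_eqF // scale1r.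
by rewrite mulrC ler_pdivlMr // mulrC.
Qed.

Let T p := {q : E -> RR | sublinear q /\ forall x, q x <= p x}.
Let R p (s t : T p) := forall x, sval t x <= sval s x.

(** [R] reverses the pointwise order, so that maximal for Zorn means minimal. A chain is bounded by
    its pointwise infimum, finite because every member at [x] is at least [- p (- x)]. *)
Lemma sublinear_chain p (C : set (T p)) : sublinear p -> total_on C (@R p) ->
  exists t, forall s, C s -> R s t.
Proof.
move=> hp tot; have [[s0 Cs0]|C0] := pselect (exists s, C s); last first.
  by exists (exist _ p (conj hp (fun x => lexx _))) => s Cs; case: C0; exists s.
pose F x := [set sval s x | s in C]%classic.
have lbF x : lbound (F x) (- p (- x)).
  move=> _ [s Cs <-]; have [hs sp] := svalP s.
  by have := sublinearN x hs; have := sp (- x); lra.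
have hlb x : has_lbound (F x) by exists (- p (- x)).
have ne x : (F x !=set0)%classic by exists (sval s0 x), s0.
pose q x := inf (F x).
have qs s x : C s -> q x <= sval s x by move=> Cs; apply: ge_inf => //; exists s.
have lq x l : (forall s, C s -> l <= sval s x) -> l <= q x.
  by move=> h; apply: lb_le_inf => // _ [s Cs <-]; apply: h.
have hq : sublinear q.
  split=> [x y|r x r0].
    have h s t : C s -> C t -> q (x + y) <= sval s x + sval t y.
      move=> Cs Ct; have [st|ts] := tot _ _ Cs Ct.
        apply: le_trans (qs t _ Ct) _; apply: le_trans ((svalP t).1.1 x y) _.
        by rewrite lerD2r.
      apply: le_trans (qs s _ Cs) _; apply: le_trans ((svalP s).1.1 x y) _.
      by rewrite lerD2l.
    rewrite -lerBlDr; apply: (lq) => s Cs; rewrite lerBlDr -lerBlDl; apply: (lq) => t Ct.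
    by rewrite lerBlDl; apply: h.
  rewrite mulrC -ler_pdivrMr //; apply: lq => s Cs; rewrite ler_pdivrMr // mulrC.
  by apply: le_trans (qs s _ Cs) _; apply: (svalP s).1.2.
have qp x : q x <= p x by apply: le_trans (qs s0 _ Cs0) _; apply: (svalP s0).2.
by exists (exist _ q (conj hq qp)) => s Cs x; apply: qs.
Qed.

(* A minimal sublinear functional is linear: lowering it in the direction [y] gives a smaller one. *)
Lemma hahn_banach p : sublinear p -> exists f,
  [/\ forall x y, f (x + y) = f x + f y, forall (r : RR) x, f (r%:C *: x) = r * f x &
      forall x, f x <= p x].
Proof.
move=> hp.
have [t tmin] : exists t : T p, forall s, R t s -> s = t.
  have [||||t tmin] := @Zorn (T p) (fun s t => `[< R s t >]).
  - by move=> s; apply/asboolP => x.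
  - move=> a b c /asboolP ab /asboolP bc; apply/asboolP => x.
    exact: le_trans (bc x) (ab x).
  - move=> [s hs] [t ht] /asboolP /= st /asboolP ts.
    have e : s = t by apply/funext => x; apply/eqP; rewrite eq_le (st x) (ts x).
    by subst t; congr exist; apply: Prop_irrelevance.
  - move=> C tot; have [|t ht] := @sublinear_chain p C hp.
      by move=> s t Cs Ct; have [/asboolP|/asboolP] := tot s t Cs Ct; [left | right].
    by exists t => s Cs; apply/asboolP; apply: ht.
  - by exists t => s st; apply: tmin; apply/asboolP.
case: t tmin => f [hf fp] tmin.
have super x y : f x <= f (x + y) - f y.
  pose F z := [set f (z + t%:C *: y) - t * f y | t in [set t | 0 <= t]]%classic.
  have fty t : 0 <= t -> t * f y <= f (t%:C *: y).
    rewrite le_eqVlt => /orP[/eqP <-|t0]; first by rewrite mul0r scale0r sublinear0.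
    by rewrite sublinearZ.
  have lbF z : lbound (F z) (- f (- z)).
    move=> _ [t t0 <-]; have := hf.1 (z + t%:C *: y) (- z); have := fty t t0.
    by rewrite addrAC subrr add0r; lra.
  have hlb z : has_lbound (F z) by exists (- f (- z)).
  have ne z : (F z !=set0)%classic by exists (f (z + 0%:C *: y) - 0 * f y), 0 => //=.
  pose q z := inf (F z).
  have qs t z : 0 <= t -> q z <= f (z + t%:C *: y) - t * f y.
    by move=> t0; apply: ge_inf => //; exists t.
  have lq z l : (forall t, 0 <= t -> l <= f (z + t%:C *: y) - t * f y) -> l <= q z.
    by move=> h; apply: lb_le_inf => // _ [t t0 <-]; apply: h.
  have qf z : q z <= f z by have := qs 0 z (lexx _); rewrite scale0r mul0r subr0 addr0.
  have hq : sublinear q.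
    split=> [x1 x2|r x1 r0].
      rewrite -lerBlDr; apply: (lq) => s s0; rewrite lerBlDr -lerBlDl; apply: (lq) => t t0.
      rewrite lerBlDl; have := qs (s + t) (x1 + x2) (addr_ge0 s0 t0).
      rewrite rmorphD scalerDl addrACA => h; apply: le_trans h _.
      by have := hf.1 (x1 + s%:C *: y) (x2 + t%:C *: y); lra.
    rewrite mulrC -ler_pdivrMr //; apply: lq => s s0; rewrite ler_pdivrMr // mulrC.
    apply: le_trans (qs (r * s) _ _) _; first by rewrite mulr_ge0 // ltW.
    rewrite rmorphM -scalerA -scalerDr (sublinearZ _ hf r0); lra.
  have qp z : q z <= p z := le_trans (qf z) (fp z).
  have /(congr1 sval) /= e := tmin (exist _ q (conj hq qp)) qf.
  by have := qs 1 x ler01; rewrite e scale1r mul1r.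
have fD x y : f (x + y) = f x + f y.
  by apply/eqP; rewrite eq_le hf.1 /=; have := super x y; lra.
have fN x : f (- x) = - f x.
  by have := fD x (- x); rewrite subrr sublinear0 //; lra.
exists f; split=> // r x; have [->|rn0] := eqVneq r 0.
  by rewrite scale0r mul0r sublinear0.
have [r0|r0] := ltP 0 r; first exact: sublinearZ.
have r0' : 0 < - r by rewrite oppr_gt0 lt_def eq_sym rn0.
have := sublinearZ x hf r0'; rewrite rmorphN scaleNr fN; lra.
Qed.
End HahnBanach.

(* Real-valued, so that it only sees the self-adjoint part of its argument. *)
Record pfun (A : cstar) := PFun {
  pf_fun :> A -> RR;
  pfD : forall a b, pf_fun (a + b) = pf_fun a + pf_fun b;
  pfZ : forall (r : RR) a, pf_fun (r%:C *: a) = r * pf_fun a;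
  pf_st : forall a, pf_fun a^† = pf_fun a;
  pf_pos : forall a, posel a -> 0 <= pf_fun a }.

(** * Functionals that are generic for countably many sequences *)

Section Generic.
Variable A : cstar.
Implicit Types (a b v w : A) (y : nat -> A) (x : pfun A).

Lemma pf0 x : x 0 = 0.
Proof. by have := pfD x 0 0; rewrite addr0; lra. Qed.
Lemma pfN x a : x (- a) = - x a.
Proof. by have := pfD x a (- a); rewrite subrr pf0; lra. Qed.
Lemma pfB x a b : x (a - b) = x a - x b.
Proof. by rewrite pfD pfN. Qed.
Lemma pf_le x a b : cle a b -> x a <= x b.
Proof. by move=> /(pf_pos x); rewrite pfB subr_ge0. Qed.

Definition fsat (S : set (nat -> A)) x :=
  forall y, S y -> forall e : RR, 0 < e -> exists n, x (y n) < e.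

(** Countability serves twice: one recursion can meet all of [S] ([generic_pf]), and countable
    unions of conditions are conditions again ([cond_bigcup]). *)
Definition cond (S : set (nat -> A)) := countable S /\ forall y, S y -> Dec0 y.

Lemma scale_gt0_eq0 (r : RR) a : 0 < r -> r%:C *: a = 0 -> a = 0.
Proof.
move=> r0 /(congr1 (fun z => r^-1%:C *: z)).
by rewrite scalerA -rmorphM /= mulVf ?gt_eqF // scale1r scaler0.
Qed.

Lemma stM_eq0 v : v^† * v = 0 -> v = 0.
Proof.
move=> h; apply: cs_norm_eq0; apply/eqP; rewrite -sqrf_eq0; apply/eqP.
by rewrite -cs_cstar_id h nm0.
Qed.

Lemma not_neg_decomp a : selfadj a -> ~ cle a 0 -> exists p,
  [/\ selfadj p, p <> 0 & p * a * p = (p * p) * (p * p)].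
Proof.
move=> sa na; have [p [q [sp sq e pq qp]]] := Pos_decomp sa; exists p; split=> //.
  move=> p0; apply: na; apply/cleN0; rewrite e p0 mul0r sub0r opprK; exact: posel_sq.
rewrite e; transitivity (p * p * (p * p) - (p * q) * (q * p)); first by ncalg.
by rewrite pq mul0r subr0.
Qed.

(** The density step. By [Dec0_conj] the sequence [v^† * y n * v] decreases to 0, so its terms
    cannot all dominate [e] times [v^† * v]. For an [n] where this fails, the root [p] of the
    positive part of the difference serves as [w]. *)
Lemma refine v y (e : RR) : v <> 0 -> Dec0 y -> 0 < e -> exists w,
  v * w <> 0 /\ exists n, cle ((v * w)^† * y n * (v * w)) (e%:C *: ((v * w)^† * (v * w))).
Proof.
move=> v0 hy e0.
have [n hn] : exists n, ~ cle (e%:C *: (v^† * v)) (v^† * y n * v).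
  apply/not_existsP => h; apply: v0; apply: stM_eq0.
  have h0 : e%:C *: (v^† * v) = 0.
    apply: posel_anti; first by apply: posel_Z; [exact: ltW | exists v].
    apply/cleN0; have [_ _] := Dec0_conj v hy; apply.
      by apply: sa_Z; apply: sa_stM.
    by move=> n; apply: contrapT; apply: h.
  exact: scale_gt0_eq0 h0.
pose z := e%:C *: (v^† * v) - v^† * y n * v.
have sz : selfadj z.
  apply: sa_B; first by apply: sa_Z; apply: sa_stM.
  by apply: sa_conj; case: hy => py _ _; apply: posel_sa.
have nz : ~ cle z 0 by rewrite cleN0 opprB.
have [p [sp p0 pz]] := not_neg_decomp sz nz.
have e1 : e%:C *: ((v * p)^† * (v * p)) - (v * p)^† * y n * (v * p) = p * z * p.
  by rewrite cs_starM sp /z; ncalg.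
exists p; split.
  move=> vp; apply: p0; apply: sq_eq0 => //; apply: sq_eq0; first exact: sa_sq.
  by rewrite -pz -e1 vp !mulr0 scaler0 subrr.
by exists n; rewrite /cle e1 pz; apply: posel_sq; apply: sa_sq.
Qed.

(** The Kelley-Vaught construction. It starts from [p0], on which [b] exceeds [d]. Step [k], decoded
    as a pair [(i, m)], multiplies [vs k] on the right so that some term of [g i] becomes at most
    [1 / (m + 1)] relative to the new product. The functional [p] is the infimum of the upper bounds
    of [rpart a] relative to the [vs k], and a linear functional below [p] inherits all bounds
    reached. *)
Lemma generic_pf (S : set (nat -> A)) b : cond S -> selfadj b -> ~ cle b 0 ->
  exists x : pfun A, fsat S x /\ 0 < x b.
Proof.
move=> [cS dS] sb nb.
have [d d0 nd] : exists2 d : RR, 0 < d & ~ cle (b - d%:S) 0.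
  apply: contrapT => h; apply: nb; apply/cleN0.
  apply: (@closed_posel A (fun n => n.+1%:R^-1%:S - b)).
    move=> n; rewrite -opprB; apply/cleN0; apply: contrapT => h2; apply: h.
    by exists n.+1%:R^-1 => //; rewrite invr_gt0 ltr0n.
  move=> e e0; have [N hN] : exists N : nat, N%:R > e^-1 by exists (Num.bound e^-1); apply: archi_boundP; rewrite invr_ge0 ltW.
  exists N => n Nn; rewrite opprK subrK nmS ger0_norm ?invr_ge0 ?ler0n //.
  rewrite invf_plt ?posrE ?ltr0n //; apply: lt_le_trans hN _.
  by rewrite ler_nat (leq_trans Nn).
have [p0 [sp0 p00 p0E]] := not_neg_decomp (sa_B sb (sa_S A d)) nd.
have /countable_injP[code codeI] := cS.
pose g i := xget (fun=> 0) [set y | S y /\ code y = i]%classic.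
have gD i : Dec0 (g i).
  rewrite /g; case: xgetP => [y _ [Sy _]|_]; first exact: dS.
  split=> [n|n|c _ h]; [exact: posel0 | exact: cle_refl | exact: (h 0%N)].
have gS y : S y -> exists i, g i = y.
  move=> Sy; exists (code y); rewrite /g; case: xgetP => [z _ [Sz e]|h].
    by apply: codeI => //; rewrite inE.
  by case: (h y).
pose good k v w := v * w <> 0 /\ forall i m, unpickle k = Some (i, m) ->
  exists n, cle ((v * w)^† * g i n * (v * w)) (m.+1%:R^-1%:C *: ((v * w)^† * (v * w))).
pose vs := fix vs k : A := if k is k'.+1 then vs k' * xget 1 (good k' (vs k')) else p0.
have step k : vs k <> 0 -> good k (vs k) (xget 1 (good k (vs k))).
  move=> v0; case: xgetP => // h.
  case E: (@unpickle (nat * nat)%type k) => [[i m]|].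
    have [w [w0 wn]] := refine v0 (gD i) (ltac:(by rewrite invr_gt0 ltr0n) : (0 : RR) < m.+1%:R^-1).
    by case: (h w); split=> // i' m'; rewrite E => -[<- <-].
  by case: (h 1); split; [rewrite mulr1 | move=> i m; rewrite E].
have vs0 k : vs k <> 0 by elim: k => [//|k IH]; have [] := step k IH.
have vsw k k' : (k <= k')%N -> exists w, vs k' = vs k * w.
  move=> /subnK <-; elim: (k' - k)%N => [|j [w hw]]; first by exists 1; rewrite mulr1.
  by exists (w * xget 1 (good (j + k)%N (vs (j + k)%N))); rewrite addSn /= hw mulrA.
pose Q a (l : RR) := exists k, cle ((vs k)^† * rpart a * vs k) (l%:C *: ((vs k)^† * vs k)).
have Qmono a l k k' : (k <= k')%N -> cle ((vs k)^† * rpart a * vs k) (l%:C *: ((vs k)^† * vs k)) ->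
    cle ((vs k')^† * rpart a * vs k') (l%:C *: ((vs k')^† * vs k')).
  move=> /vsw[w ->] /(cle_conj w); congr cle; rewrite !stE; last by ncalg.
  by rewrite !mulrA.
have vpos k : posel ((vs k)^† * vs k) by exists (vs k).
(* Since no [vs k] is 0, a relative upper bound cannot drop below [- nm (rpart a)]; this keeps [p]
   finite. *)
have Qlb a l : Q a l -> - nm (rpart a) <= l.
  case=> k hk; rewrite leNgt; apply/negP => hl.
  apply: (vs0 k); apply: stM_eq0; set t := _ * _.
  have h1 : cle (- ((nm (rpart a))%:C *: t)) ((vs k)^† * rpart a * vs k).
    have := cle_conj (vs k) (cle_nmN (sa_rpart a)); congr cle.
    by rewrite mulrN mulNr rMS -scalerAl.
  have h2 := cle_trans h1 hk.
  have r0 : 0 < - (l + nm (rpart a)) by lra.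
  have h3 : (- (l + nm (rpart a)))%:C *: t = 0.
    apply: posel_anti; first by apply: posel_Z (vpos k); exact: ltW.
    by move: h2; rewrite /cle opprK -scalerDl -rmorphD -scaleNr -rmorphN opprK.
  exact: scale_gt0_eq0 h3.
have hlb a : has_lbound [set l | Q a l]%classic.
  by exists (- nm (rpart a)) => l; apply: Qlb.
have ne a : ([set l | Q a l] !=set0)%classic.
  by exists (nm (rpart a)), 0%N; apply: conj_le; apply: sa_rpart.
pose p a := inf [set l | Q a l]%classic.
have pQ a l : Q a l -> p a <= l by move=> h; apply: ge_inf.
have lp a l : (forall m, Q a m -> l <= m) -> l <= p a by move=> h; apply: lb_le_inf.
have hp : sublinear p.
  split=> [a c|r a r0].
    rewrite -lerBlDr; apply: (lp) => l [k hk]; rewrite lerBlDr -lerBlDl; apply: (lp) => m [k' hk'].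
    rewrite lerBlDl; apply: pQ; exists (maxn k k').
    have := cle_D (Qmono _ _ _ _ (leq_maxl k k') hk) (Qmono _ _ _ _ (leq_maxr k k') hk').
    rewrite -scalerDl -rmorphD; congr cle; rewrite -mulrDl -mulrDr; congr (_ * _ * _).
    by rewrite /rpart -scalerDr cs_starD addrACA.
  rewrite mulrC -ler_pdivrMr //; apply: lp => l [k hk]; rewrite ler_pdivrMr // mulrC.
  apply: pQ; exists k; have := cle_Z (ltW r0) hk; rewrite scalerA -rmorphM; congr cle.
  by rewrite /rpart stR; ncalg.
have [f [fD fZ fp]] := hahn_banach hp.
have f0 : f 0 = 0 by have := fD 0 0; rewrite addr0; lra.
have fN a : f (- a) = - f a by have := fD a (- a); rewrite subrr f0; lra.
have rsa a : selfadj a -> rpart a = a by move=> h; rewrite /rpart h half_dbl.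
(* [p] only sees [rpart], which vanishes on [a - a^†]; used for [a] and [a^†] this makes [f]
   invariant under the adjoint. *)
have rz a : f (a - a^†) <= 0.
  apply: le_trans (fp _) _; apply: pQ; exists 0%N.
  by rewrite /rpart stB cs_starK addrA subrK subrr scaler0 mulr0 mul0r scale0r; apply: cle_refl.
have fst a : f a^† = f a.
  have := rz a; have := rz a^†; rewrite cs_starK !fD !fN; lra.
have fpos a : posel a -> 0 <= f a.
  move=> ha; rewrite -oppr_le0 -fN; apply: le_trans (fp _) _; apply: pQ; exists 0%N.
  rewrite rsa; last by apply: sa_N; apply: posel_sa.
  by rewrite scale0r; apply/cleN0; rewrite mulrN mulNr opprK; apply: posel_conj.
exists (PFun fD fZ fst fpos); split=> /=.
- move=> y Sy e e0; have [i <-] := gS y Sy.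
  have [m hm] : exists m : nat, m%:R > e^-1 by exists (Num.bound e^-1); apply: archi_boundP; rewrite invr_ge0 ltW.
  have [_ /(_ i m (pickleK _))[n hn]] := step (pickle (i, m)) (vs0 _).
  exists n; apply: le_lt_trans (fp _) _; apply: (@le_lt_trans _ _ m.+1%:R^-1).
    apply: pQ; exists (pickle (i, m)).+1; rewrite rsa //.
    by case: (gD i) => py _ _; apply: posel_sa.
  rewrite invf_plt ?posrE ?ltr0n //; apply: lt_le_trans hm _.
  by rewrite ler_nat.
- suff : f (- b) <= - d by rewrite fN; lra.
  apply: le_trans (fp _) _; apply: pQ; exists 0%N; rewrite rsa; last exact: sa_N.
  rewrite /= /cle sp0; have -> : (- d)%:C *: (p0 * p0) - p0 * - b * p0 = p0 * (b - d%:S) * p0.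
    by rewrite rmorphN; ncalg.
  by rewrite p0E; apply: posel_sq; apply: sa_sq.
Qed.
End Generic.

(** * Linear and positive maps *)

Section PositiveMaps.
Variables (A B : cstar) (f : A -> B).
Hypothesis fL : clinear f.

Lemma clin0 : f 0 = 0.
Proof. by have := fL (-1) 0 0; rewrite scaleN1r addNr scaleN1r addNr. Qed.
Lemma clinZ (c : CC) a : f (c *: a) = c *: f a.
Proof. by rewrite -[c *: a]addr0 fL clin0 addr0. Qed.
Lemma clinD a b : f (a + b) = f a + f b.
Proof. by rewrite -[X in f (X + _)]scale1r fL scale1r. Qed.
Lemma clinN a : f (- a) = - f a.
Proof. by rewrite -scaleN1r clinZ scaleN1r. Qed.
Lemma clinB a b : f (a - b) = f a - f b.
Proof. by rewrite clinD clinN. Qed.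

Lemma cp_positive : completely_positive f -> positive_map f.
Proof.
move=> cp _ [b ->].
have [|Z /matrixP/(_ ord0 ord0)] := cp 1%N (\matrix_(i, j) (b^† * b)).
  exists (\matrix_(i, j) b); apply/matrixP => i j.
  by rewrite !mxE big_ord1 !mxE.
by rewrite !mxE big_ord1 !mxE => ->; exists (Z ord0 ord0).
Qed.

Hypothesis fpos : positive_map f.

Lemma pos_sa h : selfadj h -> selfadj (f h).
Proof.
move=> sh; have -> : f h = half *: (half *: (f ((h + 1) * (h + 1)) - f ((h - 1) * (h - 1)))).
  rewrite -clinB -!clinZ; congr f.
  have -> : (h + 1) * (h + 1) - (h - 1) * (h - 1) = (h + h) + (h + h) by ncalg.
  by rewrite !half_dbl.
by do 2 apply: sa_Z; apply: sa_B; apply/posel_sa/fpos/posel_sq; [apply: sa_D | apply: sa_B] => //; apply: sa_1.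
Qed.

Lemma pos_st a : f a^† = (f a)^†.
Proof.
have sh := sa_rpart a; have sk := sa_ipart a; rewrite [a]ripart.
move: (rpart a) (ipart a) sh sk => h k sh sk.
by rewrite cs_starD stI sh sk !clinD clinN !clinZ cs_starD stI !pos_sa.
Qed.

Lemma pos_cle a b : cle a b -> cle (f a) (f b).
Proof. by rewrite /cle -clinB; apply: fpos. Qed.

Lemma pos_incr u : incr_sa u -> incr_sa (f \o u).
Proof. by case=> su mu; split=> n; [apply: pos_sa | apply: pos_cle]. Qed.
End PositiveMaps.

(** * Hilbert modules over a C*-algebra and the Stinespring construction *)

(* A complex space with a real inner product for which multiplication by [i] is skew; this is the real part of a sesquilinear form. *)
Record pmod (A : cstar) := PMod {
  pm_car :> lmodType CC;
  pip : pm_car -> pm_car -> RR;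
  pact : A -> pm_car -> pm_car;
  pipC : forall x y, pip x y = pip y x;
  pipD : forall x y z, pip (x + y) z = pip x z + pip y z;
  pipR : forall (r : RR) x y, pip (r%:C *: x) y = r * pip x y;
  pipZ : forall (c : CC) x y, pip (c *: x) y = pip x (c^* *: y);
  pip_ge0 : forall x, 0 <= pip x x;
  pactD : forall a b x, pact (a + b) x = pact a x + pact b x;
  pactZ : forall (c : CC) a x, pact (c *: a) x = c *: pact a x;
  pactM : forall a b x, pact (a * b) x = pact a (pact b x);
  pact1 : forall x, pact 1 x = x;
  pactL : forall a (c : CC) x y, pact a (c *: x + y) = c *: pact a x + pact a y;
  pact_st : forall a x y, pip (pact a x) y = pip x (pact a^† y) }.

Section PMod.
Variables (A : cstar) (P : pmod A).
Implicit Types (x y z : P) (a b : A).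

Definition pn x := Num.sqrt (pip x x).

Lemma pip0 x : pip 0 x = 0.
Proof. by rewrite -(scale0r (0 : P)) (_ : 0 = 0%:C) // pipR mul0r. Qed.
Lemma pip0r x : pip x 0 = 0. Proof. by rewrite pipC pip0. Qed.
Lemma pipDr x y z : pip x (y + z) = pip x y + pip x z.
Proof. by rewrite pipC pipD !(pipC x). Qed.
Lemma pipN x y : pip (- x) y = - pip x y.
Proof. by have := pipD x (- x) y; rewrite subrr pip0; lra. Qed.
Lemma pipNr x y : pip x (- y) = - pip x y.
Proof. by rewrite pipC pipN pipC. Qed.
Lemma pipRr (r : RR) x y : pip x (r%:C *: y) = r * pip x y.
Proof. by rewrite pipC pipR pipC. Qed.
Lemma pipB x y z : pip (x - y) z = pip x z - pip y z.
Proof. by rewrite pipD pipN. Qed.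
Lemma pipBr x y z : pip x (y - z) = pip x y - pip x z.
Proof. by rewrite pipDr pipNr. Qed.
Lemma pipZr (c : CC) x y : pip x (c *: y) = pip (c^* *: x) y.
Proof. by rewrite pipC pipZ pipC. Qed.

Lemma pn_ge0 x : 0 <= pn x. Proof. exact: sqrtr_ge0. Qed.
Lemma pn2 x : pn x ^+ 2 = pip x x. Proof. by rewrite sqr_sqrtr // pip_ge0. Qed.
Lemma pn0 : pn 0 = 0. Proof. by rewrite /pn pip0 sqrtr0. Qed.
Lemma pnN x : pn (- x) = pn x. Proof. by rewrite /pn pipN pipNr opprK. Qed.

Lemma pip_CS2 x y : pip x y ^+ 2 <= pip x x * pip y y.
Proof.
have h (t : RR) : 0 <= pip x x - 2 * t * pip x y + t ^+ 2 * pip y y.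
  have := pip_ge0 (x - t%:C *: y).
  rewrite pipB !pipBr !pipR !pipRr (pipC y x).
  by move=> hh; lra.
have hx := pip_ge0 x; have := pip_ge0 y; rewrite le_eqVlt => /orP[/eqP y0|y0].
  rewrite -y0 mulr0; have := h (pip x y); have := h (- pip x y).
  have := h ((pip x x + 1) / pip x y).
  have [->|p0] := eqVneq (pip x y) 0; first by rewrite expr0n.
  by rewrite -y0 mulr0 addr0 -mulrA divfK //; lra.
have := h (pip x y / pip y y); rewrite -(ler_pM2r y0) mul0r.
set p := pip x y; set q := pip y y; set s := pip x x => hh.
have e : (s - 2 * (p / q) * p + (p / q) ^+ 2 * q) * q = s * q - p ^+ 2.
  by field; rewrite gt_eqF.
by rewrite e in hh; lra.
Qed.

Lemma pip_CS x y : `|pip x y| <= pn x * pn y.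
Proof.
rewrite -(@ler_pXn2r _ 2) ?nnegrE ?normr_ge0 ?mulr_ge0 ?pn_ge0 //.
by rewrite real_normK ?num_real // exprMn !pn2 pip_CS2.
Qed.

Lemma pnD x y : pn (x + y) <= pn x + pn y.
Proof.
rewrite -(@ler_pXn2r _ 2) ?nnegrE ?addr_ge0 ?pn_ge0 // pn2 pipD !pipDr (pipC y x).
have := le_trans (ler_norm _) (pip_CS x y); have := pn2 x; have := pn2 y.
by rewrite !expr2; nra.
Qed.

Lemma pnB x y : pn (x - y) = pn (y - x).
Proof. by rewrite -pnN opprB. Qed.
Lemma pn_tri y x z : pn (x - z) <= pn (x - y) + pn (y - z).
Proof. by have := pnD (x - y) (y - z); rewrite addrA subrK. Qed.

Lemma pnZ (c : CC) x : pn (c *: x) <= cabs c * pn x.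
Proof.
have e : pip (c *: x) (c *: x) = cabs c ^+ 2 * pip x x.
  rewrite pipZ scalerA -pipRr; congr (pip _ (_ *: _)); rewrite mulrC.
  case: c => u v; rewrite /cabs /= sqr_sqrtr ?addr_ge0 ?sqr_ge0 //; cplx.
rewrite /pn e sqrtrM ?sqr_ge0 // sqrtr_sqr ger0_norm //.
by rewrite /cabs; case: c {e} => u v; apply: sqrtr_ge0.
Qed.

Lemma pn_near (e : RR) x y x' y' : pn (x - y) < e / 3 -> pn (x' - y') < e / 3 ->
  pn (x - x') < e / 3 -> pn (y - y') < e.
Proof.
move=> h1 h2 h3; have := pn_tri x y y'; have := pn_tri x' x y'.
by rewrite (pnB y x); lra.
Qed.

Lemma pn_near2 (e : RR) x y z : 0 < e -> pn (x - y) < e / 3 -> pn (z - y) <= e / 3 ->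
  pn (x - z) < e.
Proof. by move=> e0 h1 h2; have := pn_tri y x z; rewrite (pnB y z); lra. Qed.

Lemma pact0 x : pact 0 x = 0.
Proof. by rewrite -(scale0r (0 : A)) pactZ scale0r. Qed.
Lemma pactN a x : pact (- a) x = - pact a x.
Proof. by rewrite -[- a]scaleN1r pactZ scaleN1r. Qed.
Lemma pactB a b x : pact (a - b) x = pact a x - pact b x.
Proof. by rewrite pactD pactN. Qed.
Lemma pact_D a x y : pact a (x + y) = pact a x + pact a y.
Proof. by rewrite -[x]scale1r pactL !scale1r. Qed.
Lemma pact_0 a : pact a 0 = 0 :> P.
Proof. by have := pact_D a 0 0; rewrite addr0 -[X in X = _]addr0 => /addrI. Qed.
Lemma pact_Z a (c : CC) x : pact a (c *: x) = c *: pact a x.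
Proof. by rewrite -[c *: x]addr0 pactL pact_0 addr0. Qed.
Lemma pact_N a x : pact a (- x) = - pact a x.
Proof. by rewrite -scaleN1r pact_Z scaleN1r. Qed.
Lemma pact_B a x y : pact a (x - y) = pact a x - pact a y.
Proof. by rewrite pact_D pact_N. Qed.

Lemma pip_pos a x : posel a -> 0 <= pip (pact a x) x.
Proof. by case=> b ->; rewrite pactM pact_st cs_starK pip_ge0. Qed.

Lemma pip_le a b x : cle a b -> pip (pact a x) x <= pip (pact b x) x.
Proof. by move=> /(pip_pos x); rewrite pactB pipB subr_ge0. Qed.

(** Boundedness is not a field of [pmod]: it comes from positivity of the form and [stM_le]. *)
Lemma pact_bound a x : pn (pact a x) <= nm a * pn x.
Proof.
rewrite -(@ler_pXn2r _ 2) ?nnegrE ?pn_ge0 ?mulr_ge0 ?nm_ge0 ?pn_ge0 // exprMn !pn2.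
have := pip_le x (stM_le a); rewrite pactM pact_st cs_starK pactZ pact1 pipR.
by [].
Qed.

Definition cvgP (u : nat -> P) x :=
  forall e : RR, 0 < e -> exists N, forall n, (N <= n)%N -> pn (u n - x) < e.
Definition cauchyP (u : nat -> P) :=
  forall e : RR, 0 < e -> exists N, forall m n, (N <= m)%N -> (N <= n)%N -> pn (u m - u n) < e.

Lemma cauchyP_cst x : cauchyP (fun=> x).
Proof. by move=> e e0; exists 0%N => m n _ _; rewrite subrr pn0. Qed.
Lemma cauchyPD u v : cauchyP u -> cauchyP v -> cauchyP (fun n => u n + v n).
Proof.
move=> hu hv e e0; have e2 : 0 < e / 2 by lra.
have [N1 h1] := hu _ e2; have [N2 h2] := hv _ e2.
exists (maxn N1 N2) => m n; rewrite !geq_max => /andP[m1 m2] /andP[n1 n2].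
have := pnD (u m - u n) (v m - v n); rewrite addrACA -opprD.
by have := h1 _ _ m1 n1; have := h2 _ _ m2 n2; lra.
Qed.
Lemma cauchyP_lip (f : P -> P) (C : RR) u :
  (forall x y, pn (f x - f y) <= C * pn (x - y)) -> cauchyP u -> cauchyP (f \o u).
Proof.
move=> hf hu e e0; have C0 : 0 < `|C| + 1 by have := normr_ge0 C; lra.
have [N h] := hu (e / (`|C| + 1)) (divr_gt0 e0 C0).
exists N => m n Nm /(h _ _ Nm); rewrite ltr_pdivlMr // => hn; apply: le_lt_trans hn.
apply: le_trans (hf _ _) _; rewrite mulrC ler_wpM2l ?pn_ge0 //.
by have := ler_norm C; lra.
Qed.
Lemma cauchyPZ (c : CC) u : cauchyP u -> cauchyP (fun n => c *: u n).
Proof.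
apply: (@cauchyP_lip (fun x => c *: x) (cabs c)) => x y.
by rewrite -scalerBr; apply: pnZ.
Qed.
Lemma cauchyP_act a u : cauchyP u -> cauchyP (fun n => pact a (u n)).
Proof.
apply: (@cauchyP_lip (fun x => pact a x) (nm a)) => x y.
by rewrite -pact_B; apply: pact_bound.
Qed.
Lemma cauchyP_bounded u : cauchyP u -> exists M, forall n, pn (u n) <= M.
Proof.
move=> h; have [N hN] := h 1 ltr01.
exists (pn (u N) + 1 + \sum_(i < N) pn (u i)) => n.
have s0 : 0 <= \sum_(i < N) pn (u i) by apply: sumr_ge0 => i _; apply: pn_ge0.
have [nN|nN] := leqP N n.
  by have := pnD (u n - u N) (u N); rewrite subrK; have := hN _ _ nN (leqnn N); lra.
have : pn (u n) <= \sum_(i < N) pn (u i).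
  rewrite (bigD1 (Ordinal nN)) //= lerDl; apply: sumr_ge0 => i _; exact: pn_ge0.
by have := pn_ge0 (u N); lra.
Qed.

End PMod.

Record hmod (A : cstar) := HMod {
  hm_pmod :> pmod A;
  hm_def : forall x : hm_pmod, pip x x = 0 -> x = 0;
  hm_complete : forall u : nat -> hm_pmod, cauchyP u -> exists x, cvgP u x }.

(** * Limits of real sequences *)

Section RealLimits.
Definition cvgR (u : nat -> RR) l :=
  forall e : RR, 0 < e -> exists N, forall n, (N <= n)%N -> `|u n - l| < e.

Lemma cauchyR_cvg (u : nat -> RR) :
  (forall e : RR, 0 < e -> exists N, forall m n, (N <= m)%N -> (N <= n)%N -> `|u m - u n| < e) ->
  exists l, cvgR u l.
Proof.
(* The limit is found as the supremum of the eventual lower bounds, that is, as the lower limit. *)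
move=> h; set E := [set x | exists N, forall n, (N <= n)%N -> x <= u n]%classic.
have ub e N : (forall m n, (N <= m)%N -> (N <= n)%N -> `|u m - u n| < e) ->
    ubound E (u N + e) /\ E (u N - e).
  move=> hN; split=> [x [K hK]|].
    have := hK _ (leq_maxl K N); have := hN _ _ (leq_maxr K N) (leqnn N).
    by rewrite ltr_norml => /andP[]; lra.
  exists N => n Nn; have := hN _ _ (leqnn N) Nn; rewrite ltr_norml => /andP[]; lra.
have hs : has_sup E.
  have [N hN] := h 1 ltr01; have [h1 h2] := ub _ _ hN.
  by split; [exists (u N - 1) | exists (u N + 1)].
exists (sup E) => e e0; have [N hN] := h (e / 2) ltac:(lra); exists N => n Nn.
have [h1 h2] := ub _ _ hN.
have h3 : u N - e / 2 <= sup E by apply: sup_upper_bound.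
have h4 : sup E <= u N + e / 2 by apply: ge_sup => //; exists (u N - e / 2).
have := hN _ _ Nn (leqnn N); rewrite !ltr_norml => /andP[h5 h6].
by apply/andP; split; lra.
Qed.

Lemma cvgR_unique u l m : cvgR u l -> cvgR u m -> l = m.
Proof.
move=> hl hm; apply/eqP; rewrite -subr_eq0 -normr_le0 leNgt; apply/negP => h.
have [N1 h1] := hl _ (divr_gt0 h (ltr0n _ 2)); have [N2 h2] := hm _ (divr_gt0 h (ltr0n _ 2)).
have := ler_normD (l - u (maxn N1 N2)) (u (maxn N1 N2) - m); rewrite addrA subrK (distrC l (u _)).
by have := h1 _ (leq_maxl N1 N2); have := h2 _ (leq_maxr N1 N2); lra.
Qed.

Lemma cvgRD u v l m : cvgR u l -> cvgR v m -> cvgR (fun n => u n + v n) (l + m).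
Proof.
move=> hu hv e e0; have e2 : 0 < e / 2 by lra.
have [N1 h1] := hu _ e2; have [N2 h2] := hv _ e2.
exists (maxn N1 N2) => n; rewrite geq_max => /andP[n1 n2].
have := ler_normD (u n - l) (v n - m); rewrite addrACA -opprD.
by have := h1 _ n1; have := h2 _ n2; lra.
Qed.

Lemma cvgRZ (r : RR) u l : cvgR u l -> cvgR (fun n => r * u n) (r * l).
Proof.
move=> hu e e0; have C0 : 0 < `|r| + 1 by have := normr_ge0 r; lra.
have [N h] := hu (e / (`|r| + 1)) (divr_gt0 e0 C0).
exists N => n /h; rewrite ltr_pdivlMr // => hn; apply: le_lt_trans hn.
rewrite -mulrBr normrM mulrC ler_wpM2l ?normr_ge0 //; lra.
Qed.

Lemma cvgR_le u l M : cvgR u l -> (exists N, forall n, (N <= n)%N -> u n <= M) -> l <= M.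
Proof.
move=> hu [N hN]; rewrite leNgt; apply/negP => h.
have [K hK] := hu (l - M) ltac:(lra).
have := hK _ (leq_maxr N K); have := hN _ (leq_maxl N K).
by rewrite ltr_norml => h1 /andP[]; lra.
Qed.

Lemma cvgR_ge u l M : cvgR u l -> (exists N, forall n, (N <= n)%N -> M <= u n) -> M <= l.
Proof.
move=> hu [N hN]; rewrite leNgt; apply/negP => h.
have [K hK] := hu (M - l) ltac:(lra).
have := hK _ (leq_maxr N K); have := hN _ (leq_maxl N K).
by rewrite ltr_norml => h1 /andP[]; lra.
Qed.

Lemma cvgR_cst r : cvgR (fun=> r) r.
Proof. by move=> e e0; exists 0%N => n _; rewrite subrr normr0. Qed.
End RealLimits.

(** * Quotients and completions *)

Section Quotient.
Variables (T : Type) (R : T -> T -> Prop).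
Hypotheses (Rr : forall t, R t t) (Rs : forall s t, R s t -> R t s)
  (Rt : forall r s t, R r s -> R s t -> R r t).

(** Equivalent elements have equal predicates [R s = R t] by extensionality, and choice from equal
    predicates returns the same element. The quotient is the type of these canonical
    representatives, over an arbitrary carrier. *)
Definition qcanon (t : T) : T := sval (cid (ex_intro (R t) t (Rr t))).
Definition quot := {t : T | qcanon t = t}.

Lemma qcanonR t : R t (qcanon t).
Proof. by rewrite /qcanon; case: cid. Qed.

Lemma qcanon_eq s t : R s t -> qcanon s = qcanon t.
Proof.
move=> st; rewrite /qcanon; move: (ex_intro _ _ _) (ex_intro _ _ _).
have -> : R s = R t.
  by apply/funext => r; apply/propext; split=> h; [apply: Rt (Rs st) h | apply: Rt st h].
by move=> e1 e2; rewrite (Prop_irrelevance e1 e2).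
Qed.

Definition qcls t : quot := exist _ (qcanon t) (qcanon_eq (Rs (qcanonR t))).

Lemma qcls_eq s t : R s t -> qcls s = qcls t.
Proof. by move=> /qcanon_eq st; apply: eq_exist. Qed.
Lemma qcls_rep (x : quot) : qcls (sval x) = x.
Proof. by case: x => t ht; apply: eq_exist. Qed.
Lemma qrepR t : R (sval (qcls t)) t.
Proof. exact: Rs (qcanonR t). Qed.
End Quotient.

Section Completion.
Variables (A : cstar) (P : pmod A).

Definition cseq := {u : nat -> P | cauchyP u}.
Definition nullseq (u : nat -> P) := cvgR (fun n => pn (u n)) 0.
Definition ceq (u v : cseq) := nullseq (fun n => sval u n - sval v n).

Lemma nullseq_le (u : nat -> P) (w : nat -> RR) : cvgR w 0 -> (forall n, pn (u n) <= w n) -> nullseq u.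
Proof.
move=> hw uw e /hw[N hN]; exists N => n /hN; rewrite !subr0 => h.
rewrite ger0_norm ?pn_ge0 //; apply: le_lt_trans (uw n) _.
exact: le_lt_trans (ler_norm _) h.
Qed.
Lemma ceq_refl u : ceq u u.
Proof.
apply: nullseq_le (cvgR_cst 0) _ => n; by rewrite subrr pn0.
Qed.
Lemma ceq_sym u v : ceq u v -> ceq v u.
Proof. by move=> h; apply: nullseq_le h _ => n; rewrite pnB. Qed.
Lemma ceq_trans u v w : ceq u v -> ceq v w -> ceq u w.
Proof.
move=> h1 h2; have := cvgRD h1 h2; rewrite addr0 => h; apply: nullseq_le h _ => n.
exact: pn_tri.
Qed.
Lemma ceq_ext (u v : cseq) : (forall n, sval u n = sval v n) -> ceq u v.
Proof. by move=> h; apply: nullseq_le (cvgR_cst 0) _ => n; rewrite h subrr pn0. Qed.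

Definition hcar := quot ceq_refl.
HB.instance Definition _ := gen_eqMixin hcar.
HB.instance Definition _ := gen_choiceMixin hcar.

Definition hcls (u : cseq) : hcar := qcls ceq_refl ceq_sym ceq_trans u.
Definition hrep (x : hcar) : cseq := sval x.
Lemma hcls_eq u v : ceq u v -> hcls u = hcls v. Proof. exact: qcls_eq. Qed.
Lemma hclsK x : hcls (hrep x) = x. Proof. exact: qcls_rep. Qed.
Lemma hrepK u : ceq (hrep (hcls u)) u.
Proof. exact: (qrepR ceq_refl ceq_sym ceq_trans u). Qed.

Definition cs_cst (x : P) : cseq := exist _ _ (cauchyP_cst x).
Definition cs_add (u v : cseq) : cseq := exist _ _ (cauchyPD (svalP u) (svalP v)).
Definition cs_scale (c : CC) (u : cseq) : cseq := exist _ _ (cauchyPZ c (svalP u)).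
Definition cs_act (a : A) (u : cseq) : cseq := exist _ _ (cauchyP_act a (svalP u)).

Lemma ceq_add u u' v v' : ceq u u' -> ceq v v' -> ceq (cs_add u v) (cs_add u' v').
Proof.
move=> h1 h2; have := cvgRD h1 h2; rewrite addr0 => h; apply: nullseq_le h _ => n.
by rewrite /= opprD addrACA; apply: pnD.
Qed.
Lemma ceq_scale c u u' : ceq u u' -> ceq (cs_scale c u) (cs_scale c u').
Proof.
move=> h1; have := cvgRZ (cabs c) h1; rewrite mulr0 => h; apply: nullseq_le h _ => n.
by rewrite /= -scalerBr; apply: pnZ.
Qed.
Lemma ceq_act a u u' : ceq u u' -> ceq (cs_act a u) (cs_act a u').
Proof.
move=> h1; have := cvgRZ (nm a) h1; rewrite mulr0 => h; apply: nullseq_le h _ => n.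
by rewrite /= -pact_B; apply: pact_bound.
Qed.

Definition hzero : hcar := hcls (cs_cst 0).
Definition hadd (x y : hcar) : hcar := hcls (cs_add (hrep x) (hrep y)).
Definition hscale (c : CC) (x : hcar) : hcar := hcls (cs_scale c (hrep x)).
Definition hactf (a : A) (x : hcar) : hcar := hcls (cs_act a (hrep x)).
Definition hopp (x : hcar) : hcar := hscale (-1) x.

Lemma hadd_cls u v : hadd (hcls u) (hcls v) = hcls (cs_add u v).
Proof. by apply: hcls_eq; apply: ceq_add; apply: hrepK. Qed.
Lemma hscale_cls c u : hscale c (hcls u) = hcls (cs_scale c u).
Proof. by apply: hcls_eq; apply: ceq_scale; apply: hrepK. Qed.
Lemma hact_cls a u : hactf a (hcls u) = hcls (cs_act a u).
Proof. by apply: hcls_eq; apply: ceq_act; apply: hrepK. Qed.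
Lemma hcls_ext (u v : cseq) : (forall n, sval u n = sval v n) -> hcls u = hcls v.
Proof. by move=> h; apply: hcls_eq; apply: ceq_ext. Qed.

Lemma haddA : associative hadd.
Proof.
move=> x y z; rewrite -[x]hclsK -[y]hclsK -[z]hclsK !hadd_cls.
by apply: hcls_ext => n /=; rewrite addrA.
Qed.
Lemma haddC : commutative hadd.
Proof.
move=> x y; rewrite -[x]hclsK -[y]hclsK !hadd_cls.
by apply: hcls_ext => n /=; rewrite addrC.
Qed.
Lemma hadd0 : left_id hzero hadd.
Proof. by move=> x; rewrite -[x]hclsK hadd_cls; apply: hcls_ext => n /=; rewrite add0r. Qed.
Lemma haddN : left_inverse hzero hopp hadd.
Proof.
move=> x; rewrite -[x]hclsK /hopp hscale_cls hadd_cls; apply: hcls_ext => n /=.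
by rewrite scaleN1r addNr.
Qed.
HB.instance Definition _ := GRing.isZmodule.Build hcar haddA haddC hadd0 haddN.
Lemma hclsD u v : hcls u + hcls v = hcls (cs_add u v). Proof. exact: hadd_cls. Qed.

Lemma hscaleA c d x : hscale c (hscale d x) = hscale (c * d) x.
Proof. by rewrite -[x]hclsK !hscale_cls; apply: hcls_ext => n /=; rewrite scalerA. Qed.
Lemma hscale1 : left_id 1 hscale.
Proof. by move=> x; rewrite -[x]hclsK !hscale_cls; apply: hcls_ext => n /=; rewrite scale1r. Qed.
Lemma hscaleDr : right_distributive hscale +%R.
Proof.
move=> c x y; rewrite -[x]hclsK -[y]hclsK hclsD !hscale_cls hclsD.
by apply: hcls_ext => n /=; rewrite scalerDr.
Qed.
Lemma hscaleDl x : {morph hscale^~ x : c d / c + d}.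
Proof.
move=> c d; rewrite -[x]hclsK /= !hscale_cls hclsD.
by apply: hcls_ext => n /=; rewrite scalerDl.
Qed.
HB.instance Definition _ := GRing.Zmodule_isLmodule.Build CC hcar hscaleA hscale1 hscaleDr hscaleDl.

Lemma hclsZ c u : c *: hcls u = hcls (cs_scale c u). Proof. exact: hscale_cls. Qed.

Lemma pip_cauchy (u v : cseq) : exists l, cvgR (fun n => pip (sval u n) (sval v n)) l.
Proof.
apply: cauchyR_cvg => e e0.
have [M hM] := cauchyP_bounded (svalP u); have [K hK] := cauchyP_bounded (svalP v).
have M0 : 0 <= M := le_trans (pn_ge0 _) (hM 0%N).
have K0 : 0 <= K := le_trans (pn_ge0 _) (hK 0%N).
have C0 : 0 < M + K + 1 by lra.
have [N1 h1] := svalP u _ (divr_gt0 e0 C0); have [N2 h2] := svalP v _ (divr_gt0 e0 C0).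
exists (maxn N1 N2) => m n; rewrite !geq_max => /andP[m1 m2] /andP[n1 n2].
have := h1 _ _ m1 n1; have := h2 _ _ m2 n2; rewrite !ltr_pdivlMr //.
set x := sval u m; set x' := sval u n; set y := sval v m; set y' := sval v n => a2 a1.
have -> : pip x y - pip x' y' = pip (x - x') y + pip x' (y - y').
  by rewrite pipB pipBr addrA subrK.
apply: le_lt_trans (ler_normD _ _) _.
have b1 := pip_CS (x - x') y; have b2 := pip_CS x' (y - y').
have b3 : pn (x - x') * pn y <= pn (x - x') * K by rewrite ler_wpM2l ?pn_ge0 ?hK.
have b4 : pn x' * pn (y - y') <= M * pn (y - y') by rewrite ler_wpM2r ?pn_ge0 ?hM.
have := pn_ge0 (x - x'); have := pn_ge0 (y - y').
set p := pn (x - x') in a1 b1 b3 *; set q := pn (y - y') in a2 b2 b4 * => q0 p0.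
have [pq|/ltW pq] := leP p q; nra.
Qed.

Definition hip (x y : hcar) : RR := sval (cid (pip_cauchy (hrep x) (hrep y))).

Lemma nullseq_pip (u : nat -> P) (v : cseq) : nullseq u -> cvgR (fun n => pip (u n) (sval v n)) 0.
Proof.
move=> hu; have [K hK] := cauchyP_bounded (svalP v).
have := cvgRZ K hu; rewrite mulr0 => h e /h[N hN]; exists N => n /hN.
rewrite !subr0; apply: le_lt_trans; rewrite mulrC normrM.
apply: le_trans (pip_CS _ _) _; rewrite (ger0_norm (pn_ge0 _)) ler_wpM2l ?pn_ge0 //.
exact: le_trans (hK n) (ler_norm _).
Qed.

Lemma hip_cls u v : cvgR (fun n => pip (sval u n) (sval v n)) (hip (hcls u) (hcls v)).
Proof.
rewrite /hip; move: (cid _) => [l hl]; rewrite [sval _]/=.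
have h1 := nullseq_pip v (ceq_sym (hrepK u)).
have h2 := nullseq_pip (hrep (hcls u)) (ceq_sym (hrepK v)).
have := cvgRD (cvgRD hl h1) h2; rewrite !addr0.
congr cvgR; apply/funext => n; rewrite !pipB (pipC (sval v n)) (pipC (sval (hrep (hcls v)) n)).
by ring.
Qed.

Lemma hip_eq u v l : cvgR (fun n => pip (sval u n) (sval v n)) l -> hip (hcls u) (hcls v) = l.
Proof. exact: cvgR_unique (hip_cls u v). Qed.

Lemma hipC x y : hip x y = hip y x.
Proof.
rewrite -[x]hclsK -[y]hclsK; apply: hip_eq; have := hip_cls (hrep y) (hrep x).
by congr cvgR; apply/funext => n; rewrite pipC.
Qed.
Lemma hipD x y z : hip (x + y) z = hip x z + hip y z.
Proof.
rewrite -[x]hclsK -[y]hclsK -[z]hclsK hclsD; apply: hip_eq.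
have := cvgRD (hip_cls (hrep x) (hrep z)) (hip_cls (hrep y) (hrep z)).
by congr cvgR; apply/funext => n; rewrite pipD.
Qed.
Lemma hipR (r : RR) x y : hip (r%:C *: x) y = r * hip x y.
Proof.
rewrite -[x]hclsK -[y]hclsK hclsZ; apply: hip_eq.
have := cvgRZ r (hip_cls (hrep x) (hrep y)).
by congr cvgR; apply/funext => n; rewrite pipR.
Qed.
Lemma hipZ (c : CC) x y : hip (c *: x) y = hip x (c^* *: y).
Proof.
rewrite -[x]hclsK -[y]hclsK !hclsZ; apply: hip_eq.
have := hip_cls (hrep x) (cs_scale c^* (hrep y)).
by congr cvgR; apply/funext => n; rewrite pipZ.
Qed.
Lemma hip_ge0 x : 0 <= hip x x.
Proof.
rewrite -[x]hclsK; apply: (cvgR_ge (hip_cls (hrep x) (hrep x))).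
by exists 0%N => n _; apply: pip_ge0.
Qed.
Lemma hip_eq0 x : hip x x = 0 -> x = 0.
Proof.
rewrite -[x]hclsK => h; apply: hcls_eq => e e0.
have := hip_cls (hrep x) (hrep x); rewrite h => /(_ (e ^+ 2)) []; first by rewrite exprn_gt0.
move=> N hN; exists N => n /hN; rewrite !subr0 -pn2 !ger0_norm ?pn_ge0 ?exprn_ge0 ?pn_ge0 //.
by rewrite ltr_pXn2r ?nnegrE ?pn_ge0 // ltW.
Qed.

Lemma hactZ c a x : hactf (c *: a) x = c *: hactf a x.
Proof.
rewrite -[x]hclsK !hact_cls hclsZ; apply: hcls_ext => n /=; exact: pactZ.
Qed.
Lemma hactD a b x : hactf (a + b) x = hactf a x + hactf b x.
Proof. rewrite -[x]hclsK !hact_cls hclsD; apply: hcls_ext => n /=; exact: pactD. Qed.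
Lemma hactM a b x : hactf (a * b) x = hactf a (hactf b x).
Proof. rewrite -[x]hclsK !hact_cls; apply: hcls_ext => n /=; exact: pactM. Qed.
Lemma hact1 x : hactf 1 x = x.
Proof. rewrite -[x in LHS]hclsK hact_cls -[RHS]hclsK; apply: hcls_ext => n /=; exact: pact1. Qed.
Lemma hactL a (c : CC) x y : hactf a (c *: x + y) = c *: hactf a x + hactf a y.
Proof.
rewrite -[x]hclsK -[y]hclsK hclsZ hclsD !hact_cls hclsZ hclsD.
by apply: hcls_ext => n /=; exact: pactL.
Qed.
Lemma hact_st a x y : hip (hactf a x) y = hip x (hactf a^† y).
Proof.
rewrite -[x]hclsK -[y]hclsK !hact_cls; apply: hip_eq.
have := hip_cls (hrep x) (cs_act a^† (hrep y)).
by congr cvgR; apply/funext => n; rewrite /= pact_st.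
Qed.

Definition hpmod : pmod A :=
  PMod hipC hipD hipR hipZ hip_ge0 hactD hactZ hactM hact1 hactL hact_st.

Definition hemb (x : P) : hpmod := hcls (cs_cst x).

Lemma hemb_pip x y : pip (hemb x) (hemb y) = pip x y.
Proof. exact: (@hip_eq (cs_cst x) (cs_cst y) (pip x y) (cvgR_cst (pip x y))). Qed.
Lemma hembL (c : CC) x y : hemb (c *: x + y) = c *: hemb x + hemb y.
Proof. by rewrite /hemb hclsZ hclsD; apply: hcls_ext. Qed.
Lemma hemb_act a x : pact a (hemb x) = hemb (pact a x).
Proof. by rewrite /= hact_cls; apply: hcls_ext. Qed.
Lemma hembB x y : hemb (x - y) = hemb x - hemb y.
Proof. by rewrite addrC -scaleN1r hembL scaleN1r addrC. Qed.

Lemma pn_hcls (u : cseq) (M : RR) : 0 <= M ->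
  (exists N, forall n, (N <= n)%N -> pn (sval u n) <= M) -> pn (hcls u : hpmod) <= M.
Proof.
move=> M0 [N hN]; rewrite -(@ler_pXn2r _ 2) ?nnegrE ?pn_ge0 // pn2.
apply: (cvgR_le (hip_cls u u)); exists N => n /hN h.
by rewrite -pn2 ler_pXn2r ?nnegrE ?pn_ge0.
Qed.

Lemma hcls_near (u : cseq) (e : RR) : 0 < e ->
  exists N, forall n, (N <= n)%N -> pn ((hcls u : hpmod) - hemb (sval u n)) <= e.
Proof.
move=> e0; have [N hN] := svalP u e e0; exists N => n Nn.
have -> : (hcls u : hpmod) - hemb (sval u n) = hcls (cs_add u (cs_scale (-1) (cs_cst (sval u n)))).
  by rewrite -scaleN1r hclsZ hclsD.
apply: pn_hcls; first exact: ltW.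
by exists N => m Nm /=; rewrite scaleN1r ltW // hN.
Qed.

(** Diagonal argument: [v k] in [P] is taken within [1 / (k + 1)] of [x k], and the class of [v] is
    the limit. *)
Lemma hpmod_complete (x : nat -> hpmod) : cauchyP x -> exists l, cvgP x l.
Proof.
move=> hx.
have dense (y : hpmod) (k : nat) : exists v : P, pn (y - hemb v) <= k.+1%:R^-1.
  have [N hN] := hcls_near (hrep y) (ltac:(by rewrite invr_gt0 ltr0n) : (0 : RR) < k.+1%:R^-1).
  by exists (sval (hrep y) N); rewrite -{1}[y]hclsK; apply: hN.
pose v k := sval (cid (dense (x k) k)).
have hv k : pn (x k - hemb (v k)) <= k.+1%:R^-1 by apply: (svalP (cid (dense (x k) k))).
have small (e : RR) : 0 < e -> exists N : nat, forall n, (N <= n)%N -> n.+1%:R^-1 < e.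
  move=> e0; exists (Num.bound e^-1) => n Nn.
  rewrite invf_plt ?posrE ?ltr0n //; apply: lt_le_trans (archi_boundP _) _; first by rewrite invr_ge0 ltW.
  by rewrite ler_nat (leq_trans Nn).
have cv : cauchyP v.
  move=> e e0; have e3 : 0 < e / 3 by lra.
  have [N1 h1] := hx _ e3; have [N2 h2] := small _ e3.
  exists (maxn N1 N2) => m n; rewrite !geq_max => /andP[m1 m2] /andP[n1 n2].
  have -> : pn (v m - v n) = pn (hemb (v m) - hemb (v n)) by rewrite -hembB /pn hemb_pip.
  exact: (@pn_near A hpmod e (x m) (hemb (v m)) (x n) (hemb (v n))
    (le_lt_trans (hv m) (h2 _ m2)) (le_lt_trans (hv n) (h2 _ n2)) (h1 _ _ m1 n1)).
exists (hcls (exist _ v cv)) => e e0; have e3 : 0 < e / 3 by lra.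
have [N1 h1] := hcls_near (exist _ v cv) e3; have [N2 h2] := small _ e3.
exists (maxn N1 N2) => n; rewrite !geq_max => /andP[n1 n2].
exact: (@pn_near2 A hpmod e (x n) (hemb (v n)) (hcls (exist _ v cv)) e0
  (le_lt_trans (hv n) (h2 _ n2)) (h1 _ n1)).
Qed.

Definition completion : hmod A := @HMod A hpmod hip_eq0 hpmod_complete.

End Completion.

Section Sums.
Variable A : cstar.
Lemma st_sum (I : Type) (r : seq I) (F : I -> A) : (\sum_(i <- r) F i)^† = \sum_(i <- r) (F i)^†.
Proof. by elim/big_rec2: _ => [|i a b _ <-]; rewrite ?st0 ?cs_starD. Qed.
Lemma posel_sum (I : Type) (r : seq I) (F : I -> A) :
  (forall i, posel (F i)) -> posel (\sum_(i <- r) F i).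
Proof.
move=> h; elim: r => [|i r IH]; first by rewrite big_nil; apply: posel0.
by rewrite big_cons; apply: posel_D.
Qed.
Lemma pf_sum (x : pfun A) (I : Type) (r : seq I) (F : I -> A) :
  x (\sum_(i <- r) F i) = \sum_(i <- r) x (F i).
Proof. by elim/big_rec2: _ => [|i a b _ <-]; rewrite ?pf0 ?pfD. Qed.
End Sums.

(* The entries of the matrix [mx_adj Y *m Y] where [Y] has first row [f] and is zero elsewhere. *)
Lemma mx_pos_rank1 (A : cstar) n (f : 'I_n.+1 -> A) : mx_pos (\matrix_(i, j) ((f i)^† * f j)).
Proof.
exists (\matrix_(k, j) if k == ord0 then f j else 0); apply/matrixP => i j.
rewrite !mxE (bigD1 ord0) //= !mxE eqxx big1 ?addr0 // => k k0.
by rewrite !mxE (negPf k0) mulr0.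
Qed.

Lemma mx_pos_form (A : cstar) n (X : 'M[A]_n) (b : 'I_n -> A) : mx_pos X ->
  posel (\sum_i \sum_j (b i)^† * X i j * b j).
Proof.
case=> Y ->.
have -> : \sum_i \sum_j (b i)^† * (mx_adj Y *m Y) i j * b j =
    \sum_k (\sum_i Y k i * b i)^† * (\sum_j Y k j * b j).
  transitivity (\sum_i \sum_k \sum_j (b i)^† * (Y k i)^† * (Y k j * b j)).
    apply: eq_bigr => i _; rewrite exchange_big; apply: eq_bigr => j _.
    rewrite !mxE mulr_sumr mulr_suml; apply: eq_bigr => k _.
    by rewrite !mxE !mulrA.
  rewrite exchange_big; apply: eq_bigr => k _; rewrite st_sum mulr_suml.
  apply: eq_bigr => i _; rewrite mulr_sumr; apply: eq_bigr => j _.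
  by rewrite cs_starM.
by apply: posel_sum => k; exists (\sum_i Y k i * b i).
Qed.

(** * The Stinespring dilation over a positive functional *)

Section Stinespring.
Variables (A B : cstar) (phi : A -> B) (x : pfun B) (n : nat) (b : 'I_n -> B).
Hypotheses (phiL : clinear phi) (phiCP : completely_positive phi).

Notation V := {ffun 'I_n -> A}.
Implicit Types f g h : V.

(** The Stinespring form on [A] tensor [B], composed with [x]: the function [f] stands for the sum
    of the [f i] tensor [b i]. Complete positivity of [phi] on matrices of size [n] makes it
    positive. *)
Definition sform f g : RR := x (\sum_i \sum_j (b i)^† * phi ((g i)^† * f j) * b j).
Definition sact (a : A) f : V := [ffun i => a * f i].

Let phi_st a : phi a^† = (phi a)^†.
Proof. exact: pos_st phiL (cp_positive phiCP) a. Qed.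

Lemma sformC f g : sform f g = sform g f.
Proof.
rewrite /sform -(pf_st x) st_sum exchange_big; congr (pf_fun x _); apply: eq_bigr => i _.
rewrite st_sum; apply: eq_bigr => j _.
by rewrite !cs_starM -phi_st !cs_starM !cs_starK mulrA.
Qed.
Lemma sformD f g h : sform (f + g) h = sform f h + sform g h.
Proof.
rewrite /sform -pfD -big_split; congr (pf_fun x _); apply: eq_bigr => i _.
rewrite -big_split; apply: eq_bigr => j _ /=.
by rewrite ffunE mulrDr clinD // mulrDr mulrDl.
Qed.
Lemma sformR (r : RR) f g : sform (r%:C *: f) g = r * sform f g.
Proof.
rewrite /sform -pfZ scaler_sumr; congr (pf_fun x _); apply: eq_bigr => i _.
rewrite scaler_sumr; apply: eq_bigr => j _.
by rewrite ffunE -scalerAr clinZ // -scalerAr -scalerAl.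
Qed.
Lemma sformZ (c : CC) f g : sform (c *: f) g = sform f (c^* *: g).
Proof.
congr (pf_fun x _); apply: eq_bigr => i _; apply: eq_bigr => j _.
by rewrite !ffunE cs_starZ conjcK -scalerAr -scalerAl.
Qed.
Lemma sform_ge0 f : 0 <= sform f f.
Proof.
apply: pf_pos; case: n b f => [|n'] b' f; first by rewrite big_ord0; apply: posel0.
have [Z e] := phiCP (mx_pos_rank1 f).
have := @mx_pos_form B _ _ b' (ex_intro _ Z e); congr posel.
by apply: eq_bigr => i _; apply: eq_bigr => j _; rewrite !mxE.
Qed.
Lemma sactD a c f : sact (a + c) f = sact a f + sact c f.
Proof. by apply/ffunP => i; rewrite !ffunE mulrDl. Qed.
Lemma sactZ (c : CC) a f : sact (c *: a) f = c *: sact a f.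
Proof. by apply/ffunP => i; rewrite !ffunE -scalerAl. Qed.
Lemma sactM a c f : sact (a * c) f = sact a (sact c f).
Proof. by apply/ffunP => i; rewrite !ffunE mulrA. Qed.
Lemma sact1 f : sact 1 f = f.
Proof. by apply/ffunP => i; rewrite !ffunE mul1r. Qed.
Lemma sactL a (c : CC) f g : sact a (c *: f + g) = c *: sact a f + sact a g.
Proof. by apply/ffunP => i; rewrite !ffunE mulrDr -scalerAr. Qed.
Lemma sact_st a f g : sform (sact a f) g = sform f (sact a^† g).
Proof.
congr (pf_fun x _); apply: eq_bigr => i _; apply: eq_bigr => j _.
by rewrite !ffunE cs_starM cs_starK mulrA.
Qed.

Definition spmod : pmod A :=
  PMod sformC sformD sformR sformZ sform_ge0 sactD sactZ sactM sact1 sactL sact_st.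

(** [xi j] is the class of [1] tensor [b j]. Dilating a finite family at once is what matrix
    positivity of the extension calls for. *)
Lemma stinespring : exists (H : hmod A) (xi : 'I_n -> H),
  forall a i j, pip (pact a (xi j)) (xi i) = x ((b i)^† * phi a * b j).
Proof.
pose d (j : 'I_n) : spmod := [ffun k => (k == j)%:R] : V.
exists (completion spmod), (fun j => hemb (d j)) => a i j.
rewrite [LHS](_ : _ = pip (pact a (d j)) (d i)); last first.
  by rewrite (@hemb_act A spmod) (@hemb_pip A spmod).
congr (pf_fun x _); rewrite (bigD1 i) //= (bigD1 j) //= !ffunE !eqxx st1 mul1r mulr1.
rewrite big1 ?addr0 => [|k kj]; last by rewrite !ffunE (negPf kj) !mulr0 clin0 // mulr0 mul0r.
rewrite big1 ?addr0 // => k ki; rewrite big1 // => l _.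
by rewrite !ffunE (negPf ki) st0 mul0r clin0 // mulr0 mul0r.
Qed.
End Stinespring.

Lemma id_clinear (A : cstar) : clinear (@id A). Proof. by []. Qed.
Lemma id_cp (A : cstar) : completely_positive (@id A).
Proof. by move=> n X; rewrite map_mx_id. Qed.

Lemma gns (A : cstar) (x : pfun A) : exists (H : hmod A) (xi : H),
  forall a, pip (pact a xi) xi = x a.
Proof.
have [H [xi h]] := stinespring x (fun _ : 'I_1 => 1) (@id_clinear A) (@id_cp A).
by exists H, (xi ord0) => a; rewrite h st1 mul1r mulr1.
Qed.

(** * Generic vectors *)

Section Generic.
Variable A : cstar.
Implicit Types (S : set (nat -> A)) (H : hmod A) (a : A).

Definition vsat S H (xi : H) :=
  forall y, S y -> forall e : RR, 0 < e -> exists n, pip (pact (y n) xi) xi < e.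

Lemma Dec0_pip H (xi : H) (y : nat -> A) m n : Dec0 y -> (n <= m)%N ->
  pip (pact (y m) xi) xi <= pip (pact (y n) xi) xi.
Proof. by move=> hy mn; apply/pip_le/Dec0_mono. Qed.

Lemma vsat_sub S S' H (xi : H) : (S `<=` S')%classic -> vsat S' xi -> vsat S xi.
Proof. by move=> SS h y /SS/h. Qed.

Lemma vsatU S S' H (xi : H) : vsat (S `|` S')%classic xi -> vsat S xi /\ vsat S' xi.
Proof. by move=> h; split; apply: vsat_sub h => y; [left | right]. Qed.
Lemma vsat_bigcup (F : nat -> set (nat -> A)) n H (xi : H) :
  vsat (\bigcup_n F n)%classic xi -> vsat (F n) xi.
Proof. by apply: vsat_sub => y Fy; exists n. Qed.

Lemma pip_stM H (b : A) (xi : H) : pip (pact (b^† * b) xi) xi = pip (pact b xi) (pact b xi).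
Proof. by rewrite pactM pact_st cs_starK. Qed.

Lemma pip_quad H (a : A) (xi eta : H) : posel a ->
  pip (pact a (xi + eta)) (xi + eta) <= 2 * pip (pact a xi) xi + 2 * pip (pact a eta) eta.
Proof.
case=> b ->; rewrite !pip_stM pact_D.
set u := pact b xi; set v := pact b eta; have := pip_ge0 (u - v).
by rewrite [pip (u - v) _]pipB [pip (u + v) _]pipD !pipBr !pipDr (pipC v u); lra.
Qed.

Lemma vsat_lin S H (c : CC) (xi eta : H) : cond S -> vsat S xi -> vsat S eta ->
  vsat S (c *: xi + eta).
Proof.
move=> [_ hS] h1 h2 y Sy e e0; have hy := hS _ Sy.
have k0 : 0 <= cabs c ^+ 2 by apply: sqr_ge0.
set k := cabs c ^+ 2 in k0.
have K0 : 0 < 4 * k + 1 by lra.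
have [n1 hn1] := h1 _ Sy _ (divr_gt0 e0 K0).
have [n2 hn2] := h2 _ Sy (e / 4) ltac:(lra).
exists (maxn n1 n2).
have q1 := Dec0_pip xi hy (leq_maxl n1 n2); have q2 := Dec0_pip eta hy (leq_maxr n1 n2).
have py : posel (y (maxn n1 n2)) by case: hy.
apply: le_lt_trans (pip_quad _ _ py) _.
have e1 : pip (pact (y (maxn n1 n2)) (c *: xi)) (c *: xi) = k * pip (pact (y (maxn n1 n2)) xi) xi.
  rewrite pact_Z pipZ scalerA -pipRr; congr (pip _ (_ *: _)); rewrite mulrC /k.
  by case: (c) => u v; rewrite /cabs /= sqr_sqrtr ?addr_ge0 ?sqr_ge0 //; cplx.
rewrite e1; move: hn1; rewrite ltr_pdivlMr // => hn1.
have p0 := pip_pos xi py.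
set p := pip _ _ in q1 p0 *; set q := pip (pact (y n1) xi) xi in q1 hn1 *.
have : k * p <= k * q by rewrite ler_wpM2l.
by nra.
Qed.

Lemma vsat_0 S H : vsat S (0 : H).
Proof. by move=> y _ e e0; exists 0%N; rewrite pip0r. Qed.
Lemma vsat_Z S H (c : CC) (xi : H) : cond S -> vsat S xi -> vsat S (c *: xi).
Proof. by move=> cS h; rewrite -[_ *: _]addr0; apply: vsat_lin => //; apply: vsat_0. Qed.
Lemma vsat_D S H (xi eta : H) : cond S -> vsat S xi -> vsat S eta -> vsat S (xi + eta).
Proof. by move=> cS h1 h2; rewrite -[xi]scale1r; apply: vsat_lin. Qed.
Lemma vsat_B S H (xi eta : H) : cond S -> vsat S xi -> vsat S eta -> vsat S (xi - eta).
Proof. by move=> cS h1 h2; rewrite addrC -scaleN1r; apply: vsat_lin. Qed.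

Lemma pip_bound H a (xi : H) : pip (pact a xi) xi <= nm a * pip xi xi.
Proof.
apply: le_trans (ler_norm _) _; apply: le_trans (pip_CS _ _) _.
by rewrite -pn2 expr2 mulrA ler_wpM2r ?pn_ge0 // pact_bound.
Qed.

(** Since [nm (y n) <= nm (y 0)], replacing the vector by a nearby one costs the same for every
    [n]. *)
Lemma vsat_closed S H (u : nat -> H) (xi : H) : cond S -> (forall k, vsat S (u k)) ->
  cvgP u xi -> vsat S xi.
Proof.
move=> [_ hS] hu hl y Sy e e0; have hy := hS _ Sy.
have n0 := nm_ge0 (y 0%N).
have d0 : 0 < e / (4 * (nm (y 0%N) + 1)) by apply: divr_gt0 => //; lra.
have [k hk] := hl (Num.sqrt (e / (4 * (nm (y 0%N) + 1)))) ltac:(by rewrite sqrtr_gt0).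
have := hk k (leqnn k); rewrite ltr_sqrt // => {}hk.
have [n hn] := hu k _ Sy (e / 4) ltac:(lra); exists n.
have py : posel (y n) by case: hy.
have -> : xi = u k + (xi - u k) by rewrite addrC subrK.
apply: le_lt_trans (pip_quad _ _ py) _.
have b1 := pip_bound (y n) (xi - u k).
have b2 : nm (y n) <= nm (y 0%N) by apply: nm_mono => //; apply: Dec0_mono.
have b3 := pip_ge0 (xi - u k).
have b4 : nm (y n) * pip (xi - u k) (xi - u k) <= nm (y 0%N) * pip (xi - u k) (xi - u k).
  by rewrite ler_wpM2r.
move: hk; rewrite ltr_pdivlMr; last lra.
rewrite -opprB pipN pipNr opprK => hk.
set p := pip (xi - u k) _ in b1 b3 b4 hk *.
by nra.
Qed.

(** Genericity of [pact a xi] for [S] is genericity of [xi] for the conjugated sequences; these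
    decrease to 0 by [Dec0_conj]. *)
Definition conjc S a : set (nat -> A) :=
  [set (fun n => a^† * y n * a) | y in S]%classic.

Lemma cond_conj S a : cond S -> cond (conjc S a).
Proof.
move=> [cS dS]; split; first exact: card_le_trans (card_image_le _ _) cS.
by move=> _ [y Sy <-]; apply: Dec0_conj; apply: dS.
Qed.

Lemma vsat_conj S a H (xi : H) : vsat (conjc S a) xi -> vsat S (pact a xi).
Proof.
move=> h y Sy e e0; have [|n hn] := h (fun n => a^† * y n * a) _ e e0; first by exists y.
by exists n; move: hn; rewrite !pactM pact_st cs_starK.
Qed.

Lemma cond0 : cond (set0 : set (nat -> A)).
Proof. by split=> // y []. Qed.
Lemma cond_bigcup (F : nat -> set (nat -> A)) : (forall k, cond (F k)) ->
  cond (\bigcup_k F k)%classic.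
Proof.
move=> h; split; last by move=> y [k _ /(proj2 (h k))].
by apply: bigcup_countable => // k _; case: (h k).
Qed.

Lemma condU S S' : cond S -> cond S' -> cond (S `|` S')%classic.
Proof.
move=> cS cS'; have [|c d] := @cond_bigcup (fun k => if k is 0%N then S else S').
  by case.
split; last by move=> y [/(proj2 cS)|/(proj2 cS')].
apply: sub_countable c; apply: subset_card_le => y [Sy|Sy]; first by exists 0%N.
by exists 1%N.
Qed.

Lemma generic_vector S (b : A) : cond S -> selfadj b -> ~ cle b 0 ->
  exists (H : hmod A) (xi : H), vsat S xi /\ 0 < pip (pact b xi) xi.
Proof.
move=> cS sb nb; have [x [xS xb]] := generic_pf cS sb nb.
have [H [xi h]] := gns x; exists H, xi; split; last by rewrite h.
by move=> y Sy e e0; have [n hn] := xS y Sy e e0; exists n; rewrite h.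
Qed.
End Generic.

(** * Terms and their evaluation at generic vectors *)

Section HilbertLimits.
Variables (A : cstar) (H : hmod A).
Implicit Types (u v : nat -> H) (x y l : H).

Lemma pn_eq0 x : pn x <= 0 -> x = 0.
Proof.
move=> h; apply: hm_def; rewrite -pn2; have := pn_ge0 x => h0.
have -> : pn x = 0 by lra.
by rewrite expr0n.
Qed.

Lemma cvgP_unique u l m : cvgP u l -> cvgP u m -> l = m.
Proof.
move=> hl hm; apply/eqP; rewrite -subr_eq0; apply/eqP/pn_eq0; rewrite leNgt; apply/negP => h.
have [N1 h1] := hl _ (divr_gt0 h (ltr0n _ 2)); have [N2 h2] := hm _ (divr_gt0 h (ltr0n _ 2)).
have := pn_tri (u (maxn N1 N2)) l m; rewrite (pnB l (u _)).
by have := h1 _ (leq_maxl N1 N2); have := h2 _ (leq_maxr N1 N2); lra.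
Qed.

Definition limP u : H := xget 0 [set l | cvgP u l]%classic.

Lemma limPE u l : cvgP u l -> limP u = l.
Proof.
by move=> h; rewrite /limP; case: xgetP => [y _ hy|/(_ l)//]; apply: cvgP_unique hy h.
Qed.

Lemma cvgP_lin (c : CC) u v l m : cvgP u l -> cvgP v m ->
  cvgP (fun n => c *: u n + v n) (c *: l + m).
Proof.
move=> hu hv e e0; have c0 := cabs_ge0 c.
have C0 : 0 < 2 * (cabs c + 1) by lra.
have [N1 h1] := hu _ (divr_gt0 e0 C0); have [N2 h2] := hv (e / 2) ltac:(lra).
exists (maxn N1 N2) => n; rewrite geq_max => /andP[n1 n2].
have := h1 _ n1; have := h2 _ n2; rewrite !ltr_pdivlMr // => a2 a1.
have -> : c *: u n + v n - (c *: l + m) = c *: (u n - l) + (v n - m).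
  by rewrite scalerBr opprD addrACA.
apply: le_lt_trans (pnD _ _) _; have := pnZ c (u n - l).
have := pn_ge0 (u n - l); set p := pn (u n - l) in a1 *; set q := pn (v n - m) in a2 a1 *; set r := pn _.
by nra.
Qed.

Lemma cvgP_cst x : cvgP (fun=> x) x.
Proof. by move=> e e0; exists 0%N => n _; rewrite subrr pn0. Qed.

Lemma cvgP_pn_le u l (M : RR) : cvgP u l -> (exists N, forall n, (N <= n)%N -> pn (u n) <= M) -> pn l <= M.
Proof.
move=> hl [N hN]; rewrite leNgt; apply/negP => h.
have [K hK] := hl (pn l - M) ltac:(lra).
have := hK _ (leq_maxr N K); have := hN _ (leq_maxl N K); rewrite pnB.
by have := pnD (l - u (maxn N K)) (u (maxn N K)); rewrite subrK; lra.
Qed.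

Lemma cvgP_pip u l y : cvgP u l -> cvgR (fun n => pip (u n) y) (pip l y).
Proof.
move=> h e e0; have C0 : 0 < pn y + 1 by have := pn_ge0 y; lra.
have [N hN] := h _ (divr_gt0 e0 C0); exists N => n /hN; rewrite ltr_pdivlMr // => hn.
rewrite -pipB; apply: le_lt_trans (pip_CS _ _) _.
by have := pn_ge0 (u n - l); nra.
Qed.
End HilbertLimits.

(** Syntax rather than operators: one element has to act in every Hilbert module over [A], so it is
    a recipe that mentions none of them. *)
Inductive tm (A : cstar) :=
  | TI of A | TA of tm A & tm A | TZ of CC & tm A | TM of tm A & tm A | TL of (nat -> tm A).

Section Terms.
Variable A : cstar.
Notation T := (tm A).
Implicit Types (s t : T) (S : set (nat -> A)) (f : nat -> T) (M : RR).

(* [TL f] stands for the strong limit of [f]; its value is junk at the vectors where there is none. *)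
Fixpoint ev (H : hmod A) t (xi : H) : H :=
  match t with
  | TI a => pact a xi
  | TA t1 t2 => ev t1 xi + ev t2 xi
  | TZ c t1 => c *: ev t1 xi
  | TM t1 t2 => ev t1 (ev t2 xi)
  | TL f => limP (fun n => ev (f n) xi)
  end.

Fixpoint tstar t : T :=
  match t with
  | TI a => TI a^†
  | TA t1 t2 => TA (tstar t1) (tstar t2)
  | TZ c t1 => TZ (c^*)%C (tstar t1)
  | TM t1 t2 => TM (tstar t2) (tstar t1)
  | TL f => TL (fun n => tstar (f n))
  end.

Lemma tstarK t : tstar (tstar t) = t.
Proof.
elim: t => [a|t1 h1 t2 h2|c t1 h1|t1 h1 t2 h2|f h] /=; rewrite ?cs_starK ?h1 ?h2 //.
  by rewrite conjcK.
by congr TL; apply/funext.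
Qed.

(** Truth at all sufficiently generic vectors of all Hilbert modules. Such properties are stable
    under countable intersections ([gen_all]), and [generic_vector] provides nonzero vectors for
    every condition. *)
Definition gen (P : forall H : hmod A, H -> Prop) :=
  exists2 S, cond S & forall (H : hmod A) (xi : H), vsat S xi -> P H xi.

Lemma gen_mono (P Q : forall H : hmod A, H -> Prop) :
  (forall H xi, P H xi -> Q H xi) -> gen P -> gen Q.
Proof. by move=> PQ [S cS h]; exists S => // H xi /h/PQ. Qed.
Lemma gen_mono2 (P Q R : forall H : hmod A, H -> Prop) :
  (forall H xi, P H xi -> Q H xi -> R H xi) -> gen P -> gen Q -> gen R.
Proof.
move=> PQR [S cS h] [S' cS' h']; exists (S `|` S')%classic; first exact: condU.
move=> H xi hxi; apply: PQR; [apply: h | apply: h']; apply: vsat_sub hxi => y; [left|right] => //.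
Qed.
Lemma gen_all (P : nat -> forall H : hmod A, H -> Prop) :
  (forall n, gen (P n)) -> gen (fun H xi => forall n, P n H xi).
Proof.
move=> h; have /choice[F hF] : forall n, exists S, cond S /\ forall (H : hmod A) (xi : H), vsat S xi -> P n H xi.
  by move=> n; have [S cS hS] := h n; exists S.
exists (\bigcup_n F n)%classic; first by apply: cond_bigcup => n; case: (hF n).
move=> H xi hxi n; apply: (hF n).2; apply: vsat_sub hxi => y Fy; by exists n.
Qed.
Lemma gen_vsat S : cond S -> gen (fun H xi => vsat S xi).
Proof. by move=> cS; exists S. Qed.
Lemma gen_true (P : forall H : hmod A, H -> Prop) : (forall H xi, P H xi) -> gen P.
Proof. by move=> h; exists set0; [exact: cond0 |]. Qed.

(** Needed for products: [ev s] is controlled only at generic vectors, so [ev t xi] must be one once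
    [xi] meets a possibly stronger condition. *)
Definition stable t := forall S, cond S -> gen (fun H xi => vsat S (ev t xi)).
Definition linear_tm t := exists2 S, cond S & forall (H : hmod A) (c : CC) (xi eta : H),
  vsat S xi -> vsat S eta -> ev t (c *: xi + eta) = c *: ev t xi + ev t eta.
Definition bnd t M := gen (fun H xi => pn (ev t xi) <= M * pn xi).
Definition adjoint_tm t := exists2 S, cond S & forall (H : hmod A) (xi eta : H),
  vsat S xi -> vsat S eta -> pip (ev t xi) eta = pip xi (ev (tstar t) eta).
Definition op t := [/\ stable t, linear_tm t & exists2 M, 0 <= M & bnd t M].
(** [t] and its formal adjoint are both asked to be operators, because strong convergence of a
    sequence does not give that of the adjoints. *)
Definition good t := [/\ op t, op (tstar t) & adjoint_tm t].

Lemma gen_ev t (P : forall H : hmod A, H -> Prop) : stable t -> gen P -> gen (fun H xi => P H (ev t xi)).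
Proof. by move=> st [S cS hS]; apply: gen_mono (st S cS) => H xi; apply: hS. Qed.

Lemma op_TI a : op (TI a).
Proof.
split.
- move=> S cS; exists (conjc S a); first exact: cond_conj.
  by move=> H xi; apply: vsat_conj.
- by exists set0; [exact: cond0 | move=> H c xi eta _ _ /=; rewrite pactL].
- by exists (nm a); [exact: nm_ge0 | apply: gen_true => H xi; apply: pact_bound].
Qed.

Lemma op_TA s t : op s -> op t -> op (TA s t).
Proof.
move=> [s1 [S1 c1 l1] [M1 m1 b1]] [s2 [S2 c2 l2] [M2 m2 b2]]; split.
- by move=> S cS; apply: gen_mono2 (s1 S cS) (s2 S cS) => H xi /= h1 h2; apply: vsat_D.
- exists (S1 `|` S2)%classic; first exact: condU.
  move=> H c xi eta /vsatU[h1 h1'] /vsatU[h2 h2'] /=.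
  by rewrite l1 ?l2 // scalerDr addrACA.
- exists (M1 + M2); first exact: addr_ge0.
  by apply: gen_mono2 b1 b2 => H xi /= h1 h2; have := pnD (ev s xi) (ev t xi); lra.
Qed.

Lemma op_TZ c t : op t -> op (TZ c t).
Proof.
move=> [s1 [S1 c1 l1] [M1 m1 b1]]; split.
- by move=> S cS; apply: gen_mono (s1 S cS) => H xi /= h1; apply: vsat_Z.
- exists S1 => // H d xi eta h1 h2 /=.
  by rewrite l1 // scalerDr !scalerA mulrC.
- exists (cabs c * M1); first by rewrite mulr_ge0 // cabs_ge0.
  apply: gen_mono b1 => H xi /= h1; apply: le_trans (pnZ _ _) _.
  by rewrite -mulrA ler_wpM2l // cabs_ge0.
Qed.

Lemma op_TM s t : op s -> op t -> op (TM s t).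
Proof.
move=> [s1 [S1 c1 l1] [M1 m1 b1]] [s2 [S2 c2 l2] [M2 m2 b2]]; split.
- move=> S cS; exact: gen_ev s2 (s1 S cS).
- have [S3 c3 h3] := s2 _ c1.
  exists (S2 `|` S3)%classic; first exact: condU.
  move=> H c xi eta /vsatU[h1 h1'] /vsatU[h2 h2'] /=.
  by rewrite l2 // l1 //; apply: h3.
- exists (M1 * M2); first exact: mulr_ge0.
  apply: gen_mono2 (gen_ev s2 b1) b2 => H xi /= h1 h2; apply: le_trans h1 _.
  by rewrite -mulrA ler_wpM2l.
Qed.

Definition converges f := gen (fun H xi => exists l, cvgP (fun n => ev (f n) xi) l).

Lemma lim_ev f (H : hmod A) (xi : H) : (exists l, cvgP (fun n => ev (f n) xi) l) ->
  cvgP (fun n => ev (f n) xi) (ev (TL f) xi).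
Proof. by case=> l hl /=; rewrite (limPE hl). Qed.

Lemma op_TL f M : 0 <= M -> (forall n, op (f n)) -> (forall n, bnd (f n) M) -> converges f ->
  op (TL f).
Proof.
move=> M0 hf hM hc; split.
- move=> S cS; have h : gen (fun H xi => forall n, vsat S (ev (f n) xi)).
    by apply: gen_all => n; have [st _ _] := hf n; apply: st.
  by apply: gen_mono2 h hc => H xi h1 /lim_ev; apply: vsat_closed.
- have /choice[F hF] : forall n, exists S, cond S /\ forall (H : hmod A) (c : CC) (xi eta : H),
      vsat S xi -> vsat S eta -> ev (f n) (c *: xi + eta) = c *: ev (f n) xi + ev (f n) eta.
    by move=> n; have [_ [S cS hS] _] := hf n; exists S.
  have [S' cS' hS'] := hc.
  have cF : cond (\bigcup_n F n)%classic by apply: cond_bigcup => n; case: (hF n).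
  exists ((\bigcup_n F n) `|` S')%classic; first exact: condU.
  move=> H c xi eta /vsatU[h1 h1'] /vsatU[h2 h2']; apply: limPE.
  have -> : (fun n => ev (f n) (c *: xi + eta)) = (fun n => c *: ev (f n) xi + ev (f n) eta).
    by apply/funext => n; apply: (hF n).2; apply: vsat_bigcup.
  by apply: cvgP_lin; apply: lim_ev; apply: hS'.
- exists M => //; apply: gen_mono2 (gen_all hM) hc => H xi h1 /lim_ev h2.
  by apply: cvgP_pn_le h2 _; exists 0%N.
Qed.

Lemma adj_sym t : adjoint_tm t -> adjoint_tm (tstar t).
Proof.
by case=> S cS h; exists S => // H xi eta h1 h2; rewrite tstarK pipC -h // pipC.
Qed.
Lemma good_star t : good t -> good (tstar t).
Proof. by case=> h1 h2 h3; split; rewrite ?tstarK //; apply: adj_sym. Qed.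

Lemma good_TI a : good (TI a).
Proof.
split; [exact: op_TI | exact: op_TI |].
by exists set0; [exact: cond0 | move=> H xi eta _ _ /=; rewrite pact_st].
Qed.
Lemma good_TA s t : good s -> good t -> good (TA s t).
Proof.
move=> [s1 s2 [S1 c1 a1]] [t1 t2 [S2 c2 a2]]; split; try exact: op_TA.
exists (S1 `|` S2)%classic; first exact: condU.
by move=> H xi eta /vsatU[h1 h1'] /vsatU[h2 h2'] /=; rewrite pipD pipDr a1 ?a2.
Qed.
Lemma good_TZ c t : good t -> good (TZ c t).
Proof.
move=> [t1 t2 [S1 c1 a1]]; split; try exact: op_TZ.
have [_ [S2 c2 l2] _] := t1.
exists (S1 `|` S2)%classic; first exact: condU.
move=> H xi eta /vsatU[h1 h1'] /vsatU[h2 h2'] /=.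
have e0 : ev t (0 : H) = 0.
  have := l2 H (-1) 0 0 (@vsat_0 _ S2 H) (@vsat_0 _ S2 H).
  by rewrite scaler0 addr0 scaleN1r addNr.
have := l2 H c xi 0 h1' (@vsat_0 _ S2 H); rewrite addr0 e0 addr0 => <-.
by rewrite a1 // ?pipZ //; apply: vsat_Z.
Qed.
Lemma good_TM s t : good s -> good t -> good (TM s t).
Proof.
move=> [s1 s2 [S1 c1 a1]] [t1 t2 [S2 c2 a2]]; split; try exact: op_TM.
have [st1 _ _] := t1; have [ss2 _ _] := s2.
have [S3 c3 h3] := st1 _ c1; have [S4 c4 h4] := ss2 _ c2.
exists ((S1 `|` S2) `|` (S3 `|` S4))%classic; first by do 2 apply: condU => //.
move=> H xi eta /vsatU[/vsatU[_ x2] /vsatU[x3 _]] /vsatU[/vsatU[e1 _] /vsatU[_ e4]] /=.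
by rewrite a1 ?a2 //; [apply: h4 | apply: h3].
Qed.
Lemma good_TL f M : 0 <= M -> (forall n, good (f n)) -> (forall n, bnd (f n) M) ->
  (forall n, bnd (tstar (f n)) M) -> converges f -> converges (fun n => tstar (f n)) ->
  good (TL f).
Proof.
move=> M0 hf b1 b2 c1 c2; split.
- by apply: op_TL b1 c1 => // n; case: (hf n).
- by apply: op_TL b2 c2 => // n; case: (hf n).
have /choice[F hF] : forall n, exists S, cond S /\ forall (H : hmod A) (xi eta : H),
    vsat S xi -> vsat S eta -> pip (ev (f n) xi) eta = pip xi (ev (tstar (f n)) eta).
  by move=> n; have [_ _ [S cS hS]] := hf n; exists S.
have [S1 cS1 h1] := c1; have [S2 cS2 h2] := c2.
have cF : cond (\bigcup_n F n)%classic by apply: cond_bigcup => n; case: (hF n).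
exists ((\bigcup_n F n) `|` (S1 `|` S2))%classic; first by do 2 apply: condU => //.
move=> H xi eta /vsatU[v1 /vsatU[w1 _]] /vsatU[v2 /vsatU[_ w2]].
have l1 := lim_ev (h1 _ _ w1); have l2 := lim_ev (h2 _ _ w2).
apply: cvgR_unique (cvgP_pip eta l1) _; rewrite pipC.
have := cvgP_pip xi l2; congr cvgR; apply/funext => n; rewrite pipC -(hF n).2 //.
  exact: vsat_bigcup v1.
exact: vsat_bigcup v2.
Qed.

Definition teq s t := gen (fun H xi => ev s xi = ev t xi).

Lemma teq_refl t : teq t t. Proof. exact: gen_true. Qed.
Lemma teq_sym s t : teq s t -> teq t s. Proof. exact: gen_mono. Qed.
Lemma teq_trans r s t : teq r s -> teq s t -> teq r t.
Proof. by apply: gen_mono2 => H xi -> . Qed.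

Lemma teq_TA s s' t t' : teq s s' -> teq t t' -> teq (TA s t) (TA s' t').
Proof. by apply: gen_mono2 => H xi /= -> ->. Qed.
Lemma teq_TZ c s s' : teq s s' -> teq (TZ c s) (TZ c s').
Proof. by apply: gen_mono => H xi /= ->. Qed.
Lemma teq_TM s s' t t' : stable t -> teq s s' -> teq t t' -> teq (TM s t) (TM s' t').
Proof. by move=> st /(gen_ev st); apply: gen_mono2 => H xi /= -> ->. Qed.
(** The difference [d] of the adjoints at [xi] is itself generic by stability, so [s] and [t] agree
    at [d]. Moving the adjoints across the form then shows that [d] is orthogonal to itself. *)
Lemma teq_star s t : good s -> good t -> teq s t -> teq (tstar s) (tstar t).
Proof.
move=> [_ [ss _ _] [S1 c1 a1]] [_ [tt _ _] [S2 c2 a2]] [S3 c3 e].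
pose S := (S1 `|` (S2 `|` S3))%classic.
have cS : cond S by do 2 apply: condU => //.
have [S4 c4 h4] := ss _ cS; have [S5 c5 h5] := tt _ cS.
exists (S `|` (S4 `|` S5))%classic; first by do 2 apply: condU => //.
move=> H xi /vsatU[v0 /vsatU[v4 v5]].
set d := ev (tstar s) xi - ev (tstar t) xi.
have vd : vsat S d by apply: vsat_B => //; [apply: h4 | apply: h5].
have [d1 /vsatU[d2 d3]] := vsatU vd; have [x1 /vsatU[x2 x3]] := vsatU v0.
apply/eqP; rewrite -subr_eq0; apply/eqP; apply: hm_def; rewrite -/d.
by rewrite {2}/d pipBr -a1 // -a2 // e // subrr.
Qed.
End Terms.

(** * The C*-algebra of good terms modulo generic equality *)

Section TermAlgebra.
Variable A : cstar.

Definition gtm := {t : tm A | good t}.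
Implicit Types (s t : gtm) (M : RR).
Definition geq s t := teq (sval s) (sval t).
Lemma geq_refl s : geq s s. Proof. exact: teq_refl. Qed.
Lemma geq_sym s t : geq s t -> geq t s. Proof. exact: teq_sym. Qed.
Lemma geq_trans r s t : geq r s -> geq s t -> geq r t. Proof. exact: teq_trans. Qed.

Definition gI a : gtm := exist _ _ (good_TI a).
Definition gA s t : gtm := exist _ _ (good_TA (svalP s) (svalP t)).
Definition gZ c t : gtm := exist _ _ (good_TZ c (svalP t)).
Definition gM s t : gtm := exist _ _ (good_TM (svalP s) (svalP t)).
Definition gS t : gtm := exist _ _ (good_star (svalP t)).

Lemma g_stable t : stable (sval t). Proof. by case: t => t [[]]. Qed.

Definition dcar := quot geq_refl.
HB.instance Definition _ := gen_eqMixin dcar.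
HB.instance Definition _ := gen_choiceMixin dcar.

Definition dcls t : dcar := qcls geq_refl geq_sym geq_trans t.
Definition drep (d : dcar) : gtm := sval d.
Lemma dcls_eq s t : geq s t -> dcls s = dcls t. Proof. exact: qcls_eq. Qed.
Lemma dclsK d : dcls (drep d) = d. Proof. exact: qcls_rep. Qed.
Lemma drepK t : geq (drep (dcls t)) t. Proof. exact: (qrepR geq_refl geq_sym geq_trans). Qed.
Lemma dcls_inj s t : dcls s = dcls t -> geq s t.
Proof. by move=> e; apply: geq_trans (geq_sym (drepK s)) _; rewrite e; apply: drepK. Qed.

Definition dzero := dcls (gI 0).
Definition done_ := dcls (gI 1).
Definition dadd d e := dcls (gA (drep d) (drep e)).
Definition dmul d e := dcls (gM (drep d) (drep e)).
Definition dscale c d := dcls (gZ c (drep d)).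
Definition dopp d := dscale (-1) d.
Definition dstar d := dcls (gS (drep d)).

Lemma dadd_cls s t : dadd (dcls s) (dcls t) = dcls (gA s t).
Proof. by apply: dcls_eq; apply: teq_TA; apply: drepK. Qed.
Lemma dmul_cls s t : dmul (dcls s) (dcls t) = dcls (gM s t).
Proof. by apply: dcls_eq; apply: teq_TM; [exact: g_stable | exact: drepK..]. Qed.
Lemma dscale_cls c t : dscale c (dcls t) = dcls (gZ c t).
Proof. by apply: dcls_eq; apply: teq_TZ; apply: drepK. Qed.
Lemma dstar_cls t : dstar (dcls t) = dcls (gS t).
Proof.
by apply: dcls_eq; apply: teq_star; [exact: (svalP (drep _)) | exact: (svalP t) | exact: drepK].
Qed.
Lemma dcls_ext s t : (forall (H : hmod A) (xi : H), ev (sval s) xi = ev (sval t) xi) -> dcls s = dcls t.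
Proof. by move=> h; apply: dcls_eq; apply: gen_true. Qed.

Lemma daddA : associative dadd.
Proof.
move=> x y z; rewrite -[x]dclsK -[y]dclsK -[z]dclsK !dadd_cls.
by apply: dcls_ext => H xi /=; rewrite addrA.
Qed.
Lemma daddC : commutative dadd.
Proof.
move=> x y; rewrite -[x]dclsK -[y]dclsK !dadd_cls.
by apply: dcls_ext => H xi /=; rewrite addrC.
Qed.
Lemma dadd0 : left_id dzero dadd.
Proof.
by move=> x; rewrite -[x]dclsK dadd_cls; apply: dcls_ext => H xi /=; rewrite pact0 add0r.
Qed.
Lemma daddN : left_inverse dzero dopp dadd.
Proof.
move=> x; rewrite -[x]dclsK /dopp dscale_cls dadd_cls; apply: dcls_ext => H xi /=.
by rewrite scaleN1r addNr pact0.
Qed.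
HB.instance Definition _ := GRing.isZmodule.Build dcar daddA daddC dadd0 daddN.
Lemma dclsD s t : dcls s + dcls t = dcls (gA s t). Proof. exact: dadd_cls. Qed.

Lemma dmulA : associative dmul.
Proof.
move=> x y z; rewrite -[x]dclsK -[y]dclsK -[z]dclsK !dmul_cls.
by apply: dcls_ext.
Qed.
Lemma dmul1l : left_id done_ dmul.
Proof. by move=> x; rewrite -[x]dclsK dmul_cls; apply: dcls_ext => H xi /=; rewrite pact1. Qed.
Lemma dmul1r : right_id done_ dmul.
Proof. by move=> x; rewrite -[x]dclsK dmul_cls; apply: dcls_ext => H xi /=; rewrite pact1. Qed.
Lemma dmulDl : left_distributive dmul +%R.
Proof.
move=> x y z; rewrite -[x]dclsK -[y]dclsK -[z]dclsK dclsD !dmul_cls dclsD.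
exact: dcls_ext.
Qed.

Lemma g_linear t : exists2 S, cond S & forall (H : hmod A) (c : CC) (xi eta : H),
  vsat S xi -> vsat S eta -> ev (sval t) (c *: xi + eta) = c *: ev (sval t) xi + ev (sval t) eta.
Proof. by case: t => t [[]]. Qed.

Lemma gen_linear t (f g : forall H : hmod A, H -> H) (c : CC) :
  (forall S, cond S -> gen (fun H xi => vsat S (f H xi))) ->
  (forall S, cond S -> gen (fun H xi => vsat S (g H xi))) ->
  gen (fun H xi => ev (sval t) (c *: f H xi + g H xi) = c *: ev (sval t) (f H xi) + ev (sval t) (g H xi)).
Proof.
move=> hf hg; have [S cS hS] := g_linear t.
by apply: gen_mono2 (hf S cS) (hg S cS) => H xi; apply: hS.
Qed.

(** Left distributivity holds at every vector by the definition of evaluation; here linearity of the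
    left factor enters, which holds only at generic vectors. *)
Lemma dmulDr : right_distributive dmul +%R.
Proof.
move=> x y z; rewrite -[x]dclsK -[y]dclsK -[z]dclsK dclsD !dmul_cls dclsD.
apply: dcls_eq; have := gen_linear (drep x) 1 (g_stable (drep y)) (g_stable (drep z)).
by apply: gen_mono => H xi; rewrite !scale1r.
Qed.

Lemma not_neg1 (B : cstar) : ~ cle (1 : B) 0.
Proof.
move=> /cleN0 h; have := posel_anti (posel1 B) h => /eqP.
by rewrite oner_eq0.
Qed.

(** Every condition has a generic vector of positive length, and a generic equality [1 = 0] is
    refuted there. *)
Lemma done_neq0 : done_ != 0.
Proof.
apply/eqP => /dcls_inj [S cS h].
have [H [xi [xiS]]] := generic_vector cS (sa_1 A) (@not_neg1 A).
have /= -> := h H xi xiS; by rewrite pact0 pip0 ltxx.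
Qed.

HB.instance Definition _ := GRing.Zmodule_isNzRing.Build dcar
  dmulA dmul1l dmul1r dmulDl dmulDr done_neq0.
Lemma dclsM s t : dcls s * dcls t = dcls (gM s t). Proof. exact: dmul_cls. Qed.

Lemma dscaleA c d x : dscale c (dscale d x) = dscale (c * d) x.
Proof. by rewrite -[x]dclsK !dscale_cls; apply: dcls_ext => H xi /=; rewrite scalerA. Qed.
Lemma dscale1 : left_id 1 dscale.
Proof. by move=> x; rewrite -[x]dclsK !dscale_cls; apply: dcls_ext => H xi /=; rewrite scale1r. Qed.
Lemma dscaleDr : right_distributive dscale +%R.
Proof.
move=> c x y; rewrite -[x]dclsK -[y]dclsK dclsD !dscale_cls dclsD.
by apply: dcls_ext => H xi /=; rewrite scalerDr.
Qed.
Lemma dscaleDl x : {morph dscale^~ x : c d / c + d}.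
Proof.
move=> c d; rewrite -[x]dclsK /= !dscale_cls dclsD.
by apply: dcls_ext => H xi /=; rewrite scalerDl.
Qed.
HB.instance Definition _ := GRing.Zmodule_isLmodule.Build CC dcar dscaleA dscale1 dscaleDr dscaleDl.
Lemma dclsZ c t : c *: dcls t = dcls (gZ c t). Proof. exact: dscale_cls. Qed.

Lemma dscaleAl (c : CC) (x y : dcar) : c *: (x * y) = c *: x * y.
Proof. by rewrite -[x]dclsK -[y]dclsK dclsM !dclsZ dclsM; apply: dcls_ext. Qed.
HB.instance Definition _ := GRing.Lmodule_isLalgebra.Build CC dcar dscaleAl.
Lemma gen_linearZ t (f : forall H : hmod A, H -> H) (c : CC) :
  (forall S, cond S -> gen (fun H xi => vsat S (f H xi))) ->
  gen (fun H xi => ev (sval t) (c *: f H xi) = c *: ev (sval t) (f H xi)).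
Proof.
move=> hf; have h0 (S : set (nat -> A)) : cond S -> gen (fun H xi => vsat S (0 : H)).
  by move=> cS; apply: gen_true => H xi; apply: vsat_0.
apply: gen_mono2 (gen_linear t c hf h0) (gen_linear t 1 h0 h0) => H xi.
rewrite !addr0 !scale1r => h /esym/eqP.
by rewrite -subr_eq0 addrK => /eqP e0; rewrite h e0 addr0.
Qed.
Lemma dscaleAr (c : CC) (x y : dcar) : c *: (x * y) = x * (c *: y).
Proof.
rewrite -[x]dclsK -[y]dclsK dclsM !dclsZ dclsM; apply: dcls_eq.
by apply: teq_sym; apply: gen_linearZ; apply: g_stable.
Qed.
HB.instance Definition _ := GRing.Lalgebra_isAlgebra.Build CC dcar dscaleAr.

Definition dbnd (d : dcar) M := bnd (sval (drep d)) M.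
Lemma dbnd_cls t M : dbnd (dcls t) M <-> bnd (sval t) M.
Proof.
by split=> h; [apply: gen_mono2 h (drepK t) | apply: gen_mono2 h (geq_sym (drepK t))] => H xi h1 <-.
Qed.
Definition dnorm d : RR := inf [set M | 0 <= M /\ dbnd d M]%classic.

Lemma dnorm_has d : exists M, 0 <= M /\ dbnd d M.
Proof. by have [[_ _ [M M0 hM]] _ _] := svalP (drep d); exists M. Qed.
Lemma dnorm_lb d : has_lbound [set M | 0 <= M /\ dbnd d M]%classic.
Proof. by exists 0 => M []. Qed.
Lemma dnorm_le d M : 0 <= M -> dbnd d M -> dnorm d <= M.
Proof. by move=> M0 h; apply: ge_inf => //; exact: dnorm_lb. Qed.
Lemma dnorm_ge0 d : 0 <= dnorm d.
Proof. by have [M hM] := dnorm_has d; apply: lb_le_inf; [exists M | move=> x []]. Qed.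

(** The infimum is attained: the bounds [dnorm d + 1 / (k + 1)] hold generically for each [k], hence
    simultaneously for all [k]. *)
Lemma dnorm_bnd d : dbnd d (dnorm d).
Proof.
have h k : gen (fun H xi => pn (ev (sval (drep d)) xi) <= (dnorm d + k.+1%:R^-1) * pn xi).
  have hi : has_inf [set M | 0 <= M /\ dbnd d M]%classic.
    by split; [have [M hM] := dnorm_has d; exists M | exact: dnorm_lb].
  have [|M [M0 hM] Mlt] := inf_adherent (E := [set M | 0 <= M /\ dbnd d M]%classic) (eps := k.+1%:R^-1) _ hi.
    by rewrite invr_gt0 ltr0n.
  by apply: gen_mono hM => H xi h; apply: le_trans h _; rewrite ler_wpM2r ?pn_ge0 // ltW.
apply: gen_mono (gen_all h) => H xi {}h; rewrite leNgt; apply/negP => hlt.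
set p := pn xi in h hlt; set q := pn _ in h hlt.
have p0 : 0 <= p := pn_ge0 _; have D0 := dnorm_ge0 d.
have e0 : 0 < (q - dnorm d * p) / (p + 1) by apply: divr_gt0; lra.
have [k hk] : exists k : nat, k.+1%:R^-1 < (q - dnorm d * p) / (p + 1).
  exists (Num.bound ((q - dnorm d * p) / (p + 1))^-1).
  rewrite invf_plt ?posrE ?ltr0n //; apply: lt_le_trans (archi_boundP _) _; first by rewrite invr_ge0 ltW.
  by rewrite ler_nat.
have := h k; move: hk; rewrite ltr_pdivlMr; last lra.
have k0 : 0 < k.+1%:R^-1 :> RR by rewrite invr_gt0 ltr0n.
by set i := k.+1%:R^-1 in k0 *; nra.
Qed.

Lemma dbnd_gen t : gen (fun H xi => pn (ev (sval t) xi) <= dnorm (dcls t) * pn xi).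
Proof. by apply/(dbnd_cls t); apply: dnorm_bnd. Qed.
Lemma dnorm_cls_le t M : 0 <= M -> bnd (sval t) M -> dnorm (dcls t) <= M.
Proof. by move=> M0 h; apply: dnorm_le => //; apply/dbnd_cls. Qed.

Lemma dstarD (a b : dcar) : dstar (a + b) = dstar a + dstar b.
Proof. by rewrite -[a]dclsK -[b]dclsK dclsD !dstar_cls dclsD; apply: dcls_ext. Qed.
Lemma dstarZ (c : CC) (a : dcar) : dstar (c *: a) = (c^*)%C *: dstar a.
Proof. by rewrite -[a]dclsK dclsZ !dstar_cls dclsZ; apply: dcls_ext. Qed.
Lemma dstarM (a b : dcar) : dstar (a * b) = dstar b * dstar a.
Proof. by rewrite -[a]dclsK -[b]dclsK dclsM !dstar_cls dclsM; apply: dcls_ext. Qed.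
Lemma dstarK a : dstar (dstar a) = a.
Proof. by rewrite -[a]dclsK !dstar_cls; apply: dcls_ext => H xi /=; rewrite tstarK. Qed.

Lemma dnorm_eq0 a : dnorm a = 0 -> a = 0.
Proof.
rewrite -[a]dclsK => h; apply: dcls_eq; have := dbnd_gen (drep a); rewrite h.
by apply: gen_mono => H xi /=; rewrite mul0r pact0 => /pn_eq0.
Qed.
Lemma dnormD (a b : dcar) : dnorm (a + b) <= dnorm a + dnorm b.
Proof.
rewrite -[a]dclsK -[b]dclsK dclsD; apply: dnorm_cls_le; first by rewrite addr_ge0 ?dnorm_ge0.
apply: gen_mono2 (dbnd_gen (drep a)) (dbnd_gen (drep b)) => H xi /= h1 h2.
by rewrite mulrDl; apply: le_trans (pnD _ _) _; apply: lerD.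
Qed.
Lemma dnormZ_le (c : CC) (a : dcar) : dnorm (c *: a) <= cabs c * dnorm a.
Proof.
rewrite -[a]dclsK dclsZ; apply: dnorm_cls_le; first by rewrite mulr_ge0 ?cabs_ge0 ?dnorm_ge0.
apply: gen_mono (dbnd_gen (drep a)) => H xi /= h1.
by apply: le_trans (pnZ _ _) _; rewrite -mulrA ler_wpM2l ?cabs_ge0.
Qed.
Lemma cabs0 : cabs 0 = 0. Proof. by rewrite (_ : 0 = 0%:C) // cabsR normr0. Qed.
Lemma dnormZ (c : CC) (a : dcar) : dnorm (c *: a) = cabs c * dnorm a.
Proof.
apply/eqP; rewrite eq_le dnormZ_le /=.
have [->|c0] := eqVneq c 0; first by rewrite cabs0 mul0r dnorm_ge0.
have := dnormZ_le c^-1 (c *: a); rewrite scalerA mulVf // scale1r.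
have e : cabs c * cabs c^-1 = 1.
  by rewrite -ComplexField.Normc.normcM divff // /cabs /= expr1n expr0n addr0 sqrtr1.
by move=> /(ler_wpM2l (cabs_ge0 c)); rewrite mulrA e mul1r.
Qed.
Lemma dnormM (a b : dcar) : dnorm (a * b) <= dnorm a * dnorm b.
Proof.
rewrite -[a]dclsK -[b]dclsK dclsM; apply: dnorm_cls_le; first by rewrite mulr_ge0 ?dnorm_ge0.
apply: gen_mono2 (gen_ev (g_stable (drep b)) (dbnd_gen (drep a))) (dbnd_gen (drep b)) => H xi /= h1 h2.
by apply: le_trans h1 _; rewrite -mulrA ler_wpM2l ?dnorm_ge0.
Qed.

Lemma g_adjoint t : exists2 S, cond S & forall (H : hmod A) (xi eta : H),
  vsat S xi -> vsat S eta -> pip (ev (sval t) xi) eta = pip xi (ev (tstar (sval t)) eta).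
Proof. by case: t => t []. Qed.

Lemma gen_stM t : gen (fun H xi => pip xi (ev (tstar (sval t)) (ev (sval t) xi)) = pn (ev (sval t) xi) ^+ 2).
Proof.
have [S cS h] := g_adjoint t.
by apply: gen_mono2 (gen_vsat cS) (g_stable t cS) => H xi h1 h2; rewrite pn2 h.
Qed.

Lemma dnorm_sq_le (a : dcar) : dnorm a ^+ 2 <= dnorm (dstar a * a).
Proof.
rewrite -[a]dclsK dstar_cls dclsM; set t := drep a; set d := dcls (gM _ _).
have d0 := dnorm_ge0 d; rewrite -[leRHS]sqr_sqrtr // ler_pXn2r ?nnegrE ?sqrtr_ge0 ?dnorm_ge0 //.
apply: dnorm_cls_le; first exact: sqrtr_ge0.
apply: gen_mono2 (gen_stM t) (dbnd_gen (gM (gS t) t)) => H xi /= h1 h2.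
rewrite -(@ler_pXn2r _ 2) ?nnegrE ?mulr_ge0 ?sqrtr_ge0 ?pn_ge0 // -h1 exprMn sqr_sqrtr //.
apply: le_trans (ler_norm _) _; apply: le_trans (pip_CS _ _) _.
by rewrite expr2 mulrA mulrC ler_wpM2r ?pn_ge0.
Qed.

Lemma dnorm_star (a : dcar) : dnorm (dstar a) = dnorm a.
Proof.
have le b : dnorm b <= dnorm (dstar b).
  have [->|h] := eqVneq (dnorm b) 0; first exact: dnorm_ge0.
  have h0 : 0 < dnorm b by rewrite lt_def h dnorm_ge0.
  by rewrite -(ler_pM2r h0) -expr2; apply: le_trans (dnorm_sq_le b) (dnormM _ _).
by apply/eqP; rewrite eq_le le andbT; have := le (dstar a); rewrite dstarK.
Qed.

Lemma dnorm_cstar (a : dcar) : dnorm (dstar a * a) = dnorm a ^+ 2.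
Proof.
apply/eqP; rewrite eq_le dnorm_sq_le andbT expr2; apply: le_trans (dnormM _ _) _.
by rewrite dnorm_star.
Qed.

Lemma dcls_subE s t : dcls s - dcls t = dcls (gA s (gZ (-1) t)).
Proof. by rewrite -scaleN1r dclsZ dclsD. Qed.
Lemma gen_sub_bnd s t : gen (fun H xi => pn (ev (sval s) xi - ev (sval t) xi) <= dnorm (dcls s - dcls t) * pn xi).
Proof.
by rewrite dcls_subE; apply: gen_mono (dbnd_gen (gA s (gZ (-1) t))) => H xi /=; rewrite scaleN1r.
Qed.
Lemma gen_dsub (a b : dcar) :
  gen (fun H xi => pn (ev (sval (drep a)) xi - ev (sval (drep b)) xi) <= dnorm (a - b) * pn xi).
Proof. by have := gen_sub_bnd (drep a) (drep b); rewrite !dclsK. Qed.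

(** Serves both completeness of the norm and the suprema of [dalg_sup]. Convergence of the adjoints
    is what makes the limit term good. *)
Lemma dnorm_limit (u : nat -> dcar) (M : RR) : 0 <= M -> (forall n, dnorm (u n) <= M) ->
  converges (fun n => sval (drep (u n))) -> converges (fun n => sval (drep (dstar (u n)))) ->
  exists l : gtm, gen (fun H xi => cvgP (fun n => ev (sval (drep (u n))) xi) (ev (sval l) xi)).
Proof.
move=> M0 hM c1 c2.
have b1 n : bnd (sval (drep (u n))) M.
  apply: gen_mono (dnorm_bnd (u n)) => H xi h; apply: le_trans h _.
  by rewrite ler_wpM2r ?pn_ge0.
have st n : geq (drep (dstar (u n))) (gS (drep (u n))) by apply: drepK.
have b2 n : bnd (tstar (sval (drep (u n)))) M.
  apply: gen_mono2 (st n) (dnorm_bnd (dstar (u n))) => H xi /= <- h; apply: le_trans h _.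
  by rewrite dnorm_star ler_wpM2r ?pn_ge0.
have c3 : converges (fun n => tstar (sval (drep (u n)))).
  apply: gen_mono2 (gen_all st) c2 => H xi h [l hl]; exists l.
  by move: hl; congr cvgP; apply/funext => n; apply: h.
exists (exist _ _ (good_TL M0 (fun n => svalP (drep (u n))) b1 b2 c1 c3)).
by apply: gen_mono (c1) => H xi; apply: lim_ev.
Qed.

Lemma cauchy_converges (u : nat -> dcar) :
  (forall e : RR, 0 < e -> exists N, forall m n, (N <= m)%N -> (N <= n)%N -> dnorm (u m - u n) < e) ->
  converges (fun n => sval (drep (u n))).
Proof.
move=> hu; have h : gen (fun H xi => forall m n,
    pn (ev (sval (drep (u m))) xi - ev (sval (drep (u n))) xi) <= dnorm (u m - u n) * pn xi).
  apply: gen_all => m; apply: gen_all => n; exact: gen_dsub.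
apply: gen_mono h => H xi h; apply: hm_complete => e e0.
have p0 : 0 < pn xi + 1 by have := pn_ge0 xi; lra.
have [N hN] := hu _ (divr_gt0 e0 p0); exists N => m n Nm Nn.
have := hN _ _ Nm Nn; rewrite ltr_pdivlMr // => h2; apply: le_lt_trans (h m n) _.
by have := dnorm_ge0 (u m - u n); have := pn_ge0 xi; nra.
Qed.

Lemma dcomplete (u : nat -> dcar) :
  (forall e : RR, 0 < e -> exists N, forall m n, (N <= m)%N -> (N <= n)%N -> dnorm (u m - u n) < e) ->
  exists l, forall e : RR, 0 < e -> exists N, forall n, (N <= n)%N -> dnorm (u n - l) < e.
Proof.
move=> hu; have c1 := cauchy_converges hu.
have dN (a : dcar) : dnorm (- a) = dnorm a.
  by rewrite -scaleN1r dnormZ (_ : -1 = (-1)%:C) ?cabsR ?normrN ?normr1 ?mul1r // rmorphN.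
have dst a b : dstar (a - b) = dstar a - dstar b.
  by rewrite dstarD -scaleN1r dstarZ (_ : (-1)^* = -1) ?scaleN1r //; cplx.
have c2 : converges (fun n => sval (drep (dstar (u n)))).
  apply: cauchy_converges => e /hu[N hN]; exists N => m n Nm Nn.
  by rewrite -dst dnorm_star; apply: hN.
have [M M0 hM] : exists2 M, 0 <= M & forall n, dnorm (u n) <= M.
  have [N hN] := hu 1 ltr01.
  have s0 : 0 <= \sum_(i < N) dnorm (u i) by apply: sumr_ge0 => i _; apply: dnorm_ge0.
  exists (dnorm (u N) + 1 + \sum_(i < N) dnorm (u i)); first by have := dnorm_ge0 (u N); lra.
  move=> n; have [nN|nN] := leqP N n.
    by have := dnormD (u n - u N) (u N); rewrite subrK; have := hN _ _ nN (leqnn N); lra.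
  have : dnorm (u n) <= \sum_(i < N) dnorm (u i).
    rewrite (bigD1 (Ordinal nN)) //= lerDl; apply: sumr_ge0 => i _; exact: dnorm_ge0.
  by have := dnorm_ge0 (u N); lra.
have [l hl] := dnorm_limit M0 hM c1 c2.
exists (dcls l) => e e0; have [N hN] := hu (e / 2) ltac:(lra); exists N => n Nn.
apply: (@le_lt_trans _ _ (e / 2)); last lra.
rewrite -{1}[u n]dclsK dcls_subE; apply: dnorm_cls_le; first lra.
have h : gen (fun H xi => forall m, pn (ev (sval (drep (u n))) xi - ev (sval (drep (u m))) xi) <= dnorm (u n - u m) * pn xi).
  by apply: gen_all => m; apply: gen_dsub.
apply: gen_mono2 h hl => H xi h hl' /=; rewrite scaleN1r.
have := cvgP_lin (-1) hl' (cvgP_cst (ev (sval (drep (u n))) xi)); rewrite scaleN1r addrC.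
move=> hc; apply: cvgP_pn_le hc _; exists N => m Nm; rewrite scaleN1r addrC.
by apply: le_trans (h m) _; rewrite ler_wpM2r ?pn_ge0 // ltW // hN.
Qed.

Definition dalg : cstar := CStar dstarD dstarZ dstarM dstarK dnorm_eq0 dnormD dnormZ dnormM
  dnorm_cstar dcomplete.

End TermAlgebra.

Section StarHom.
Variables (A B : cstar) (f : A -> B).
Hypothesis fH : star_hom f.

Lemma hom_linear : clinear f. Proof. by case: fH. Qed.
Lemma hom_positive : positive_map f.
Proof. by case: fH => _ _ fM fS _ [b ->]; exists (f b); rewrite fM fS. Qed.
Lemma hom_cp : completely_positive f.
Proof.
case: fH => fL _ fM fS n X [Y ->]; exists (map_mx f Y).
apply/matrixP => i j; rewrite !mxE (big_morph f (clinD fL) (clin0 fL)).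
by apply: eq_bigr => k _; rewrite !mxE fM fS.
Qed.
Lemma hom_sncpu : sigma_normal f -> sncpu f.
Proof. by case: (fH) => fL f1 _ _ fN; split=> //; apply: hom_cp. Qed.
End StarHom.

(** * Order, suprema and the embedding of [A] in the term algebra *)

Section TermAlgebraOrder.
Variable A : cstar.
Notation D := (dalg A).
Implicit Types (d e v s : D) (u : nat -> D).

Definition dev d (H : hmod A) (xi : H) : H := ev (sval (drep d)) xi.

Lemma gen_dev d (P : forall H : hmod A, H -> Prop) : gen P -> gen (fun H xi => P H (dev d xi)).
Proof. exact: gen_ev (g_stable _). Qed.
Lemma gen_devM d e : gen (fun H xi => dev (d * e) xi = dev d (dev e xi)).
Proof. by have := drepK (gM (drep d) (drep e)); rewrite -dclsM !dclsK. Qed.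
Lemma gen_devD d e : gen (fun H xi => dev (d + e) xi = dev d xi + dev e xi).
Proof. by have := drepK (gA (drep d) (drep e)); rewrite -dclsD !dclsK. Qed.
Lemma gen_devZ (c : CC) d : gen (fun H xi => dev (c *: d) xi = c *: dev d xi).
Proof. by have := drepK (gZ c (drep d)); rewrite -dclsZ !dclsK. Qed.
Lemma gen_devB d e : gen (fun H xi => dev (d - e) xi = dev d xi - dev e xi).
Proof.
rewrite -scaleN1r; apply: gen_mono2 (gen_devD d (-1 *: e)) (gen_devZ (-1) e) => H xi -> ->.
by rewrite scaleN1r.
Qed.
Lemma gen_dev_bound d : gen (fun H xi => pn (dev d xi) <= nm d * pn xi).
Proof. exact: dnorm_bnd. Qed.
Lemma dev_ext d e : gen (fun H xi => dev d xi = dev e xi) -> d = e.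
Proof. by move=> h; rewrite -[d]dclsK -[e]dclsK; apply: dcls_eq. Qed.
Lemma gen_dev_linear d : exists2 S, cond S & forall (H : hmod A) (c : CC) (xi eta : H),
  vsat S xi -> vsat S eta -> dev d (c *: xi + eta) = c *: dev d xi + dev d eta.
Proof. exact: g_linear. Qed.
Lemma dev_adjoint d : exists2 S, cond S & forall (H : hmod A) (xi eta : H),
  vsat S xi -> vsat S eta -> pip (dev d xi) eta = pip xi (dev d^† eta).
Proof.
have [S cS h] := g_adjoint (drep d).
have [S' cS' h'] : geq (drep d^†) (gS (drep d)) by apply: drepK.
exists (S `|` S')%classic; first exact: condU.
by move=> H xi eta /vsatU[x1 x2] /vsatU[y1 y2]; rewrite /dev h // h'.
Qed.

Lemma gen_form_star d : gen (fun H xi => pip (dev d^† xi) xi = pip (dev d xi) xi).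
Proof.
by have [S cS h] := dev_adjoint d; apply: gen_mono (gen_vsat cS) => H xi hx; rewrite [RHS]h // pipC.
Qed.
Lemma gen_form_conj v d : gen (fun H xi => pip (dev (v^† * d * v) xi) xi = pip (dev d (dev v xi)) (dev v xi)).
Proof.
have [S cS h] := dev_adjoint v.
have g1 := gen_mono2 (fun H xi (h1 : dev (v^† * d * v) xi = _) (h2 : dev (v^† * d) (dev v xi) = _) => etrans h1 h2)
   (gen_devM (v^† * d) v) (gen_dev v (gen_devM v^† d)).
apply: gen_mono2 g1 (gen_mono2 (fun H xi a b => conj a b) (gen_vsat cS) (gen_dev v (gen_dev d (gen_vsat cS)))).
by move=> H xi -> [x1 x2]; rewrite pipC -h // pipC.
Qed.
Lemma gen_form_stM e : gen (fun H xi => pip (dev (e^† * e) xi) xi = pn (dev e xi) ^+ 2).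
Proof.
have h1 : gen (fun H xi => dev (1 : D) xi = xi).
  have : gen (fun H xi => dev (1 : D) xi = pact 1 xi) by apply: (drepK (gI 1)).
  by apply: gen_mono => H xi ->; rewrite pact1.
have := gen_form_conj e 1; rewrite mulr1; apply: gen_mono2 (gen_dev e h1).
by move=> H xi {}h1 ->; rewrite pn2 h1.
Qed.

Lemma posel_gen d : posel d -> gen (fun H xi => 0 <= pip (dev d xi) xi).
Proof. by case=> b ->; apply: gen_mono (gen_form_stM b) => H xi ->; apply: sqr_ge0. Qed.

Lemma gen_le d e : cle d e -> gen (fun H xi => pip (dev d xi) xi <= pip (dev e xi) xi).
Proof.
move=> /posel_gen; apply: gen_mono2 (gen_devB e d) => H xi ->.
by rewrite pipB subr_ge0.
Qed.

(* The negative part [q * q] of [d] satisfies [q * d * q = - (q * q) ^+ 2]. *)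
Lemma gen_posel d : selfadj d -> gen (fun H xi => 0 <= pip (dev d xi) xi) -> posel d.
Proof.
move=> sd h; have [p [q [sp sq e pq qp]]] := Pos_decomp sd.
have q2 : q * q = 0.
  apply: dev_ext; have e1 : q^† * d * q = (-1) *: ((q * q)^† * (q * q)).
    by rewrite cs_starM sq e; transitivity ((q * p) * (p * q) - q * q * (q * q)); [ncalg | rewrite qp mul0r sub0r scaleN1r].
  have h1 := gen_dev q h; have h2 := gen_form_conj q d; rewrite e1 in h2.
  have h3 := gen_mono2 (fun H xi (a : 0 <= _) (b : _ = _) => eq_ind_r (fun z => 0 <= z) a b) h1 h2.
  have h4 := gen_mono2 (fun H xi a b => conj a b) h3 (gen_devZ (-1) ((q * q)^† * (q * q))).
  have h5 := gen_mono2 (fun H xi a b => conj a b) h4 (gen_form_stM (q * q)).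
  have h6 : gen (fun H xi => dev (0 : D) xi = pact 0 xi) by apply: (drepK (gI 0)).
  apply: gen_mono2 h5 h6 => H xi [[h3' h4'] h5'] ->; rewrite pact0; apply: pn_eq0.
  move: h3'; rewrite h4' scaleN1r pipN h5' oppr_ge0 => h7.
  have : pn (dev (q * q) xi) ^+ 2 = 0 by apply/eqP; rewrite eq_le h7 sqr_ge0.
  by move=> /eqP; rewrite sqrf_eq0 => /eqP ->.
by rewrite e q2 subr0; apply: posel_sq.
Qed.

Lemma gen_sq_le e : posel e ->
  gen (fun H xi => pn (dev e xi) ^+ 2 <= nm e * pip (dev e xi) xi).
Proof.
move=> pe; have := gen_le (sq_le pe); rewrite -{1}[e](posel_sa pe : e^† = e) => h.
apply: gen_mono2 (gen_form_stM e) (gen_mono2 (fun H xi a b => conj a b) h (gen_devZ (nm e)%:C e)).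
by move=> H xi <- [h1 h2]; apply: le_trans h1 _; rewrite h2 pipR.
Qed.

(** By [gen_sq_le] the squared length of [(s - u n) xi] is at most [K] times the form of [s - u n]
    at [xi]. *)
Lemma strong_of_form u s (K : RR) : (forall n, cle (u n) s) -> (forall n, nm (s - u n) <= K) ->
  gen (fun H xi => cvgR (fun n => pip (dev (u n) xi) xi) (pip (dev s xi) xi)) ->
  gen (fun H xi => cvgP (fun n => dev (u n) xi) (dev s xi)).
Proof.
move=> us hK h; have K0 : 0 <= K := le_trans (nm_ge0 _) (hK 0%N).
have h1 : gen (fun H xi => forall n, pn (dev (s - u n) xi) ^+ 2 <= nm (s - u n) * pip (dev (s - u n) xi) xi).
  by apply: gen_all => n; apply: gen_sq_le; apply: us.
have h2 : gen (fun H xi => forall n, dev (s - u n) xi = dev s xi - dev (u n) xi).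
  by apply: gen_all => n; apply: gen_devB.
apply: gen_mono2 h (gen_mono2 (fun H xi a b => conj a b) h1 h2) => H xi h [{}h1 {}h2] e e0.
have K1 : 0 < K + 1 by lra.
have [N hN] := h (e ^+ 2 / (K + 1)) (divr_gt0 (exprn_gt0 _ e0) K1).
exists N => n /hN; rewrite ltr_pdivlMr // distrC => hn.
have := h1 n; rewrite h2 pipB pnB; set r := _ - _ in hn *.
set p := pn _ => hp; have p0 : 0 <= p := pn_ge0 _.
rewrite -(@ltr_pXn2r _ 2) ?nnegrE ?pn_ge0 ?ltW //; apply: le_lt_trans hp _.
apply: le_lt_trans hn; apply: (@le_trans _ _ (nm (s - u n) * `|r|)).
  by rewrite ler_wpM2l ?nm_ge0 // ler_norm.
by rewrite mulrC ler_wpM2l ?normr_ge0 //; have := hK n; lra.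
Qed.

(** Vigier's theorem at generic vectors: the forms increase and are bounded, and [gen_sq_le] for the
    differences turns this into a Cauchy sequence of vectors. The adjoints converge too, as the
    [u n] are self-adjoint. *)
Lemma dalg_sup u : incr_sa u -> nbounded u -> exists s, is_sup u s /\
  gen (fun H xi => cvgP (fun n => dev (u n) xi) (dev s xi)).
Proof.
move=> iu [M hM]; have [su mu] := iu; have M0 : 0 <= M := le_trans (nm_ge0 _) (hM 0%N).
have mono n m : (n <= m)%N -> posel (u m - u n) by apply: incr_mono.
have gb : gen (fun H xi => forall n, pn (dev (u n) xi) <= M * pn xi).
  apply: gen_all => n; apply: gen_mono (gen_dev_bound (u n)) => H xi h; apply: le_trans h _.
  by rewrite ler_wpM2r ?pn_ge0.
have gm : gen (fun H xi => forall n, pip (dev (u n) xi) xi <= pip (dev (u n.+1) xi) xi).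
  by apply: gen_all => n; apply: gen_le.
have gd : gen (fun H xi => forall m n, (n <= m)%N ->
    pn (dev (u m) xi - dev (u n) xi) ^+ 2 <= 2 * M * (pip (dev (u m) xi) xi - pip (dev (u n) xi) xi)).
  apply: gen_all => m; apply: gen_all => n; have [nm|] := leqP n m; last by move=> _; apply: gen_true.
  apply: gen_mono2 (gen_sq_le (mono _ _ nm)) (gen_mono2 (fun H xi a b => conj a b) (gen_devB (u m) (u n)) (posel_gen (mono _ _ nm))).
  move=> H xi h1 [h2 h3] _; rewrite -h2; apply: le_trans h1 _; rewrite -pipB -h2.
  rewrite ler_wpM2r //; have := cs_normD (u m) (- u n); rewrite nmN.
  by have := hM m; have := hM n; lra.
have c1 : converges (fun n => sval (drep (u n))).
  apply: gen_mono2 gd (gen_mono2 (fun H xi a b => conj a b) gb gm) => H xi gd' [gb' gm'].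
  have [|l [hl1 hl2]] := @real_mono_lim (fun n => pip (dev (u n) xi) xi) (M * pn xi * pn xi) gm'.
    move=> n; apply: le_trans (ler_norm _) _; apply: le_trans (pip_CS _ _) _.
    by rewrite ler_wpM2r ?pn_ge0.
  apply: hm_complete => e e0; have M1 : 0 < 2 * M + 1 by lra.
  have [N hN] := hl2 _ (divr_gt0 (exprn_gt0 2 e0) M1); exists N.
  have main m n : (N <= n)%N -> (n <= m)%N -> pn (dev (u m) xi - dev (u n) xi) < e.
    move=> Nn nm; rewrite -(@ltr_pXn2r _ 2) ?nnegrE ?pn_ge0 ?ltW //.
    apply: le_lt_trans (gd' _ _ nm) _; have := hN _ Nn; have := hl1 m.
    set p := pip _ _; set q := pip _ _ => a1 a2.
    have : p - q < e ^+ 2 / (2 * M + 1) by lra.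
    have : q <= p := real_mono_le (r := fun k => pip (dev (u k) xi) xi) gm' nm.
    by rewrite ltr_pdivlMr //; nra.
  move=> m n Nm Nn; have [nm|/ltnW mn] := leqP n m; first exact: main.
  by rewrite pnB; apply: main.
have c2 : converges (fun n => sval (drep (dstar (u n)))).
  by apply: gen_mono c1 => H xi [l hl]; exists l; move: hl; congr cvgP; apply/funext => n; rewrite (su n : dstar (u n) = _).
have [l hl] := dnorm_limit M0 hM c1 c2.
(* The limit term is not visibly self-adjoint. Its real part has the same forms, and
   [strong_of_form] gets strong convergence back from them. *)
pose d : D := dcls l; pose s := rpart d.
have ss : selfadj s := sa_rpart d.
have fs : gen (fun H xi => pip (dev s xi) xi = pip (dev d xi) xi).
  have := gen_mono2 (fun H xi a b => conj a b) (gen_devD d d^†) (gen_devZ half (d + d^†)).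
  apply: gen_mono2 (gen_form_star d) => H xi h1 [h2 h3].
  by rewrite h3 h2 pipR pipD h1; field.
have hl' : gen (fun H xi => cvgP (fun n => dev (u n) xi) (dev d xi)).
  by apply: gen_mono2 hl (drepK l) => H xi h1 h2; rewrite /dev h2.
have hf : gen (fun H xi => cvgR (fun n => pip (dev (u n) xi) xi) (pip (dev s xi) xi)).
  by apply: gen_mono2 hl' fs => H xi h1 ->; apply: cvgP_pip.
have us n : cle (u n) s.
  apply: gen_posel; first exact: sa_B.
  apply: gen_mono2 (gen_devB s (u n)) (gen_mono2 (fun H xi a b => conj a b) hf gm) => H xi -> [h1 h2].
  rewrite pipB subr_ge0; apply: cvgR_ge h1 _; exists n => k nk.
  exact: (real_mono_le (r := fun k => pip (dev (u k) xi) xi)).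
exists s; split.
  split=> // t st ut; apply: gen_posel; first exact: sa_B.
  have gt : gen (fun H xi => forall n, pip (dev (u n) xi) xi <= pip (dev t xi) xi).
    by apply: gen_all => n; apply: gen_le.
  apply: gen_mono2 (gen_devB t s) (gen_mono2 (fun H xi a b => conj a b) hf gt) => H xi -> [h1 h2].
  by rewrite pipB subr_ge0; apply: cvgR_le h1 _; exists 0%N.
apply: (strong_of_form (K := nm s + M)) => // n.
by have := cs_normD s (- u n); rewrite nmN; have := hM n; lra.
Qed.

Lemma dalg_sigma : sigma_cstar D.
Proof. by move=> u iu bu; have [s [h _]] := dalg_sup iu bu; exists s. Qed.

Lemma gen_sup u s : incr_sa u -> nbounded u -> is_sup u s ->
  gen (fun H xi => cvgP (fun n => dev (u n) xi) (dev s xi)).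
Proof. by move=> iu bu us; have [t [h g]] := dalg_sup iu bu; rewrite (sup_unique us h). Qed.

Definition dj (a : A) : D := dcls (gI a).

Lemma gen_dj a : gen (fun H xi => dev (dj a) xi = pact a xi).
Proof. exact: (drepK (gI a)). Qed.

Lemma dj_hom : star_hom dj.
Proof.
split.
- move=> c a b; rewrite /dj [in RHS]/GRing.scale /= .
  rewrite [X in _ = X + _]dclsZ dclsD; apply: dcls_ext => H xi /=; by rewrite pactD pactZ.
- by [].
- by move=> a b; rewrite /dj dclsM; apply: dcls_ext => H xi /=; rewrite pactM.
- by move=> a; rewrite /dj [RHS]dstar_cls; apply: dcls_ext.
Qed.

Lemma dj_inj : injective dj.
Proof.
move=> a b /dcls_inj [S cS h]; apply/eqP; rewrite -subr_eq0; apply/eqP.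
apply: contrapT => ab; have nn : ~ cle ((a - b)^† * (a - b)) 0.
  move=> /cleN0 hn; apply: ab; apply: stM_eq0; apply: posel_anti => //; by exists (a - b).
have [H [xi [xiS]]] := generic_vector cS (sa_stM (a - b)) nn.
have e : pact a xi = pact b xi := h H xi xiS.
by rewrite pip_stM pactB e subrr pip0 ltxx.
Qed.

(** The sequence [s - u n] itself is taken as a condition. At vectors generic for it the forms of
    [u n] come arbitrarily close to that of [s], so an upper bound in the term algebra dominates
    [dj s] there, and [gen_posel] concludes. *)
Lemma dj_normal : sigma_normal dj.
Proof.
move=> u s iu _ us; have hy := Dec0_sup iu us.
have jL := hom_linear dj_hom; have jp := hom_positive dj_hom.
have cS : cond [set fun n => s - u n]%classic.
  by split; [exact: finite_set_countable | move=> y ->].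
split.
- by apply: pos_sa => //; case: us.
- by move=> n; apply: pos_cle => //; case: us.
move=> t st ut; apply: gen_posel; first by apply: sa_B => //; apply: pos_sa => //; case: us.
have gt : gen (fun H xi => forall n, pip (pact (u n) xi) xi <= pip (dev t xi) xi).
  apply: gen_all => n; apply: gen_mono2 (gen_le (ut n)) (gen_dj (u n)) => H xi h1 h2.
  by move: h1; rewrite /= h2.
apply: gen_mono2 (gen_mono2 (fun H xi a b => conj a b) (gen_devB t (dj s)) (gen_dj s))
  (gen_mono2 (fun H xi a b => conj a b) gt (gen_vsat cS)) => H xi [-> ->] [{}gt hs].
rewrite pipB subr_ge0 leNgt; apply/negP => hlt.
have [|n] := hs (fun n => s - u n) erefl (pip (pact s xi) xi - pip (dev t xi) xi); first lra.
by rewrite pactB pipB; have := gt n; lra.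
Qed.
End TermAlgebraOrder.

(** * The sigma-closure of a subalgebra is a subalgebra *)

Section Closure.
Variables (A E : cstar) (j : A -> E).
Hypothesis jH : star_hom j.
Implicit Types (a b : A) (s t x z v w : E) (u : nat -> E).

Notation X := (fun x => exists a, x = j a).
Notation S := (sigma_closure X).

Lemma clo_ind (P : E -> Prop) : sigma_subspace P -> (forall a, P (j a)) -> forall s, S s -> P s.
Proof. by move=> hP hj s; apply=> // _ [a ->]. Qed.
Lemma clo_j a : S (j a).
Proof. by move=> P hP hj; apply: hj; exists a. Qed.
Lemma clo_subspace : star_subspace S.
Proof.
split=> [P [[]] //|c s t hs ht P hP hX|s hs P hP hX].
  by case: (hP) => [[_ hL _] _]; apply: hL; [apply: hs | apply: ht].
by case: (hP) => [[_ _ hs'] _]; apply: hs'; apply: hs.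
Qed.
Lemma clo_sup u s : incr_sa u -> nbounded u -> (forall n, S (u n)) -> is_sup u s -> S s.
Proof.
move=> iu bu hu us P hP hX; case: (hP) => _ h; apply: h iu bu _ us => n.
exact: hu.
Qed.
Lemma clo0 : S 0. Proof. by case: clo_subspace. Qed.
Lemma cloL (c : CC) s t : S s -> S t -> S (c *: s + t). Proof. by case: clo_subspace => _ h _; apply: h. Qed.
Lemma clo_st s : S s -> S s^†. Proof. by case: clo_subspace => _ _ h; apply: h. Qed.
Lemma cloZ (c : CC) s : S s -> S (c *: s).
Proof. by move=> hs; rewrite -[_ *: _]addr0; apply: cloL => //; apply: clo0. Qed.
Lemma cloD s t : S s -> S t -> S (s + t).
Proof. by move=> hs ht; rewrite -[s]scale1r; apply: cloL. Qed.
Lemma cloN s : S s -> S (- s).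
Proof. by move=> hs; rewrite -scaleN1r; apply: cloZ. Qed.
Lemma cloB s t : S s -> S t -> S (s - t).
Proof. by move=> hs ht; apply: cloD => //; apply: cloN. Qed.
Lemma clo1 : S 1.
Proof. by case: jH => _ h1 _ _; rewrite -h1; apply: clo_j. Qed.
Lemma clo_rpart s : S s -> S (rpart s).
Proof. by move=> hs; apply: cloZ; apply: cloD => //; apply: clo_st. Qed.
Lemma clo_ipart s : S s -> S (ipart s).
Proof. by move=> hs; apply: cloZ; apply: cloB => //; apply: clo_st. Qed.

Lemma half_pow (k : nat) : (2^-1 ^+ k : RR) <= k.+1%:R^-1.
Proof.
rewrite exprVn lef_pV2 ?posrE ?exprn_gt0 ?ltr0n //.
by rewrite -natrX ler_nat ltn_expl.
Qed.

(* Subtracting [3 * 2^-k] turns a rapidly convergent sequence into an increasing one with the same limit. *)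
Lemma clo_closed_sa u x : (forall n, S (u n)) -> (forall n, selfadj (u n)) -> cvgA u x -> S x.
Proof.
move=> hS hsa hu.
have sx : selfadj x := closed_sa hsa hu.
pose d (k : nat) : RR := 2^-1 ^+ k.
have d0 k : 0 < d k by apply: exprn_gt0; lra.
have dS k : d k.+1 = d k / 2 by rewrite /d exprS mulrC.
have /choice[f hf] : forall k, exists n, nm (u n - x) < d k.
  by move=> k; have [N hN] := hu _ (d0 k); exists N; apply: hN.
(* The factor 3 makes [z] increasing: consecutive [u (f k)] differ in norm by at most
   [d k + d k.+1], which equals [3 * (d k - d k.+1)]. *)
pose z k := u (f k) - (3 * d k)%:S.
have xz k : cle ((d k)%:S) (x - z k).
  have : cle (- (d k)%:S) (x - u (f k)).
    have h := cle_nmM (sa_B (hsa (f k)) sx) (ltW (hf k)).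
    by have := cle_N h; rewrite opprB.
  rewrite /cle /z (_ : 3 * d k = d k + (d k + d k)) -?rSD; last by lra.
  move=> h; have := posel_D h (posel_Z (ltW (d0 k)) (posel1 E)); congr posel; ncalg.
have zc : cvgA z x.
  move=> e e0; exists (Num.bound (4 / e)) => n Nn.
  have h1 := cs_normD (u (f n) - x) (- (3 * d n)%:S); rewrite addrAC -/(z n) nmN nmS in h1.
  have h2 := hf n; have h3 := half_pow n.
  have h4 : 4 / e < n.+1%:R.
    apply: lt_le_trans (archi_boundP _) _; first by rewrite divr_ge0 // ltW.
    by rewrite ler_nat (leq_trans Nn).
  have h5 : 4 * n.+1%:R^-1 < e.
    by rewrite -/(4 / _) ltr_pdivrMr ?ltr0n // mulrC -ltr_pdivrMr.
  have : `|3 * d n| = 3 * d n by rewrite ger0_norm // mulr_ge0 ?ler0n // ltW.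
  have h6 : d n <= n.+1%:R^-1 := h3.
  move=> h7; rewrite h7 in h1; move: h5 h6 h2 h1.
  by set i := n.+1%:R^-1; set dn := d n; set p := nm _; set q := nm _; lra.
have zb : nbounded z by apply: cvgA_bounded zc.
apply: (clo_sup (u := z)) => //.
- split=> k; first by apply: sa_B => //; apply: sa_S.
  have h1 : cle (- (d k + d k.+1)%:S) (u (f k.+1) - u (f k)).
    have h := @cle_nmM E (u (f k) - u (f k.+1)) (d k + d k.+1) (sa_B (hsa _) (hsa _)).
    have : nm (u (f k) - u (f k.+1)) <= d k + d k.+1.
      have := nm_tri x (u (f k)) (u (f k.+1)); rewrite (nmB x).
      by have := hf k; have := hf k.+1; lra.
    by move=> /h/cle_N; rewrite opprB.
  have : posel (z k.+1 - z k) <-> posel (u (f k.+1) - u (f k) + (3 * (d k - d k.+1))%:S).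
    rewrite (_ : z k.+1 - z k = u (f k.+1) - u (f k) + (3 * (d k - d k.+1))%:S) //.
    by rewrite /z mulrBr rmorphB scalerBl; ncalg.
  case=> _; apply; move: h1; rewrite /cle opprK.
  by rewrite (_ : d k + d k.+1 = 3 * (d k - d k.+1)) // dS; field.
- by move=> k; apply: cloB => //; apply: cloZ; apply: clo1.
- split=> // [k|t st ut].
    by have := posel_D (xz k) (posel_Z (ltW (d0 k)) (posel1 E)); rewrite subrK.
  apply: (closed_posel (u := fun k => t - z k)) => //.
  by apply: cvgAD; [exact: cvgA_cst | exact: cvgAN].
Qed.

Lemma clo_closed : closedA S.
Proof.
move=> u x hS hu; rewrite [x]ripart addrC; apply: cloD.
  apply: cloZ; apply: (@clo_closed_sa (fun n => ipart (u n))).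
  - by move=> n; apply: clo_ipart.
  - by move=> n; apply: sa_ipart.
  - by apply: cvgAZ; apply: cvgAD => //; apply: cvgAN; apply: cvgAst.
apply: (@clo_closed_sa (fun n => rpart (u n))).
- by move=> n; apply: clo_rpart.
- by move=> n; apply: sa_rpart.
- by apply: cvgAZ; apply: cvgAD => //; apply: cvgAst.
Qed.

Lemma polar v w s : v^† * s * w =
  half *: ((v + w)^† * s * (v + w) - iC *: ((v + iC *: w)^† * s * (v + iC *: w))
    - (1 - iC) *: (v^† * s * v + w^† * s * w)).
Proof.
rewrite !cs_starD stI; ncalg_core.
all: apply/eqP; rewrite eq_complex /=; apply/andP; split; apply/eqP; by field.
Qed.

Lemma nbounded_conj v u : nbounded u -> nbounded (fun n => v^† * u n * v).
Proof.
move=> [M hM]; exists (nm v^† * M * nm v) => n.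
apply: le_trans (cs_normM _ _) _; rewrite ler_wpM2r ?nm_ge0 //.
by apply: le_trans (cs_normM _ _) _; rewrite ler_wpM2l ?nm_ge0.
Qed.

Lemma clo_sup_conj v u s : incr_sa u -> nbounded u -> is_sup u s ->
  (forall n, S (v^† * u n * v)) -> S (v^† * s * v).
Proof.
move=> iu bu us hS; have [iv vs] := sup_conj v iu us.
exact: clo_sup iv (nbounded_conj v bu) hS vs.
Qed.

(** Conjugation preserves suprema, so the elements whose conjugate lies in [S] form a
    sigma-subspace. *)
Lemma clo_conj a s : S s -> S ((j a)^† * s * j a).
Proof.
case: jH => jL j1 jM jS; move: s; apply: clo_ind; last first.
  by move=> b; rewrite -jS -!jM; apply: clo_j.
split; first split.
- by rewrite mulr0 mul0r; apply: clo0.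
- by move=> c s t hs ht; rewrite mulrDr mulrDl -scalerAr -scalerAl; apply: cloL.
- by move=> s /clo_st; rewrite !stE mulrA.
by move=> u s iu bu hu us; apply: clo_sup_conj iu bu us hu.
Qed.

Lemma clo_bimod a b s : S s -> S (j a * s * j b).
Proof.
case: (jH) => jL j1 jM jS hs.
rewrite -[j a]cs_starK -jS polar; apply: cloZ; apply: cloB; first apply: cloB.
- by rewrite -(clinD jL); apply: clo_conj.
- by apply: cloZ; rewrite -(clinZ jL) -(clinD jL); apply: clo_conj.
- by apply: cloZ; apply: cloD; apply: clo_conj.
Qed.
Lemma clo_left a s : S s -> S (j a * s).
Proof. by case: (jH) => jL j1 jM jS /(clo_bimod a 1); rewrite j1 mulr1. Qed.
Lemma clo_right a s : S s -> S (s * j a).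
Proof. by case: (jH) => jL j1 jM jS /(clo_bimod 1 a); rewrite j1 mul1r. Qed.

(** Products are out of reach of a direct induction on the closure. The multipliers of [S] form a
    closed subalgebra containing [j A]; the work lies in showing that they are stable under suprema
    ([mult_sup]). *)
Definition mult z := S z /\ forall s, S s -> S (z * s) /\ S (s * z).

Lemma mult_j a : mult (j a).
Proof. by split; [exact: clo_j | move=> s hs; split; [exact: clo_left | exact: clo_right]]. Qed.

Lemma mult_csub : csub mult.
Proof.
split.
- by split; [exact: clo1 | move=> s hs; rewrite mul1r mulr1].
- move=> c a b [Sa ha] [Sb hb]; split; first exact: cloL.
  move=> s hs; rewrite mulrDl mulrDr -scalerAl -scalerAr.
  by have [a1 a2] := ha s hs; have [b1 b2] := hb s hs; split; apply: cloL.
- move=> a b [Sa ha] [Sb hb]; split; first by case: (ha b Sb).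
  move=> s hs; have [b1 b2] := hb s hs; have [a1 a2] := ha s hs.
  by split; [rewrite -mulrA; case: (ha _ b1) | rewrite mulrA; case: (hb _ a2)].
- move=> u l hu hl; split; first by apply: clo_closed hl => n; case: (hu n).
  move=> s hs; split.
    by apply: clo_closed (cvgAMr s hl) => n; case: (hu n) => _ /(_ s hs)[].
  by apply: clo_closed (cvgAMl s hl) => n; case: (hu n) => _ /(_ s hs)[].
Qed.

Lemma mult_st z : mult z -> mult z^†.
Proof.
move=> [Sz hz]; split; first exact: clo_st.
move=> s /clo_st hs; have [h1 h2] := hz _ hs.
by split; [have := clo_st h2 | have := clo_st h1]; rewrite cs_starM cs_starK.
Qed.

(* The resolvents [(1 + r * z n)^-1] decrease to [(1 + r * x)^-1] because inversion is antitone. *)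
Lemma clo_resolvent (z : nat -> E) x (r : RR) (v : E) : 0 <= r ->
  (forall n, mult (z n)) -> incr_sa z -> (forall n, posel (z n)) -> is_sup z x ->
  v * (1 + r%:C *: x) = 1 -> (1 + r%:C *: x) * v = 1 -> Pos v -> S v.
Proof.
move=> r0 hz iz pz xs vx xv pv.
have [sz mz] := iz; have [sx zx lx] := xs.
have px : posel x by rewrite -[x](subrK (z 0%N)); apply: posel_D => //; apply: zx.
have /choice[w hw] : forall n, exists w : E, [/\ w * (1 + r%:C *: z n) = 1,
    (1 + r%:C *: z n) * w = 1, Pos w, cle w 1 & mult w].
  move=> n; have [|w [h1 h2 h3 h4 h5]] := @Pos_inv E (r%:C *: z n).
    by apply/poselP; apply: posel_Z.
  by exists w; split=> //; apply: h5; [exact: mult_csub | apply: csubZ (hz n); exact: mult_csub].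
have pw n : posel (w n) by apply/poselP; case: (hw n).
have pv' : posel v by apply/poselP.
have wd n : cle (w n.+1) (w n).
  have [a1 a2 _ _ _] := hw n; have [b1 b2 _ _ _] := hw n.+1.
  apply: (inv_antitone (cle_Z r0 (mz n)) (pw n) (posel_sa (pw n.+1)) a1 a2 b1 b2).
have vw n : cle v (w n).
  have [a1 a2 _ _ _] := hw n.
  exact: (inv_antitone (cle_Z r0 (zx n)) (pw n) (posel_sa pv') a1 a2 vx xv).
have hy : Dec0 (fun n => x - z n) := Dec0_sup iz xs.
pose K := nm (x - z 0%N).
have K0 : 0 <= K := nm_ge0 _.
(* With [e = x - z n], iterating the resolvent identity gives [w n - v = r v e v + r^2 (e v)^† (w n)
   (e v)]. The second term is controlled by [w n <= 1] and [e * e <= K e], so [w n - v] inherits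
   infimum 0 from the conjugates of [e]. *)
have bound n : cle (w n - v) ((r + r * r * K)%:C *: (v^† * (x - z n) * v)).
  have [a1 a2 _ w1 _] := hw n; pose e := x - z n.
  have pe : posel e by apply: zx.
  have se := posel_sa pe; have svv := posel_sa pv'; have sw := posel_sa (pw n).
  have e1 : w n - v = r%:C *: (w n * e * v).
    have -> : r%:C *: (w n * e * v) = w n * ((1 + r%:C *: x) * v) - w n * (1 + r%:C *: z n) * v.
      by rewrite /e; ncalg.
    by rewrite xv a1 mulr1 mul1r.
  have e2 : w n - v = r%:C *: (v * e * w n).
    have -> : r%:C *: (v * e * w n) = v * (1 + r%:C *: x) * w n - v * ((1 + r%:C *: z n) * w n).
      by rewrite /e; ncalg.
    by rewrite vx a2 mulr1 mul1r.
  have e3 : w n - v = r%:C *: (v^† * e * v) + (r * r)%:C *: ((e * v)^† * w n * (e * v)).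
    have -> : w n - v = r%:C *: (v * e * v) + r%:C *: (v * e * (w n - v)) by rewrite {1}e2; ncalg.
    by rewrite {1}e1 cs_starM (svv : v^† = v) (se : e^† = e) rmorphM; ncalg.
  rewrite e3 rmorphD scalerDl; apply: cle_D; first exact: cle_refl.
  have -> : (r * r * K)%:C *: (v^† * e * v) = (r * r)%:C *: (K%:C *: (v^† * e * v)).
    by rewrite scalerA -rmorphM.
  apply: (cle_Z (mulr_ge0 r0 r0)).
  apply: cle_trans (cle_conj (e * v) w1) _.
  rewrite mulr1 cs_starM (se : e^† = e).
  have -> : v^† * e * (e * v) = v^† * (e * e) * v by rewrite !mulrA.
  apply: cle_trans (cle_conj v (sq_le pe)) _.
  rewrite -scalerAr -scalerAl; apply: cle_ZP; last exact: posel_conj.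
  by apply: nm_mono => //; apply: (Dec0_mono hy (leq0n n)).
have dw : Dec0 (fun n => w n - v).
  apply: Dec0_le (Dec0_Z _ (Dec0_conj v hy)) _ _ bound.
  - by rewrite addr_ge0 ?mulr_ge0.
  - exact: vw.
  - by move=> n; apply: cle_Dr.
rewrite -[v]opprK; apply: cloN.
apply: (@clo_sup (fun n => - w n)).
- by split=> n; [apply: sa_N; apply: posel_sa | apply: cle_N].
- exists 1 => n; rewrite nmN; apply: nm_cleS => //; rewrite scale1r; by case: (hw n).
- by move=> n; apply: cloN; case: (hw n) => _ _ _ _ [].
- apply: sup_Dec0; first by apply: sa_N; apply: posel_sa.
  by move: dw; congr Dec0; apply/funext => n; rewrite opprK addrC.
Qed.

Lemma is_sup_shift u s (M : RR) : is_sup u s -> is_sup (fun n => u n + M%:S) (s + M%:S).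
Proof.
move=> [ss us ls]; split=> [|n|t st ut].
- by apply: sa_D => //; apply: sa_S.
- exact: cle_Dr.
have : cle s (t - M%:S).
  apply: ls => [|n]; first by apply: sa_B => //; apply: sa_S.
  by have := cle_Dr (- M%:S) (ut n); rewrite addrK.
by move=> /(cle_Dr M%:S); rewrite subrK.
Qed.

(** Second-order expansion of the resolvent: for [v = (1 + r x)^-1] the element
    [(v - 1 + r x) / r^2] lies in [S] and equals [v * x * x], which tends to [x * x] in norm as [r]
    tends to 0. *)
Lemma clo_sq_pos (z : nat -> E) x : (forall n, mult (z n)) -> incr_sa z ->
  (forall n, posel (z n)) -> is_sup z x -> S x -> S (x * x).
Proof.
move=> hz iz pz xs Sx; have [sx zx _] := xs.
have px : posel x by rewrite -[x](subrK (z 0%N)); apply: posel_D => //; apply: zx.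
pose r (k : nat) : RR := k.+1%:R^-1.
have r0 k : 0 < r k by rewrite invr_gt0 ltr0n.
have /choice[v hv] : forall k, exists v : E, [/\ v * (1 + (r k)%:C *: x) = 1,
    (1 + (r k)%:C *: x) * v = 1, Pos v & cle v 1].
  move=> k; have [|w [h1 h2 h3 h4 h5]] := @Pos_inv E ((r k)%:C *: x); last by exists w.
  by apply/poselP; apply: posel_Z => //; exact: ltW.
have Sv k : S (v k).
  by have [h1 h2 h3 _] := hv k; apply: (clo_resolvent (ltW (r0 k)) hz iz pz xs h1 h2 h3).
pose q k := v k * x * x.
have qE k : q k = ((r k)^-1 * (r k)^-1)%:C *: (v k - 1 + (r k)%:C *: x).
  have [h1 h2 _ _] := hv k.
  have e1 : (r k)%:C *: (v k * x) = 1 - v k.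
    by rewrite -{1}h1; ncalg.
  have -> : v k - 1 + (r k)%:C *: x = (r k * r k)%:C *: q k.
    have -> : (r k * r k)%:C *: q k = (r k)%:C *: (((r k)%:C *: (v k * x)) * x).
      by rewrite rmorphM /q; ncalg.
    by rewrite e1 mulrBl mul1r scalerBr e1; ncalg.
  rewrite scalerA -rmorphM /= (_ : _ * _ * _ = 1) ?scale1r //.
  by field; rewrite gt_eqF.
have Sq k : S (q k).
  rewrite qE; apply: cloZ; apply: cloD; last exact: cloZ.
  by apply: cloB => //; apply: clo1.
apply: (clo_closed Sq) => e e0.
have C0 : 0 < nm (x * x * x) + 1 by have := nm_ge0 (x * x * x); lra.
exists (Num.bound ((nm (x * x * x) + 1) / e)) => k hk.
have [h1 _ h3 h4] := hv k.
have -> : q k - x * x = - ((r k)%:C *: (v k * (x * x * x))).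
  have e1 : (r k)%:C *: (v k * x) = 1 - v k by rewrite -{1}h1; ncalg.
  have -> : (r k)%:C *: (v k * (x * x * x)) = ((r k)%:C *: (v k * x)) * (x * x) by ncalg.
  by rewrite e1 /q; ncalg.
rewrite nmN nmZ gtr0_norm //.
have n1 : nm (v k) <= 1 by apply: nm_cleS; [apply/poselP | rewrite scale1r].
have n2 : nm (v k * (x * x * x)) <= nm (x * x * x).
  apply: le_trans (cs_normM _ _) _; rewrite -[leRHS]mul1r ler_wpM2r ?nm_ge0 //.
have h5 : (nm (x * x * x) + 1) / e < k.+1%:R.
  apply: lt_le_trans (archi_boundP _) _; first by rewrite divr_ge0 // ltW.
  by rewrite ler_nat (leq_trans hk).
apply: (@le_lt_trans _ _ (r k * nm (x * x * x))); first by rewrite ler_wpM2l // ltW.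
rewrite /r mulrC ltr_pdivrMr ?ltr0n //.
by move: h5; rewrite ltr_pdivrMr // mulrC; lra.
Qed.

Lemma incr_shift u (M : RR) : incr_sa u -> incr_sa (fun n => u n + M%:S).
Proof.
by case=> su mu; split=> n; [apply: sa_D => //; apply: sa_S | apply: cle_Dr].
Qed.

(** Adding the scalar [M] makes the sequence positive and changes the square by elements of [S]. *)
Lemma clo_sq (z : nat -> E) x : (forall n, mult (z n)) -> incr_sa z -> nbounded z ->
  is_sup z x -> S (x * x).
Proof.
move=> hz iz bz xs; have [M hM] := bz.
have Sx : S x by apply: (clo_sup iz bz _ xs) => n; case: (hz n).
have h : S ((x + M%:S) * (x + M%:S)).
  apply: (clo_sq_pos (z := fun n => z n + M%:S)) => //.
  - move=> n; apply: csubD (hz n) _; first exact: mult_csub.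
    by apply: csubZ; [exact: mult_csub | exact: (csub1 mult_csub)].
  - exact: incr_shift.
  - move=> n; have [sz _] := iz.
    by have := cle_nmM (sa_N (sz n)) (ltac:(by rewrite nmN) : nm (- z n) <= M); rewrite /cle opprK addrC.
  - exact: is_sup_shift.
  - by apply: cloD => //; apply: cloZ; apply: clo1.
have -> : x * x = (x + M%:S) * (x + M%:S) - ((M + M)%:C *: x + (M * M)%:S).
  by rewrite rmorphD rmorphM; ncalg.
apply: cloB => //; apply: cloD; first exact: cloZ.
by apply: cloZ; apply: clo1.
Qed.

(** Up to a multiple of [x * x], replace [a] by the invertible positive [c = d * d]. Then
    [j d * x * j d] is the supremum of the multipliers [j d * u n * j d], so its square lies in [S];
    stripping the outer factors with the inverse [d * v] of [d] leaves [x * j c * x]. *)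
Lemma mult_sandwich_sa (u : nat -> E) x a : (forall n, mult (u n)) -> incr_sa u -> nbounded u ->
  is_sup u x -> selfadj a -> S (x * j a * x).
Proof.
move=> hu iu bu xs sa; have [jL j1 jM jS] := jH.
have pb : Pos (a + (nm a)%:S).
  by apply/poselP; have := cle_nmN sa; rewrite /cle opprK.
pose c := 1 + (a + (nm a)%:S).
have [v [vc cv pv _ vP]] := Pos_inv pb; rewrite -/c in vc cv.
have pc : Pos c by apply: Pos_D => //; apply/poselP; apply: posel1.
have [d [sd dd _ dP]] := Pos_sqrt pc.
have vd : v * d = d * v.
  apply: (vP _ (csub_comm d)); have cd : c * d = d * c by rewrite -dd mulrA.
  by move: cd; rewrite /c [_ * d]mulrDl [d * _]mulrDr mul1r mulr1 => /addrI.
have jd : (j d)^† = j d by rewrite -jS sd.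
have h : S ((j d * x * j d) * (j d * x * j d)).
  have [iv vs] := sup_conj (j d) iu xs; rewrite jd in iv vs.
  apply: (clo_sq (z := fun n => j d * u n * j d)) iv _ vs.
    move=> n; apply: (csubM mult_csub); last exact: mult_j.
    by apply: (csubM mult_csub) => //; apply: mult_j.
  by have := nbounded_conj (j d) bu; rewrite jd.
have := clo_bimod (d * v) (d * v) h.
have -> : j (d * v) * (j d * x * j d * (j d * x * j d)) * j (d * v) = x * j c * x.
  transitivity (j (d * v * d) * x * j (d * d) * x * j (d * (d * v))).
    by rewrite !jM; ncalg.
  have e1 : d * v * d = 1 by rewrite -mulrA vd mulrA dd cv.
  have e2 : d * (d * v) = 1 by rewrite mulrA dd cv.
  by rewrite e1 e2 dd j1 mul1r mulr1.
move=> h1; have h2 : S (x * x) := clo_sq hu iu bu xs.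
have -> : x * j a * x = x * j c * x - (1 + nm a)%:C *: (x * x).
  rewrite /c !(clinD jL) (clinZ jL) j1 rmorphD; ncalg.
by apply: cloB => //; apply: cloZ.
Qed.

Lemma mult_sandwich (u : nat -> E) x a : (forall n, mult (u n)) -> incr_sa u -> nbounded u ->
  is_sup u x -> S (x * j a * x).
Proof.
move=> hu iu bu xs; have [jL _ _ _] := jH.
have -> : x * j a * x = x * j (rpart a) * x + iC *: (x * j (ipart a) * x).
  by rewrite {1}[a]ripart (clinD jL) (clinZ jL); ncalg.
apply: cloD; first exact: mult_sandwich_sa hu iu bu xs (sa_rpart a).
by apply: cloZ; apply: mult_sandwich_sa hu iu bu xs (sa_ipart a).
Qed.

(** Including [x * s * x] makes [Q] inductive. Conjugations by [x], [1 + x] and [1 + i x] preserve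
    suprema; the last two, less [s] and [x * s * x], give [x * s + s * x] and [s * x - x * s]. The
    base case [s = j a] is [mult_sandwich]. *)
Lemma mult_sup (u : nat -> E) x : (forall n, mult (u n)) -> incr_sa u -> nbounded u ->
  is_sup u x -> mult x.
Proof.
move=> hu iu bu xs; have sx : x^† = x by case: xs.
pose Q s := [/\ S s, S (x * s), S (s * x) & S (x * s * x)].
have Sx : S x by apply: (clo_sup iu bu _ xs) => n; case: (hu n).
have QQ : sigma_subspace Q.
  split; first split.
  - by rewrite /Q mulr0 !mul0r; split; apply: clo0.
  - move=> c s t [s1 s2 s3 s4] [t1 t2 t3 t4].
    by split; rewrite ?mulrDr ?mulrDl -?scalerAr -?scalerAl; apply: cloL.
  - move=> s [s1 s2 s3 s4]; split; first exact: clo_st.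
    + by have := clo_st s3; rewrite cs_starM sx.
    + by have := clo_st s2; rewrite cs_starM sx.
    + by have := clo_st s4; rewrite !cs_starM sx mulrA.
  move=> w s iw bw hw ws.
  have S1 : S s by apply: (clo_sup iw bw _ ws) => n; case: (hw n).
  have S4 : S (x * s * x).
    by have := clo_sup_conj (v := x) iw bw ws; rewrite sx; apply=> n; case: (hw n).
  have h1 : S ((1 + x)^† * s * (1 + x)).
    apply: (clo_sup_conj iw bw ws) => n; have [a1 a2 a3 a4] := hw n.
    have -> : (1 + x)^† * w n * (1 + x) = w n + x * w n + w n * x + x * w n * x.
      by rewrite cs_starD st1 sx; ncalg.
    by do 3 apply: cloD => //.
  have h2 : S ((1 + iC *: x)^† * s * (1 + iC *: x)).
    apply: (clo_sup_conj iw bw ws) => n; have [a1 a2 a3 a4] := hw n.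
    have -> : (1 + iC *: x)^† * w n * (1 + iC *: x) =
        w n + iC *: (w n * x - x * w n) - (iC * iC) *: (x * w n * x).
      by rewrite cs_starD st1 stI sx; ncalg.
    apply: cloB; last exact: cloZ.
    by apply: cloD => //; apply: cloZ; apply: cloB.
  have e1 : (1 + x)^† * s * (1 + x) - s - x * s * x = x * s + s * x.
    by rewrite cs_starD st1 sx; ncalg.
  have e2 : (1 + iC *: x)^† * s * (1 + iC *: x) - s - x * s * x = iC *: (s * x - x * s).
    transitivity (iC *: (s * x - x * s) + (- (iC * iC) - 1) *: (x * s * x)).
      by rewrite cs_starD st1 stI sx; ncalg.
    by rewrite iC2 opprK subrr scale0r addr0.
  have g1 : S (x * s + s * x) by rewrite -e1; apply: cloB => //; apply: cloB.
  have g2 : S (s * x - x * s).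
    have : S (iC *: (s * x - x * s)) by rewrite -e2; apply: cloB => //; apply: cloB.
    by move=> /(cloZ (- iC)); rewrite scalerA mulNr iC2 opprK scale1r.
  split=> //.
    have -> : x * s = half *: ((x * s + s * x) - (s * x - x * s)).
      by rewrite (_ : _ - _ = x * s + x * s) ?half_dbl //; ncalg.
    by apply: cloZ; apply: cloB.
  have -> : s * x = half *: ((x * s + s * x) + (s * x - x * s)).
    by rewrite (_ : _ + (_ - _) = s * x + s * x) ?half_dbl //; ncalg.
  by apply: cloZ; apply: cloD.
have hQ : forall s, S s -> Q s.
  apply: clo_ind QQ _ => a; split; [exact: clo_j | exact: clo_right | exact: clo_left |].
  exact: mult_sandwich hu iu bu xs.
by split=> // s /hQ[].
Qed.

Lemma clo_mult s : S s -> mult s.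
Proof.
move: s; apply: clo_ind; last exact: mult_j.
split; last by move=> u s iu bu hu us; apply: mult_sup hu iu bu us.
split; [exact: csub0 mult_csub | exact: (csubL mult_csub) | exact: mult_st].
Qed.

Lemma clo_csub : csub S.
Proof.
split; [exact: clo1 | exact: cloL | | exact: clo_closed].
by move=> s t /clo_mult[_ h] /h[].
Qed.
End Closure.

(** * Closed self-adjoint subalgebras as C*-algebras *)

Section Subalgebra.
Variables (E : cstar) (S : E -> Prop).
Hypotheses (hS : csub S) (hst : forall x, S x -> S x^†).

(** The two proofs are phantom arguments, recorded in the type so that the algebra instances can
    find them. *)
Definition scar_of of csub S & (forall x, S x -> S x^†) := {x : E | S x}.
Notation scar := (scar_of hS hst).
HB.instance Definition _ := gen_eqMixin scar.
HB.instance Definition _ := gen_choiceMixin scar.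
Implicit Types x y z : scar.

Lemma scar_inj x y : sval x = sval y -> x = y.
Proof. by case: x y => x hx [y hy] /= e; apply: eq_exist. Qed.

Definition szero : scar := exist _ _ (csub0 hS).
Definition sone : scar := exist _ _ (csub1 hS).
Definition sadd x y : scar := exist _ _ (csubD hS (svalP x) (svalP y)).
Definition smul x y : scar := exist _ _ (csubM hS (svalP x) (svalP y)).
Definition sscale c x : scar := exist _ _ (csubZ c hS (svalP x)).
Definition sopp x := sscale (-1) x.
Definition sstar x : scar := exist _ _ (hst (svalP x)).

Lemma saddA : associative sadd.
Proof. by move=> x y z; apply: scar_inj; apply: addrA. Qed.
Lemma saddC : commutative sadd.
Proof. by move=> x y; apply: scar_inj; apply: addrC. Qed.
Lemma sadd0 : left_id szero sadd.
Proof. by move=> x; apply: scar_inj; apply: add0r. Qed.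
Lemma saddN : left_inverse szero sopp sadd.
Proof. by move=> x; apply: scar_inj; rewrite /= scaleN1r addNr. Qed.
HB.instance Definition _ := GRing.isZmodule.Build scar saddA saddC sadd0 saddN.
Lemma smulA : associative smul.
Proof. by move=> x y z; apply: scar_inj; apply: mulrA. Qed.
Lemma smul1l : left_id sone smul.
Proof. by move=> x; apply: scar_inj; apply: mul1r. Qed.
Lemma smul1r : right_id sone smul.
Proof. by move=> x; apply: scar_inj; apply: mulr1. Qed.
Lemma smulDl : left_distributive smul +%R.
Proof. by move=> x y z; apply: scar_inj; apply: mulrDl. Qed.
Lemma smulDr : right_distributive smul +%R.
Proof. by move=> x y z; apply: scar_inj; apply: mulrDr. Qed.
Lemma sone_neq0 : sone != 0.
Proof. by apply/eqP => /(congr1 sval)/eqP; rewrite oner_eq0. Qed.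
HB.instance Definition _ := GRing.Zmodule_isNzRing.Build scar
  smulA smul1l smul1r smulDl smulDr sone_neq0.
Lemma sscaleA c d x : sscale c (sscale d x) = sscale (c * d) x.
Proof. by apply: scar_inj; apply: scalerA. Qed.
Lemma sscale1 : left_id 1 sscale.
Proof. by move=> x; apply: scar_inj; apply: scale1r. Qed.
Lemma sscaleDr : right_distributive sscale +%R.
Proof. by move=> c x y; apply: scar_inj; apply: scalerDr. Qed.
Lemma sscaleDl x : {morph sscale^~ x : c d / c + d}.
Proof. by move=> c d; apply: scar_inj; apply: scalerDl. Qed.
HB.instance Definition _ := GRing.Zmodule_isLmodule.Build CC scar sscaleA sscale1 sscaleDr sscaleDl.
Lemma sscaleAl (c : CC) (x y : scar) : c *: (x * y) = c *: x * y.
Proof. by apply: scar_inj; apply: scalerAl. Qed.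
HB.instance Definition _ := GRing.Lmodule_isLalgebra.Build CC scar sscaleAl.
Lemma sscaleAr (c : CC) (x y : scar) : c *: (x * y) = x * (c *: y).
Proof. by apply: scar_inj; apply: scalerAr. Qed.
HB.instance Definition _ := GRing.Lalgebra_isAlgebra.Build CC scar sscaleAr.

Definition snorm x := nm (sval x).
Lemma svalN (x : scar) : sval (- x) = - sval x.
Proof. exact: scaleN1r. Qed.
Lemma svalB (x y : scar) : sval (x - y) = sval x - sval y.
Proof. by rewrite -svalN. Qed.

Lemma scomplete (u : nat -> scar) :
  (forall e : RR, 0 < e -> exists N, forall m n, (N <= m)%N -> (N <= n)%N -> snorm (u m - u n) < e) ->
  exists l, forall e : RR, 0 < e -> exists N, forall n, (N <= n)%N -> snorm (u n - l) < e.
Proof.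
move=> hu; have [l hl] : exists l, cvgA (fun n => sval (u n)) l.
  apply: cs_complete => e /hu[N hN]; exists N => m n Nm Nn.
  by have := hN m n Nm Nn; rewrite /snorm svalB.
have Sl : S l by apply: (csub_closed hS) hl => n; apply: svalP.
exists (exist _ l Sl) => e /hl[N hN]; exists N => n /hN.
by rewrite /snorm svalB.
Qed.

Lemma sstarD (x y : scar) : sstar (x + y) = sstar x + sstar y.
Proof. by apply: scar_inj; apply: cs_starD. Qed.
Lemma sstarZ (c : CC) (x : scar) : sstar (c *: x) = (c^*)%C *: sstar x.
Proof. by apply: scar_inj; apply: cs_starZ. Qed.
Lemma sstarM (x y : scar) : sstar (x * y) = sstar y * sstar x.
Proof. by apply: scar_inj; apply: cs_starM. Qed.
Lemma sstarK x : sstar (sstar x) = x.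
Proof. by apply: scar_inj; apply: cs_starK. Qed.
Lemma snorm_eq0 x : snorm x = 0 -> x = 0.
Proof. by move=> h; apply: scar_inj; apply: cs_norm_eq0. Qed.
Lemma snormD (x y : scar) : snorm (x + y) <= snorm x + snorm y.
Proof. exact: cs_normD. Qed.
Lemma snormZ (c : CC) (x : scar) : snorm (c *: x) = cabs c * snorm x.
Proof. exact: cs_normZ. Qed.
Lemma snormM (x y : scar) : snorm (x * y) <= snorm x * snorm y.
Proof. exact: cs_normM. Qed.
Lemma snorm_cstar (x : scar) : snorm (sstar x * x) = snorm x ^+ 2.
Proof. exact: cs_cstar_id. Qed.

Definition subcs : cstar :=
  CStar sstarD sstarZ sstarM sstarK snorm_eq0 snormD snormZ snormM snorm_cstar scomplete.

Definition sinc (x : subcs) : E := sval x.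

Lemma sinc_hom : star_hom sinc. Proof. by []. Qed.
Lemma sinc_nm (x : subcs) : nm (sinc x) = nm x. Proof. by []. Qed.

Lemma sinc_sa (x : subcs) : selfadj (sinc x) <-> selfadj x.
Proof. by split=> [h|h]; [apply: scar_inj | rewrite /selfadj -{2}h]. Qed.

(** The form [b^† * b] asks for a [b] inside the subalgebra; [Pos] only involves the norm and
    transfers. *)
Lemma sinc_posel (x : subcs) : posel (sinc x) <-> posel x.
Proof.
split; last exact: (hom_positive sinc_hom).
move=> /poselP [h [M hM]]; apply/poselP; split; first by apply/sinc_sa.
by exists M; rewrite -sinc_nm /sinc svalB.
Qed.

Lemma sinc_cle (x y : subcs) : cle (sinc x) (sinc y) <-> cle x y.
Proof. by rewrite /cle -sinc_posel /sinc svalB. Qed.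

Lemma sinc_incr (u : nat -> subcs) : incr_sa (fun n => sinc (u n)) <-> incr_sa u.
Proof.
by split=> [] [h1 h2]; split=> n; [apply/sinc_sa | apply/sinc_cle | apply/sinc_sa | apply/sinc_cle].
Qed.

Lemma sup_sinc (u : nat -> subcs) s : is_sup (fun n => sinc (u n)) (sinc s) -> is_sup u s.
Proof.
move=> [h1 h2 h3]; split=> [|n|t st ut]; [exact/sinc_sa | exact/sinc_cle | apply/sinc_cle].
by apply: h3 => [|n]; [apply/sinc_sa | apply/sinc_cle].
Qed.
End Subalgebra.

(** * The sigma-completion *)

Section Completion.
Variables (A E : cstar) (j : A -> E).
Hypotheses (jH : star_hom j) (jN : sigma_normal j) (jI : injective j) (Esig : sigma_cstar E).

Notation S := (sigma_closure (fun x => exists a, x = j a)).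

Definition sgen : cstar := subcs (clo_csub jH) (@clo_st A E j).
Definition sgi : sgen -> E := @sinc E S (clo_csub jH) (@clo_st A E j).
Definition sgj (a : A) : sgen := exist _ (j a) (@clo_j A E j a).

Lemma sgj_hom : star_hom sgj.
Proof.
have [jL j1 jM jS] := jH; split.
- by move=> c a b; apply: scar_inj; apply: jL.
- by apply: scar_inj; apply: j1.
- by move=> a b; apply: scar_inj; apply: jM.
- by move=> a; apply: scar_inj; apply: jS.
Qed.

(** The supremum in [E] belongs to the closure, hence is the supremum there too; uniqueness then
    makes the inclusion sigma-normal. *)
Lemma sgi_sup_ex (u : nat -> sgen) : incr_sa u -> nbounded u -> exists s,
  is_sup u s /\ is_sup (fun n => sgi (u n)) (sgi s).
Proof.
move=> iu bu; have iu' : incr_sa (fun n => sgi (u n)) by apply/sinc_incr.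
have [s hs] := Esig iu' bu.
have Ss : S s by apply: clo_sup iu' bu _ hs => n; apply: svalP.
by exists (exist _ s Ss); split=> //; apply: sup_sinc.
Qed.

Lemma sgen_sigma : sigma_cstar sgen.
Proof. by move=> u iu bu; have [s []] := sgi_sup_ex iu bu; exists s. Qed.

Lemma sgi_normal : sigma_normal sgi.
Proof.
move=> u s iu bu us; have [t [h1 h2]] := sgi_sup_ex iu bu.
by rewrite (sup_unique us h1).
Qed.

Lemma sgj_normal : sigma_normal sgj.
Proof. by move=> u s iu bu us; apply: sup_sinc; apply: jN iu bu us. Qed.

Lemma sgj_inj : injective sgj.
Proof. by move=> a b /(congr1 sval)/jI. Qed.

(** Membership of [b] in the closure is an induction principle over [E], so a sigma-subspace of
    [sgen] is pushed forward to one of [E]; by [sgi_sup_ex] suprema agree. *)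
Lemma sgj_dense (b : sgen) : sigma_closure (fun x => exists a, x = sgj a) b.
Proof.
case: b => b Sb P hP hX; have [[P0 PL Pst] Psup] := hP.
pose Q (x : E) := exists y : sgen, sgi y = x /\ P y.
have : Q b.
  apply: Sb => [|_ [a ->]]; last by exists (sgj a); split=> //; apply: hX; exists a.
  split; first split.
  - by exists 0; split.
  - by move=> c _ _ [x [<- Px]] [y [<- Py]]; exists (c *: x + y); split=> //; apply: PL.
  - by move=> _ [x [<- Px]]; exists (x^†); split=> //; apply: Pst.
  move=> u s iu bu /choice[v hv] us.
  have e : u = fun n => sgi (v n) by apply/funext => n; case: (hv n).
  rewrite e in iu bu us.
  have iv : incr_sa v by apply/sinc_incr; apply: iu.
  have [t [h1 h2]] := sgi_sup_ex iv bu.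
  exists t; split; first exact: sup_unique h2 us.
  by apply: Psup iv bu _ h1 => n; case: (hv n).
by case=> y [e Py]; rewrite (_ : exist _ b Sb = y) //; apply: scar_inj.
Qed.

Lemma sgj_completion : sigma_completion sgj.
Proof.
split; [exact: sgen_sigma | | exact: sgj_inj | exact: sgj_dense].
by split; [exact: sgj_hom | exact: sgj_normal].
Qed.
End Completion.

(** * Matrices over a C*-algebra *)

Section Columns.
Variables (B : cstar) (m : nat).
Implicit Types (v w : 'cV[B]_m) (X Y : 'M[B]_m) (t : B).

Definition ip v w : B := \sum_i (v i 0)^† * w i 0.
Definition colM v t : 'cV[B]_m := \col_i (v i 0 * t).
Definition mxZ k (c : CC) (v : 'M[B]_(m, k)) : 'M[B]_(m, k) := \matrix_(i, j) (c *: v i j).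

Lemma ip_st v w : (ip v w)^† = ip w v.
Proof. by rewrite st_sum; apply: eq_bigr => i _; rewrite cs_starM cs_starK. Qed.
Lemma ipDl v v' w : ip (v + v') w = ip v w + ip v' w.
Proof. by rewrite -big_split; apply: eq_bigr => i _; rewrite /= mxE cs_starD mulrDl. Qed.
Lemma ipDr v w w' : ip v (w + w') = ip v w + ip v w'.
Proof. by rewrite -big_split; apply: eq_bigr => i _; rewrite /= mxE mulrDr. Qed.
Lemma ipNl v w : ip (- v) w = - ip v w.
Proof. by rewrite -sumrN; apply: eq_bigr => i _; rewrite mxE stN mulNr. Qed.
Lemma ipNr v w : ip v (- w) = - ip v w.
Proof. by rewrite -sumrN; apply: eq_bigr => i _; rewrite mxE mulrN. Qed.
Lemma ipMr v w t : ip v (colM w t) = ip v w * t.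
Proof. by rewrite mulr_suml; apply: eq_bigr => i _; rewrite mxE mulrA. Qed.
Lemma ipMl v w t : ip (colM v t) w = t^† * ip v w.
Proof. by rewrite -[LHS]cs_starK ip_st ipMr cs_starM ip_st. Qed.
Lemma ipZ (c : CC) v : ip (mxZ c v) (mxZ c v) = (c^* * c)%C *: ip v v.
Proof.
rewrite scaler_sumr; apply: eq_bigr => i _.
by rewrite !mxE cs_starZ -scalerAl -scalerAr scalerA.
Qed.
Lemma ip_pos v : posel (ip v v).
Proof. by apply: posel_sum => i; exists (v i 0). Qed.
Lemma ip_adj X v w : ip (X *m v) w = ip v (mx_adj X *m w).
Proof.
rewrite /ip; under eq_bigr do rewrite mxE st_sum mulr_suml.
rewrite exchange_big; apply: eq_bigr => i _.
rewrite mxE mulr_sumr; apply: eq_bigr => j _.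
by rewrite mxE cs_starM mulrA.
Qed.

(** Cauchy-Schwarz in the Hilbert module of columns: with [z = ip w v] and [K = nm (ip w w)], expand
    the square of [v - w * z / K] and use [ip w w <= K]. *)
Lemma ip_CS v w : nm (ip v w) ^+ 2 <= nm (ip v v) * nm (ip w w).
Proof.
have [w0|w0] := leP (nm (ip w w)) 0.
  suff -> : ip v w = 0 by rewrite nm0 expr0n mulr_ge0 ?nm_ge0.
  have e : ip w w = 0 := nm_eq0 w0; apply: big1 => i _.
  suff -> : w i 0 = 0 by rewrite mulr0.
  apply: stM_eq0; apply: posel_anti; first by exists (w i 0).
  have := e; rewrite /ip (bigD1 i) //= => /eqP; rewrite addrC addr_eq0 => /eqP <-.
  by rewrite big_mkcond; apply: posel_sum => k; case: (k != i); [exists (w k 0) | exact: posel0].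
set K := nm (ip w w) in w0 *; set z := ip w v.
have ez : z^† = ip v w by apply: ip_st.
have h : posel (ip v v - (K^-1)%:C *: (z^† * z)).
  have h1 := ip_pos (v - colM w (K^-1%:C *: z)).
  have h2 := posel_conj (K^-1%:C *: z) (cle_nm (posel_sa (ip_pos w)) : posel (K%:S - ip w w)).
  have := posel_D h1 h2; congr posel.
  have -> : (K^-1%:C *: z)^† * (K%:S - ip w w) * (K^-1%:C *: z) =
    (K^-1 * K^-1 * K)%:C *: (z^† * z) - (K^-1 * K^-1)%:C *: (z^† * ip w w * z).
    by rewrite stR !rmorphM; ncalg.
  rewrite -mulrA mulVf ?gt_eqF // mulr1.
  rewrite ipDl !ipDr !ipNl !ipNr ipMr ipMl ipMr ipMl -ez -/z stR.
  rewrite rmorphM; ncalg.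
have h3 : nm (z^† * z) <= K * nm (ip v v).
  rewrite mulrC -ler_pdivrMr // mulrC.
  have k0 : 0 <= K^-1 by rewrite invr_ge0 ltW.
  have pz : posel (z^† * z) by exists z.
  by have := nm_mono (posel_Z k0 pz) h; rewrite nmZ ger0_norm.
by rewrite -ez nm_st -cs_cstar_id mulrC.
Qed.

Definition nv v : RR := Num.sqrt (nm (ip v v)).
Lemma nv_ge0 v : 0 <= nv v. Proof. exact: sqrtr_ge0. Qed.
Lemma nv2 v : nv v ^+ 2 = nm (ip v v). Proof. by rewrite sqr_sqrtr // nm_ge0. Qed.

Lemma nv_CS v w : nm (ip v w) <= nv v * nv w.
Proof.
by rewrite -(@ler_pXn2r _ 2) ?nnegrE ?nm_ge0 ?mulr_ge0 ?nv_ge0 // exprMn !nv2 ip_CS.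
Qed.
Lemma nvD v w : nv (v + w) <= nv v + nv w.
Proof.
rewrite -(@ler_pXn2r _ 2) ?nnegrE ?addr_ge0 ?nv_ge0 // nv2 ipDl !ipDr.
have h1 := cs_normD (ip v v + ip v w) (ip w v + ip w w).
have h2 := cs_normD (ip v v) (ip v w); have h3 := cs_normD (ip w v) (ip w w).
have h4 := nv_CS v w; have h5 := nv_CS w v; have h6 := nv2 v; have h7 := nv2 w.
by rewrite -h6 in h2; rewrite -h7 in h3; nra.
Qed.
Lemma nvZ (c : CC) v : nv (mxZ c v) = cabs c * nv v.
Proof.
apply/eqP; rewrite -(@eqrXn2 _ 2) ?nv_ge0 ?mulr_ge0 ?nv_ge0 //; last by exact: cabs_ge0.
rewrite exprMn !nv2 ipZ (_ : (c^* * c)%C = (cabs c ^+ 2)%:C).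
  by rewrite nmZ ger0_norm // sqr_ge0.
case: c => a b; rewrite /cabs /= sqr_sqrtr ?addr_ge0 ?sqr_ge0 //; cplx.
Qed.
Lemma nm_nv v i : nm (v i 0) <= nv v.
Proof.
rewrite -(@ler_pXn2r _ 2) ?nnegrE ?nm_ge0 ?nv_ge0 // nv2 -cs_cstar_id.
apply: nm_mono; first by exists (v i 0).
rewrite /cle /ip (bigD1 i) //= addrC addrK big_mkcond; apply: posel_sum => k.
by case: (k != i); [exists (v k 0) | exact: posel0].
Qed.
Lemma nv_sum v : nv v <= \sum_i nm (v i 0).
Proof.
have s0 : 0 <= \sum_i nm (v i 0) by apply: sumr_ge0 => i _; apply: nm_ge0.
rewrite -(@ler_pXn2r _ 2) ?nnegrE ?nv_ge0 // nv2.
apply: (@le_trans _ _ (\sum_i nm (v i 0) ^+ 2)).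
  rewrite /ip; elim/big_ind2: _ => [|a x b y h1 h2|i _]; first by rewrite nm0.
    by apply: le_trans (cs_normD _ _) _; apply: lerD.
  by rewrite cs_cstar_id.
rewrite expr2 mulr_suml; apply: ler_sum => i _.
rewrite expr2 ler_wpM2l ?nm_ge0 // (bigD1 i) //= lerDl.
by apply: sumr_ge0 => k _; apply: nm_ge0.
Qed.
Lemma nm_sum (I : Type) (r : seq I) (F : I -> B) : nm (\sum_(i <- r) F i) <= \sum_(i <- r) nm (F i).
Proof.
elim/big_ind2: _ => [|a x b y h1 h2|i _] //; first by rewrite nm0.
by apply: le_trans (cs_normD _ _) _; apply: lerD.
Qed.
Lemma nv_mulmx X v : nv (X *m v) <= (\sum_i \sum_j nm (X i j)) * nv v.
Proof.
apply: le_trans (nv_sum _) _; rewrite mulr_suml; apply: ler_sum => i _.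
rewrite mxE mulr_suml; apply: le_trans (nm_sum _ _) _; apply: ler_sum => j _.
by apply: le_trans (cs_normM _ _) _; rewrite ler_wpM2l ?nm_ge0 ?nm_nv.
Qed.

Definition mbound X : set RR := [set M | 0 <= M /\ forall v, nv (X *m v) <= M * nv v]%classic.
(** The operator norm on the Hilbert module of columns. The C*-identity holds as on a Hilbert space,
    and comparison with the norms of the entries gives completeness. *)
Definition mnorm X : RR := inf (mbound X).

Lemma mbound_ne X : mbound X (\sum_i \sum_j nm (X i j)).
Proof.
split; last exact: nv_mulmx.
by apply: sumr_ge0 => i _; apply: sumr_ge0 => j _; apply: nm_ge0.
Qed.
Lemma mnorm_le X M : 0 <= M -> (forall v, nv (X *m v) <= M * nv v) -> mnorm X <= M.
Proof. by move=> M0 h; apply: ge_inf => //; exists 0 => K []. Qed.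
Lemma mnorm_ge0 X : 0 <= mnorm X.
Proof. by apply: lb_le_inf => [|M []] //; exists (\sum_i \sum_j nm (X i j)); apply: mbound_ne. Qed.
Lemma mnormP X v : nv (X *m v) <= mnorm X * nv v.
Proof.
have [v0|v0] := leP (nv v) 0.
  by have := nv_mulmx X v; have -> : nv v = 0; [have := nv_ge0 v; lra | rewrite !mulr0].
rewrite -ler_pdivrMr //; apply: lb_le_inf => [|M [_ h]]; last by rewrite ler_pdivrMr.
by exists (\sum_i \sum_j nm (X i j)); apply: mbound_ne.
Qed.
Lemma mnorm_sum X : mnorm X <= \sum_i \sum_j nm (X i j).
Proof. by have [h1 h2] := mbound_ne X; apply: mnorm_le. Qed.
Lemma nm_mnorm X i j : nm (X i j) <= mnorm X.
Proof.
pose v : 'cV[B]_m := \col_k (k == j)%:R.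
have v1 : nv v = 1.
  rewrite /nv /ip (bigD1 j) //= big1 ?addr0 ?mxE ?eqxx ?mulr1 ?st1 ?nm1 ?sqrtr1 // => k kj.
  by rewrite mxE (negPf kj) mulr0.
have := nm_nv (X *m v) i; have := mnormP X v; rewrite v1 mulr1.
suff -> : (X *m v) i 0 = X i j by move=> h1 h2; apply: le_trans h2 h1.
rewrite mxE (bigD1 j) //= mxE eqxx mulr1 big1 ?addr0 // => k kj.
by rewrite mxE (negPf kj) mulr0.
Qed.

Lemma mx_adjK X : mx_adj (mx_adj X) = X.
Proof. by apply/matrixP => i j; rewrite !mxE cs_starK. Qed.
Lemma mx_adjM X Y : mx_adj (X *m Y) = mx_adj Y *m mx_adj X.
Proof.
apply/matrixP => i j; rewrite !mxE st_sum; apply: eq_bigr => k _.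
by rewrite !mxE cs_starM.
Qed.
Lemma mx_adjD X Y : mx_adj (X + Y) = mx_adj X + mx_adj Y.
Proof. by apply/matrixP => i j; rewrite !mxE cs_starD. Qed.
Lemma mx_adjZ (c : CC) X : mx_adj (mxZ c X) = mxZ c^* (mx_adj X).
Proof. by apply/matrixP => i j; rewrite !mxE cs_starZ. Qed.
Lemma mxZ_mul (c : CC) k (X : 'M[B]_m) (v : 'M[B]_(m, k)) : mxZ c X *m v = mxZ c (X *m v).
Proof.
apply/matrixP => i j; rewrite !mxE scaler_sumr; apply: eq_bigr => l _.
by rewrite mxE scalerAl.
Qed.

Lemma mnorm_eq0 X : mnorm X = 0 -> X = 0.
Proof.
move=> h; apply/matrixP => i j; rewrite mxE; apply: nm_eq0.
by rewrite -h nm_mnorm.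
Qed.
Lemma mnormD X Y : mnorm (X + Y) <= mnorm X + mnorm Y.
Proof.
apply: mnorm_le => [|v]; first by rewrite addr_ge0 ?mnorm_ge0.
rewrite mulmxDl mulrDl; apply: le_trans (nvD _ _) _.
by apply: lerD; apply: mnormP.
Qed.
Lemma mnormM X Y : mnorm (X *m Y) <= mnorm X * mnorm Y.
Proof.
apply: mnorm_le => [|v]; first by rewrite mulr_ge0 ?mnorm_ge0.
rewrite -mulmxA; apply: le_trans (mnormP _ _) _.
by rewrite -mulrA ler_wpM2l ?mnorm_ge0 ?mnormP.
Qed.
Lemma mnormZ_le (c : CC) X : mnorm (mxZ c X) <= cabs c * mnorm X.
Proof.
have c0 := cabs_ge0 c.
apply: mnorm_le => [|v]; first by rewrite mulr_ge0 ?mnorm_ge0.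
by rewrite mxZ_mul nvZ -mulrA ler_wpM2l ?mnormP.
Qed.
Lemma cabs_inv (c : CC) : c != 0 -> cabs c^-1 * cabs c = 1.
Proof.
move=> c0; rewrite /cabs -ComplexField.Normc.normcM mulVf //.
by have := cabsR 1; rewrite normr1.
Qed.
Lemma mnormZ (c : CC) X : mnorm (mxZ c X) = cabs c * mnorm X.
Proof.
apply/eqP; rewrite eq_le mnormZ_le /=.
have c0 := cabs_ge0 c.
have [->|cn] := eqVneq c 0; first by rewrite (cabsR 0) normr0 mul0r mnorm_ge0.
have e := cabs_inv cn.
have : mnorm X <= cabs c^-1 * mnorm (mxZ c X).
  apply: le_trans (mnormZ_le _ _); rewrite (_ : mxZ _ _ = X) //.
  by apply/matrixP => i j; rewrite !mxE scalerA mulVf // scale1r.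
move=> /(ler_wpM2l c0); rewrite mulrA [cabs c * cabs c^-1]mulrC e mul1r //.
Qed.
Lemma mnorm_sq_le X : mnorm X ^+ 2 <= mnorm (mx_adj X *m X).
Proof.
set K := mnorm (_ *m _); have K0 : 0 <= K := mnorm_ge0 _.
rewrite -[K]sqr_sqrtr // ler_pXn2r ?nnegrE ?mnorm_ge0 ?sqrtr_ge0 //.
apply: mnorm_le => [|v]; first exact: sqrtr_ge0.
rewrite -(@ler_pXn2r _ 2) ?nnegrE ?mulr_ge0 ?sqrtr_ge0 ?nv_ge0 // exprMn (sqr_sqrtr K0).
rewrite (nv2 (X *m v)) ip_adj mulmxA; apply: le_trans (nv_CS _ _) _.
by rewrite expr2 mulrCA ler_wpM2l ?nv_ge0 ?mnormP.
Qed.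
Lemma mnorm_adj_le X : mnorm X <= mnorm (mx_adj X).
Proof.
have := le_trans (mnorm_sq_le X) (mnormM _ _); have := mnorm_ge0 X; have := mnorm_ge0 (mx_adj X).
by have [->|h] := eqVneq (mnorm X) 0 => // h1 h2; rewrite expr2 ler_pM2r // lt_def h.
Qed.
Lemma mnorm_cstar X : mnorm (mx_adj X *m X) = mnorm X ^+ 2.
Proof.
apply/eqP; rewrite eq_le mnorm_sq_le andbT; apply: le_trans (mnormM _ _) _.
by rewrite expr2 ler_wpM2r ?mnorm_ge0 // -{2}[X]mx_adjK mnorm_adj_le.
Qed.
Lemma mcomplete (u : nat -> 'M[B]_m) :
  (forall e : RR, 0 < e -> exists N, forall k n, (N <= k)%N -> (N <= n)%N -> mnorm (u k - u n) < e) ->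
  exists l, forall e : RR, 0 < e -> exists N, forall n, (N <= n)%N -> mnorm (u n - l) < e.
Proof.
move=> hu; have /choice[f hf] : forall ij : 'I_m * 'I_m, exists l, cvgA (fun n => u n ij.1 ij.2) l.
  move=> [i j]; apply: cs_complete => e /hu[N hN]; exists N => k n Nk Nn.
  by apply: le_lt_trans (hN k n Nk Nn); have := nm_mnorm (u k - u n) i j; rewrite !mxE.
exists (\matrix_(i, j) f (i, j)) => e e0.
pose d : RR := e / (m%:R * m%:R + 1).
have c0 : 0 < (m%:R * m%:R + 1 : RR) by rewrite ltr_wpDl // mulr_ge0 ?ler0n.
have d0 : 0 < d by apply: divr_gt0.
have /choice[g hg] := fun ij => hf ij d d0.
exists (\max_ij g ij) => n hn; apply: le_lt_trans (mnorm_sum _) _.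
apply: (@le_lt_trans _ _ (\sum_(i < m) \sum_(j < m) d)).
  apply: ler_sum => i _; apply: ler_sum => j _; rewrite !mxE ltW //.
  by apply: (hg (i, j)); apply: leq_trans hn; apply: leq_bigmax.
rewrite !sumr_const !card_ord -mulrnA -mulr_natl natrM /d.
by rewrite mulrA ltr_pdivrMr // mulrC ltr_pM2l // ltrDl.
Qed.
End Columns.

Section MatrixAlgebra.
Variables (B : cstar) (n : nat).
(** The size is positive because a C*-algebra has [1 != 0]. The separate name carries the complex
    scalars, as opposed to scalars from [B]. *)
Definition mcar := 'M[B]_n.+1.
HB.instance Definition _ := GRing.NzRing.copy mcar 'M[B]_n.+1.
Implicit Types X Y : mcar.

Definition mscale (c : CC) X : mcar := mxZ c X.
Lemma mscaleA c d X : mscale c (mscale d X) = mscale (c * d) X.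
Proof. by apply/matrixP => i j; rewrite !mxE scalerA. Qed.
Lemma mscale1 : left_id 1 mscale.
Proof. by move=> X; apply/matrixP => i j; rewrite !mxE scale1r. Qed.
Lemma mscaleDr : right_distributive mscale +%R.
Proof. by move=> c X Y; apply/matrixP => i j; rewrite !mxE scalerDr. Qed.
Lemma mscaleDl X : {morph mscale^~ X : c d / c + d}.
Proof. by move=> c d; apply/matrixP => i j; rewrite !mxE scalerDl. Qed.
HB.instance Definition _ := GRing.Zmodule_isLmodule.Build CC mcar mscaleA mscale1 mscaleDr mscaleDl.
Lemma mscaleAl (c : CC) (X Y : mcar) : c *: (X * Y) = c *: X * Y.
Proof. by rewrite /GRing.scale /= /mscale -mxZ_mul. Qed.
HB.instance Definition _ := GRing.Lmodule_isLalgebra.Build CC mcar mscaleAl.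
Lemma mscaleAr (c : CC) (X Y : mcar) : c *: (X * Y) = X * (c *: Y).
Proof.
apply/matrixP => i j; rewrite /GRing.scale /= /mscale !mxE scaler_sumr.
by apply: eq_bigr => k _; rewrite mxE scalerAr.
Qed.
HB.instance Definition _ := GRing.Lalgebra_isAlgebra.Build CC mcar mscaleAr.

Definition mxcs : cstar := @CStar mcar (@mx_adj B n.+1) (@mnorm B n.+1)
  (@mx_adjD B n.+1) (@mx_adjZ B n.+1) (@mx_adjM B n.+1) (@mx_adjK B n.+1) (@mnorm_eq0 B n.+1)
  (@mnormD B n.+1) (@mnormZ B n.+1) (@mnormM B n.+1) (@mnorm_cstar B n.+1) (@mcomplete B n.+1).
End MatrixAlgebra.

Lemma form_ip (B : cstar) n (X : 'M[B]_n) (v : 'cV[B]_n) :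
  \sum_i \sum_j (v i 0)^† * X i j * v j 0 = ip v (X *m v).
Proof.
apply: eq_bigr => i _; rewrite mxE mulr_sumr; apply: eq_bigr => j _.
by rewrite mulrA.
Qed.

(** This is what the C*-structure on matrices is for: write [X = P * P - Q * Q] there. At the column
    [Q w] the form of [X] is minus the square of [Q * Q w], so positivity forces [Q * Q = 0]. *)
Lemma form_mx_pos (B : cstar) n (X : 'M[B]_n) : mx_adj X = X ->
  (forall b : 'I_n -> B, posel (\sum_i \sum_j (b i)^† * X i j * b j)) -> mx_pos X.
Proof.
case: n X => [|n] X sX h; first by exists X; apply/matrixP => -[].
have hv (v : 'cV[B]_n.+1) : posel (ip v (X *m v)) by rewrite -form_ip; apply: (h (fun i => v i 0)).
have [P [Q [sP sQ e PQ QP]]] := @Pos_decomp (mxcs B n) X sX.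
have eX : X = P *m P - Q *m Q := e.
suff Q2 : Q *m Q = 0 by exists P; rewrite eX Q2 subr0 (sP : mx_adj P = P).
have hQ (w : 'cV[B]_n.+1) : Q *m Q *m w = 0.
  have := hv (Q *m w); rewrite ip_adj (sQ : mx_adj Q = Q) !mulmxA.
  have -> : Q *m X *m Q = - (Q *m Q *m Q *m Q).
    by rewrite eX mulmxBr mulmxBl !mulmxA (QP : Q *m P = 0) !mul0mx sub0r.
  have Qip v v' : ip v (Q *m v') = ip (Q *m v) v' by rewrite ip_adj (sQ : mx_adj Q = Q).
  rewrite mulNmx ipNr -!mulmxA Qip Qip  => /(posel_anti (ip_pos _)) h0.
  apply/matrixP => i j; rewrite ord1 [RHS]mxE; apply: nm_eq0; apply: le_trans (nm_nv _ _) _.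
  by rewrite /nv h0 nm0 sqrtr0.
apply/matrixP => i j; have := hQ (\col_k (k == j)%:R) => /matrixP/(_ i 0).
rewrite [in LHS]mxE (bigD1 j) //= [X in _ * X]mxE eqxx mulr1 big1 ?addr0 => [->|k kj]; first by rewrite !mxE.
by rewrite [X in _ * X]mxE (negPf kj) mulr0.
Qed.

(** * Extension of sigma-normal completely positive maps *)

Lemma normal_Dec0 (A B : cstar) (phi : A -> B) (y : nat -> A) :
  clinear phi -> positive_map phi -> sigma_normal phi -> Dec0 y -> Dec0 (fun n => phi (y n)).
Proof.
move=> fL fp fN hy; have [py my _] := hy.
have iu : incr_sa (fun n => - y n).
  by split=> n; [apply: sa_N; apply: posel_sa | apply: cle_N].
have bu : nbounded (fun n => - y n).
  by exists (nm (y 0%N)) => n; rewrite nmN; apply: nm_mono => //; apply: (Dec0_mono hy (leq0n n)).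
have us : is_sup (fun n => - y n) 0.
  by apply: sup_Dec0; [exact: sa_0 | move: hy; congr Dec0; apply/funext => n; rewrite sub0r opprK].
have := Dec0_sup (pos_incr fL fp iu) (fN _ _ iu bu us).
by congr Dec0; apply/funext => n; rewrite /= (clinN fL) (clin0 fL) sub0r opprK.
Qed.

Section Transfer.
Variables (A B : cstar) (phi : A -> B).
Hypothesis phiS : sncpu phi.
Implicit Types (d e s : dalg A) (x : pfun B).

Let phiL : clinear phi. Proof. by case: phiS. Qed.
Let phiCP : completely_positive phi. Proof. by case: phiS. Qed.
Let phiP : positive_map phi. Proof. exact: cp_positive phiCP. Qed.
Let phiN : sigma_normal phi. Proof. by case: phiS. Qed.

Section Family.
Variables (n : nat) (b : 'I_n -> B).

Definition dilates x (H : hmod A) (xi : 'I_n -> H) :=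
  forall a i j, pip (pact a (xi j)) (xi i) = x ((b i)^† * phi a * b j).

(** The counterpart of [gen]: the countable condition bears on the functional [x] of [B] alone, and
    the property is asked of every dilation over it. *)
Definition tgen (P : pfun B -> forall H : hmod A, ('I_n -> H) -> Prop) :=
  exists2 S, cond S & forall x, fsat S x -> forall H xi, @dilates x H xi -> P x H xi.

Lemma tgen_mono P Q : (forall x H xi, P x H xi -> Q x H xi) -> tgen P -> tgen Q.
Proof. by move=> PQ [S cS h]; exists S => // x xS H xi hxi; apply: PQ; apply: h. Qed.
Lemma tgen_mono2 P Q R : (forall x H xi, P x H xi -> Q x H xi -> R x H xi) ->
  tgen P -> tgen Q -> tgen R.
Proof.
move=> PQR [S cS h] [S' cS' h']; exists (S `|` S')%classic; first exact: condU.
move=> x xS H xi hxi; apply: PQR; [apply: h | apply: h'] => //.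
  by move=> y Sy; apply: xS; left.
by move=> y Sy; apply: xS; right.
Qed.
Lemma tgen_all (P : nat -> pfun B -> forall H : hmod A, ('I_n -> H) -> Prop) :
  (forall k, tgen (P k)) -> tgen (fun x H xi => forall k, P k x H xi).
Proof.
move=> h; have /choice[F hF] : forall k, exists S, cond S /\
    forall x, fsat S x -> forall H xi, @dilates x H xi -> P k x H xi.
  by move=> k; have [S cS hS] := h k; exists S.
exists (\bigcup_k F k)%classic; first by apply: cond_bigcup => k; case: (hF k).
move=> x xS H xi hxi k; case: (hF k) => _; apply => // y Sy; apply: xS.
by exists k.
Qed.
Lemma tgen_ord m (P : 'I_m -> pfun B -> forall H : hmod A, ('I_n -> H) -> Prop) :
  (forall k, tgen (P k)) -> tgen (fun x H xi => forall k, P k x H xi).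
Proof.
move=> h; have : tgen (fun x H xi => forall k (i : 'I_m), i = k :> nat -> P i x H xi).
  apply: tgen_all => k; have [km|mk] := ltnP k m.
    apply: tgen_mono (h (Ordinal km)) => x H xi hk i e.
    by rewrite (_ : i = Ordinal km) //; apply: val_inj.
  exists set0; first exact: cond0.
  by move=> x _ H xi _ i e; have := ltn_ord i; rewrite e ltnNge mk.
by apply: tgen_mono => x H xi hk i; apply: (hk i).
Qed.
Lemma tgen_fsat S : cond S -> tgen (fun x H xi => fsat S x).
Proof. by move=> cS; exists S. Qed.
Lemma tgen_dilates : tgen (fun x H xi => dilates x xi).
Proof. by exists set0; first exact: cond0. Qed.

Definition pushc (S : set (nat -> A)) : set (nat -> B) :=
  [set (fun k => phi (y k)) | y in S]%classic.

Lemma cond_push S : cond S -> cond (pushc S).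
Proof.
move=> [cS dS]; split; first exact: card_le_trans (card_image_le _ _) cS.
by move=> _ [y Sy <-]; apply: normal_Dec0 => //; apply: dS.
Qed.

(** Here normality enters: [phi] carries conditions on [A] to conditions on [B], and a functional
    generic for their conjugates by [b i] dilates to a vector [xi i] generic for [A]. *)
Lemma tgen_vec (P : forall H : hmod A, H -> Prop) : gen P -> tgen (fun x H xi => forall i, P H (xi i)).
Proof.
move=> [S cS h]; apply: tgen_ord => i; exists (conjc (pushc S) (b i)).
  by apply: cond_conj; apply: cond_push.
move=> x xS H xi hxi; apply: h => y Sy e e0.
have [|k hk] := xS (fun k => (b i)^† * phi (y k) * b i) _ e e0.
  by exists (fun k => phi (y k)) => //; exists y.
by exists k; rewrite hxi.
Qed.

Lemma tgen_posel w : selfadj w -> tgen (fun x H xi => 0 <= x w) -> posel w.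
Proof.
move=> sw [S cS h]; apply: contrapT => nw.
have [|x [xS xw]] := generic_pf cS (sa_N sw); first by move=> /cleN0; rewrite opprK.
have [H [xi hxi]] := stinespring x b phiL phiCP.
by have := h x xS H xi hxi; move: xw; rewrite pfN; lra.
Qed.

End Family.

(** Forms and functionals are real-valued; the scalar [c] lets them recover the imaginary part. *)
Definition matches n (b : 'I_n -> B) d (w : B) x (H : hmod A) (xi : 'I_n -> H) :=
  forall (c : CC) i j, pip (dev d (xi j)) (c *: xi i) = x (c^* *: ((b i)^† * w * b j)).

(* [rel d w]: the value at [d] of the extension of [phi] is [w]. *)
Definition rel d (w : B) := forall n (b : 'I_n -> B), tgen b (matches b d w).

Lemma rel_j a : rel (dj a) (phi a).
Proof.
move=> n b; apply: tgen_mono2 (tgen_vec b (gen_dj a)) (tgen_dilates b) => x H xi h hd c i j.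
rewrite h pipZr -pactZ hd (clinZ phiL); congr (pf_fun x _).
by rewrite -scalerAr -scalerAl.
Qed.

Lemma rel_lin (c : CC) d e v w : rel d v -> rel e w -> rel (c *: d + e) (c *: v + w).
Proof.
move=> h1 h2 n b.
have g := gen_mono2 (fun H xi a b => conj a b) (gen_devD (c *: d) e) (gen_devZ c d).
have := tgen_mono2 (fun x H xi a b => conj a b) (h1 n b) (h2 n b).
apply: tgen_mono2 (tgen_vec b g) => x H xi {}g [m1 m2] k i j.
have [-> ->] := g j; rewrite pipD m2 pipZ scalerA m1 -pfD; congr (pf_fun x _).
rewrite rmorphM /= conjCK mulrDr mulrDl -scalerAr -scalerAl scalerDr !scalerA.
by rewrite [(c * _)%R]mulrC.
Qed.

Lemma dev_scale d : exists2 S, cond S & forall (H : hmod A) (c : CC) (xi : H),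
  vsat S xi -> dev d (c *: xi) = c *: dev d xi.
Proof.
have [S cS h] := gen_dev_linear d; exists S => // H c xi hx.
have d0 : dev d (0 : H) = 0.
  have := h H 1 0 0 (@vsat_0 _ S H) (@vsat_0 _ S H); rewrite !scale1r addr0 => /eqP.
  by rewrite -subr_eq subrr eq_sym => /eqP.
by have := h H c xi 0 hx (@vsat_0 _ S H); rewrite d0 !addr0.
Qed.

Lemma rel_st d w : rel d w -> rel d^† w^†.
Proof.
move=> h n b; have [S cS hS] := dev_adjoint d; have [S' cS' hS'] := dev_scale d.
have g := gen_mono2 (fun H xi a b => conj a b) (gen_vsat cS) (gen_vsat cS').
apply: tgen_mono2 (tgen_vec b g) (h n b) => x H xi {}g m c i j.
have [i1 i2] := g i; have [j1 j2] := g j.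
rewrite pipC -hS //; last exact: vsat_Z.
rewrite hS' // pipZ m -pf_st; congr (pf_fun x _).
by rewrite cs_starZ !cs_starM cs_starK conjcK mulrA.
Qed.

Lemma rel_pos d w : rel d w -> selfadj w -> posel d -> posel w.
Proof.
move=> h sw pd; have h1 := h 1%N (fun=> 1).
apply: (tgen_posel (b := fun _ : 'I_1 => 1)) => //.
apply: tgen_mono2 h1 (tgen_vec _ (posel_gen pd)) => x H xi m hp.
have := m 1 ord0 ord0; rewrite rmorph1 !scale1r st1 mul1r mulr1 => <-; exact: hp.
Qed.

(** By linearity it is enough that 0 has only the value 0. A self-adjoint value [u] of 0 is positive
    by [rel_pos], and so is [- u]; real and imaginary parts reduce to this case. *)
Lemma rel_fun d v w : rel d v -> rel d w -> v = w.
Proof.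
have key u : rel 0 u -> selfadj u -> u = 0.
  move=> h su; apply: posel_anti; first exact: rel_pos h su (posel0 _).
  have h' := rel_lin (-1) h (rel_lin 0 h h).
  rewrite !scaler0 !addr0 scale0r add0r scaleN1r addNr in h'.
  apply: (rel_pos _ (sa_N su) (posel0 (dalg A))).
  by have := rel_lin (-1) h h'; rewrite scaler0 !addr0 scaleN1r.
move=> h1 h2; apply/eqP; rewrite -subr_eq0; apply/eqP.
have h : rel 0 (v - w).
  have := rel_lin (-1) h2 h1; rewrite !scaleN1r addNr addrC.
  by [].
have hs : rel 0 (v - w)^† by rewrite -(@st0 (dalg A)); apply: rel_st.
have lin0 (c : CC) (y z : B) : rel 0 y -> rel 0 z -> rel 0 (c *: y + z).
  by move=> hy hz; have := rel_lin c hy hz; rewrite scaler0 addr0.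
have h0 : rel 0 0 by have := lin0 (-1) _ _ h h; rewrite scaleN1r addNr.
have hr : rel 0 (rpart (v - w)).
  by rewrite /rpart -[_ *: _]addr0; apply: (lin0) => //; rewrite -{1}[v - w]scale1r; apply: lin0.
have hi : rel 0 (ipart (v - w)).
  by rewrite /ipart -[_ *: _]addr0; apply: (lin0) => //; rewrite addrC -scaleN1r; apply: lin0.
by rewrite [LHS]ripart (key _ hr (sa_rpart _)) (key _ hi (sa_ipart _)) scaler0 addr0.
Qed.

Lemma rel_sa d w : rel d w -> selfadj d -> selfadj w.
Proof. by move=> h sd; have := rel_st h; rewrite (sd : d^† = d) => /rel_fun; apply. Qed.

Lemma rel_le d e v w : rel d v -> rel e w -> selfadj d -> selfadj e -> cle d e -> cle v w.
Proof.
move=> h1 h2 sd se; apply: rel_pos; last first.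
  by apply: sa_B; [exact: rel_sa h2 se | exact: rel_sa h1 sd].
by have := rel_lin (-1) h1 h2; rewrite !scaleN1r ![- _ + _]addrC.
Qed.

Lemma rel_S (M : RR) : rel M%:S M%:S.
Proof.
have h : rel (1 : dalg A) 1.
  have <- : phi 1 = 1 by case: phiS.
  exact: rel_j.
have := rel_lin (M%:C - 1) h h.
by rewrite -[X in _ + X]scale1r -[X in rel _ (_ + X)]scale1r -!scalerDl subrK.
Qed.

(* [v + c w] and [v - c w] in place of a Cauchy-Schwarz inequality *)
Lemma pf_cross x (e v w : B) (c : CC) : posel e ->
  `|x (c *: (v^† * e * w))| <= x (v^† * e * v) + cabs c ^+ 2 * x (w^† * e * w).
Proof.
move=> pe; have se := posel_sa pe; set z := c *: w.
have -> : cabs c ^+ 2 * x (w^† * e * w) = x (z^† * e * z).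
  rewrite -pfZ /z cs_starZ -!scalerAl -!scalerAr scalerA; congr (pf_fun x (_ *: _)).
  case: c {z} => a b; rewrite /cabs /= sqr_sqrtr ?addr_ge0 ?sqr_ge0 //; cplx.
rewrite scalerAr -/z; have e1 : x (z^† * e * v) = x (v^† * e * z).
  by rewrite -pf_st !stE (se : e^† = e) mulrA.
have h1 := pf_pos x (posel_conj (v + z) pe); have h2 := pf_pos x (posel_conj (v - z) pe).
have h3 := pf_pos x (posel_conj v pe); have h4 := pf_pos x (posel_conj z pe).
rewrite cs_starD !mulrDl !mulrDr !pfD e1 in h1.
rewrite stB !mulrBl !mulrBr !pfB e1 in h2.
by rewrite ler_norml; apply/andP; split; lra.
Qed.

Lemma fsat_cvg S x (y : nat -> B) : fsat S x -> S y -> Dec0 y -> cvgR (fun k => x (y k)) 0.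
Proof.
move=> xS Sy hy e e0; have [N hN] := xS y Sy e e0; exists N => k Nk.
have [py _ _] := hy; rewrite subr0 ger0_norm ?pf_pos //.
by apply: le_lt_trans hN; apply: pf_le; apply: Dec0_mono.
Qed.

(** [rel] respects order and scalars, so [w] is increasing and bounded and has a supremum [t]. With
    the conjugates of [t - w k] by the [b i] in the condition, the diagonal values tend to 0, and
    [pf_cross] controls the others by them. On the side of [A], suprema are strong limits by
    [gen_sup]. *)
Lemma rel_sup (u : nat -> dalg A) s (w : nat -> B) : sigma_cstar B ->
  incr_sa u -> nbounded u -> is_sup u s -> (forall k, rel (u k) (w k)) ->
  exists2 t, is_sup w t & rel s t.
Proof.
move=> Bsig iu bu us hw; have [su mu] := iu; have [M hM] := bu.
have sw k : selfadj (w k) := rel_sa (hw k) (su k).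
have iw : incr_sa w by split=> // k; apply: rel_le (hw k) (hw k.+1) (su k) (su k.+1) (mu k).
have bw : nbounded w.
  exists (2 * M) => k; apply: nm_cle2 => //.
    have := rel_le (rel_S (- M)) (hw k) (sa_S _ _) (su k); rewrite rmorphN !scaleNr; apply.
    have := cle_nmM (sa_N (su k)); rewrite nmN => /(_ _ (hM k))/cle_N.
    by rewrite opprK.
  by apply: rel_le (hw k) (rel_S M) (su k) (sa_S _ _) _; apply: cle_nmM.
have [t wt] := Bsig w iw bw; exists t => // n b.
have hy := Dec0_sup iw wt; pose y k := t - w k.
have cy : cond [set y]%classic.
  by split; [exact: finite_set_countable | move=> _ ->].
have g1 : tgen b (fun x H xi => forall i, cvgR (fun k => x ((b i)^† * y k * b i)) 0).
  apply: tgen_ord => i; apply: tgen_mono (tgen_fsat b (cond_conj (b i) cy)) => x H xi hx.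
  by apply: (fsat_cvg hx); [exists y | apply: Dec0_conj].
have g2 := tgen_vec b (gen_sup iu bu us).
have g3 : tgen b (fun x H xi => forall k, matches b (u k) (w k) x xi) by apply: tgen_all => k; apply: hw.
apply: tgen_mono2 g1 (tgen_mono2 (fun x H xi a b => conj a b) g2 g3) => x H xi {}g1 [{}g2 {}g3] c i j.
apply: (cvgR_unique (cvgP_pip (c *: xi i) (g2 j))) => e e0.
have hsum := cvgRD (g1 i) (cvgRZ (cabs c^* ^+ 2) (g1 j)); rewrite mulr0 addr0 in hsum.
have [N hN] := hsum e e0; exists N => k /hN; rewrite g3 subr0 => h.
apply: le_lt_trans (le_lt_trans (ler_norm _) h).
rewrite -pfB -scalerBr -normrN -pfN -scalerN opprB -mulrBl -mulrBr.
by apply: pf_cross; apply: (proj1 (proj2 wt)) || case: hy.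
Qed.

End Transfer.

(** * The extended map on the completion *)

Section Extension.
Variable A : cstar.

Definition csigma : cstar := sgen (@dj_hom A).
Definition cj : A -> csigma := @sgj A (dalg A) (@dj A) (@dj_hom A).
Definition cinc : csigma -> dalg A := @sgi A (dalg A) (@dj A) (@dj_hom A).

Lemma cinc_hom : star_hom cinc. Proof. exact: sinc_hom. Qed.
Lemma cj_completion : sigma_completion cj.
Proof. by apply: sgj_completion; [exact: dj_normal | exact: dj_inj | exact: dalg_sigma]. Qed.
Lemma cinc_normal : sigma_normal cinc.
Proof. by apply: sgi_normal; exact: dalg_sigma. Qed.

Variables (B : cstar) (phi : A -> B).
Hypotheses (Bsig : sigma_cstar B) (phiS : sncpu phi).

(** The elements to which [rel] assigns a value form a sigma-subspace, by [rel_sup]; this is an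
    argument about the sigma-closure of [A], not about all of [dalg A]. *)
Lemma rel_total (y : csigma) : exists w, rel phi (cinc y) w.
Proof.
suff : exists w, rel phi (sval y) w by [].
move: (sval y) (svalP y); apply: clo_ind; last by move=> a; exists (phi a); apply: rel_j.
split; first split.
- by exists (phi 0); have := rel_j phiS 0; rewrite (clin0 (hom_linear (@dj_hom A))).
- by move=> c d e [v hv] [w hw]; exists (c *: v + w); apply: rel_lin.
- by move=> d [v hv]; exists v^†; apply: rel_st.
move=> u s iu bu /choice[w hw] us; have [t _ ht] := rel_sup phiS Bsig iu bu us hw.
by exists t.
Qed.

Definition cext (y : csigma) : B := sval (cid (rel_total y)).

Lemma cextP y : rel phi (cinc y) (cext y). Proof. exact: svalP (cid (rel_total y)). Qed.
Lemma cextE y w : rel phi (cinc y) w -> cext y = w.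
Proof. exact: (rel_fun phiS (cextP y)). Qed.

Lemma cext_linear : clinear cext.
Proof.
move=> c y z; apply: cextE; rewrite (hom_linear cinc_hom).
by apply: rel_lin => //; apply: cextP.
Qed.
Lemma cext_j a : cext (cj a) = phi a.
Proof. by apply: cextE; apply: rel_j. Qed.
Lemma cext_st y : cext y^† = (cext y)^†.
Proof. by apply: cextE; apply: (rel_st phiS); apply: cextP. Qed.
Lemma cext_unital : unital cext.
Proof.
have [_ [[_ j1 _ _] _] _ _] := cj_completion; have [_ p1 _ _] := phiS.
by rewrite /unital -j1 cext_j p1.
Qed.
Lemma cext_normal : sigma_normal cext.
Proof.
move=> u s iu bu us; have us' := cinc_normal iu bu us.
have iu' : incr_sa (fun n => cinc (u n)) by apply/sinc_incr.
have [t ht st] := rel_sup phiS Bsig iu' bu us' (fun n => cextP (u n)).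
by rewrite (cextE st).
Qed.

Lemma form_exchange (H : hmod A) n (f : 'I_n -> 'I_n -> H) :
  \sum_i \sum_j \sum_k pip (f k j) (f k i) = \sum_k pip (\sum_j f k j) (\sum_j f k j).
Proof.
have pip_suml (F : 'I_n -> H) y : pip (\sum_j F j) y = \sum_j pip (F j) y.
  by elim/big_ind2: _ => [|a b c d <- <-|] //; [rewrite pip0 | rewrite pipD].
transitivity (\sum_k \sum_i \sum_j pip (f k j) (f k i)).
  rewrite exchange_big; under eq_bigr do rewrite exchange_big.
  by rewrite exchange_big; apply: eq_bigr => k _; rewrite exchange_big.
apply: eq_bigr => k _; rewrite [RHS]pip_suml; apply: eq_bigr => i _.
by rewrite pipC pip_suml; apply: eq_bigr => j _.
Qed.

(** At a generic functional with its dilation, the form of the matrix at the [b i] is the sum over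
    [k] of the squared lengths of the vectors obtained by summing [Y k j] applied to [xi j] over
    [j]. [form_mx_pos] turns positive forms into a positive matrix. *)
Lemma cext_cp : completely_positive cext.
Proof.
move=> n _ [Y ->]; apply: form_mx_pos => [|b].
  apply/matrixP => i j; rewrite !mxE -cext_st st_sum; congr cext.
  by apply: eq_bigr => k _; rewrite !mxE cs_starM cs_starK.
set X := mx_adj Y *m Y.
have eX i j : X i j = \sum_k (Y k i)^† * Y k j.
  by rewrite mxE; apply: eq_bigr => k _; rewrite mxE.
apply: (tgen_posel phiS (b := b)).
  rewrite /selfadj st_sum exchange_big; apply: eq_bigr => i _; rewrite st_sum.
  apply: eq_bigr => j _; rewrite !mxE !cs_starM cs_starK mulrA -cext_st; congr (_ * cext _ * _).
  by rewrite st_sum; apply: eq_bigr => k _; rewrite !mxE cs_starM cs_starK.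
have g1 : tgen phi b (fun x H xi => forall i j k, 
    pip (dev (cinc ((Y k i)^† * Y k j)) (xi j)) (xi i) = x ((b i)^† * cext ((Y k i)^† * Y k j) * b j)).
  apply: tgen_ord => i; apply: tgen_ord => j; apply: tgen_ord => k.
  apply: tgen_mono (cextP ((Y k i)^† * Y k j) b) => x H xi m.
  by have := m 1 i j; rewrite rmorph1 !scale1r.
have g2 : tgen phi b (fun x H xi => forall i j k,
    pip (dev (cinc ((Y k i)^† * Y k j)) (xi j)) (xi i) = pip (dev (cinc (Y k j)) (xi j)) (dev (cinc (Y k i)) (xi i))).
  apply: tgen_ord => i; apply: tgen_ord => j; apply: tgen_ord => k.
  have [S cS hS] := dev_adjoint (cinc (Y k i)).
  have h1 := tgen_vec phiS b (gen_devM (cinc (Y k i))^† (cinc (Y k j))).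
  have h2 := tgen_vec phiS b (gen_dev (cinc (Y k j)) (gen_vsat cS)).
  have h3 := tgen_vec phiS b (gen_vsat cS).
  apply: tgen_mono2 h1 (tgen_mono2 (fun x H xi a b => conj a b) h2 h3) => x H xi {}h1 [{}h2 {}h3].
  by rewrite h1 pipC -hS // pipC.
apply: tgen_mono2 g1 g2 => x H xi {}g1 {}g2.
rewrite pf_sum (eq_bigr (fun i => \sum_j \sum_k pip (dev (cinc (Y k j)) (xi j)) (dev (cinc (Y k i)) (xi i)))).
  rewrite (form_exchange (fun k j => dev (cinc (Y k j)) (xi j))); apply: sumr_ge0 => k _; exact: pip_ge0.
move=> i _; rewrite pf_sum; apply: eq_bigr => j _.
rewrite [map_mx _ _ _ _]mxE eX (big_morph cext (clinD cext_linear) (clin0 cext_linear)).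
rewrite mulr_sumr mulr_suml pf_sum; apply: eq_bigr => k _.
by rewrite -g1 g2.
Qed.

Lemma cext_sncpu : sncpu cext.
Proof.
split; [exact: cext_linear | exact: cext_unital | exact: cext_cp | exact: cext_normal].
Qed.
End Extension.

Lemma csigma_ind (A : cstar) (P : csigma A -> Prop) :
  sigma_subspace P -> (forall a, P (cj a)) -> forall y, P y.
Proof.
move=> hP hj y; have [_ _ _ /(_ y)] := cj_completion A; apply=> // _ [a ->].
exact: hj.
Qed.

Lemma sncpu_unique (A B : cstar) (f g : csigma A -> B) : sncpu f -> sncpu g ->
  (forall a, f (cj a) = g (cj a)) -> forall y, f y = g y.
Proof.
move=> [fL _ /cp_positive fp fN] [gL _ /cp_positive gp gN] h; apply: csigma_ind => //.
split; first split.
- by rewrite (clin0 fL) (clin0 gL).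
- by move=> c y z e1 e2; rewrite fL gL e1 e2.
- by move=> y e; rewrite (pos_st fL fp) (pos_st gL gp) e.
move=> u s iu bu e us; apply: sup_unique (fN _ _ iu bu us) _.
by rewrite (funext e : (fun n => f (u n)) = (fun n => g (u n))); apply: gN.
Qed.

(** * Extensions of homomorphisms *)

Section Product.
Variables A B : cstar.
Implicit Types p q : (A * B)%type.

Definition pstar p : A * B := (p.1^†, p.2^†).
Definition pnorm p : RR := Num.max (nm p.1) (nm p.2).

Lemma pstarD p q : pstar (p + q) = pstar p + pstar q.
Proof. by congr pair; apply: cs_starD. Qed.
Lemma pstarZ (c : CC) p : pstar (c *: p) = (c^*)%C *: pstar p.
Proof. by congr pair; apply: cs_starZ. Qed.
Lemma pstarM p q : pstar (p * q) = pstar q * pstar p.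
Proof. by congr pair; apply: cs_starM. Qed.
Lemma pstarK p : pstar (pstar p) = p.
Proof. by case: p => a b; rewrite /pstar /= !cs_starK. Qed.
Lemma pnorm_eq0 p : pnorm p = 0 -> p = 0.
Proof.
case: p => a b; rewrite /pnorm /= => h.
have ha : nm a <= 0 by rewrite -h le_max lexx.
have hb : nm b <= 0 by rewrite -h le_max lexx orbT.
by rewrite (nm_eq0 ha) (nm_eq0 hb).
Qed.
Lemma pnorm1 p : nm p.1 <= pnorm p. Proof. by rewrite le_max lexx. Qed.
Lemma pnorm2 p : nm p.2 <= pnorm p. Proof. by rewrite le_max lexx orbT. Qed.
Lemma pnormD p q : pnorm (p + q) <= pnorm p + pnorm q.
Proof.
rewrite ge_max; apply/andP; split; apply: le_trans (cs_normD _ _) _; apply: lerD;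
  by [exact: pnorm1 | exact: pnorm2].
Qed.
Lemma pnormZ (c : CC) p : pnorm (c *: p) = cabs c * pnorm p.
Proof. by rewrite /pnorm /= !cs_normZ maxr_pMr //; exact: cabs_ge0. Qed.
Lemma pnormM p q : pnorm (p * q) <= pnorm p * pnorm q.
Proof.
rewrite ge_max; apply/andP; split; apply: le_trans (cs_normM _ _) _; apply: ler_pM => //;
  by [exact: nm_ge0 | exact: pnorm1 | exact: pnorm2].
Qed.
Lemma pnorm_cstar p : pnorm (pstar p * p) = pnorm p ^+ 2.
Proof.
rewrite /pnorm /= !cs_cstar_id; have := nm_ge0 p.1; have := nm_ge0 p.2.
case: (leP (nm p.1) (nm p.2)) => h h1 h2.
  by apply/max_idPr; rewrite ler_pXn2r.
by apply/max_idPl; rewrite ler_pXn2r // ltW.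
Qed.
Lemma pcomplete (u : nat -> A * B) :
  (forall e : RR, 0 < e -> exists N, forall m n, (N <= m)%N -> (N <= n)%N -> pnorm (u m - u n) < e) ->
  exists l, forall e : RR, 0 < e -> exists N, forall n, (N <= n)%N -> pnorm (u n - l) < e.
Proof.
move=> h.
have [a ha] : exists a, cvgA (fun n => (u n).1) a.
  apply: cs_complete => e /h[N hN]; exists N => m n Nm Nn.
  exact: le_lt_trans (pnorm1 (u m - u n)) (hN m n Nm Nn).
have [b hb] : exists b, cvgA (fun n => (u n).2) b.
  apply: cs_complete => e /h[N hN]; exists N => m n Nm Nn.
  exact: le_lt_trans (pnorm2 (u m - u n)) (hN m n Nm Nn).
exists (a, b) => e e0; have [N1 h1] := ha e e0; have [N2 h2] := hb e e0.
exists (maxn N1 N2) => n; rewrite geq_max => /andP[n1 n2].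
by rewrite gt_max; apply/andP; split; [apply: h1 | apply: h2].
Qed.

Definition prodcs : cstar := @CStar (A * B)%type pstar pnorm
  pstarD pstarZ pstarM pstarK pnorm_eq0 pnormD pnormZ pnormM pnorm_cstar pcomplete.

Lemma prod_cle (p q : prodcs) : cle p q <-> cle p.1 q.1 /\ cle p.2 q.2.
Proof.
split=> [[[a b] e]|[[a ea] [b eb]]].
  by split; [exists a; apply: (congr1 fst e) | exists b; apply: (congr1 snd e)].
by exists (a, b); congr pair.
Qed.
Lemma prod_sa (p : prodcs) : selfadj p <-> selfadj p.1 /\ selfadj p.2.
Proof.
split=> [e|]; first by split; [apply: (congr1 fst e) | apply: (congr1 snd e)].
by case: p => a b [/= h1 h2]; congr pair.
Qed.
Lemma prod_incr (u : nat -> prodcs) :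
  incr_sa u <-> incr_sa (fun n => (u n).1) /\ incr_sa (fun n => (u n).2).
Proof.
split=> [[su mu]|[[s1 m1] [s2 m2]]]; last by split=> n; [apply/prod_sa | apply/prod_cle].
have s n := proj1 (prod_sa _) (su n); have m n := proj1 (prod_cle _ _) (mu n).
by split; split=> n; do [by case: (s n) | by case: (m n)].
Qed.
Lemma prod_sup (u : nat -> prodcs) s :
  is_sup (fun n => (u n).1) s.1 -> is_sup (fun n => (u n).2) s.2 -> is_sup u s.
Proof.
move=> [s1 u1 l1] [s2 u2 l2]; split=> [|n|t]; [exact/prod_sa | exact/prod_cle |].
move=> /prod_sa[t1 t2] ut; apply/prod_cle.
by split; [apply: l1 | apply: l2] => // n; have [] := (proj1 (prod_cle _ _) (ut n)).
Qed.
Lemma prod_sup_proj (u : nat -> prodcs) s v w :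
  is_sup (fun n => (u n).1) v -> is_sup (fun n => (u n).2) w -> is_sup u s -> s = (v, w).
Proof. by move=> h1 h2 h; apply: sup_unique h _; apply: prod_sup. Qed.
End Product.

Lemma pos_nbounded (A B : cstar) (f : A -> B) (u : nat -> A) :
  clinear f -> unital f -> positive_map f -> incr_sa u -> nbounded u -> nbounded (fun n => f (u n)).
Proof.
move=> fL f1 fp [su _] [M hM]; exists (2 * M) => n; apply: nm_cle2; first exact: pos_sa.
  have := cle_N (pos_cle fL fp (cle_nmM (sa_N (su n)) (ltac:(by rewrite nmN) : nm (- u n) <= M))).
  by rewrite (clinN fL) opprK (clinZ fL) f1.
by have := pos_cle fL fp (cle_nmM (su n) (hM n)); rewrite (clinZ fL) f1.
Qed.

(* The graph of [cext] is the sigma-closure of [{(cj a, k a)}] in the product, hence an algebra. *)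
Lemma cext_hom (A B : cstar) (k : A -> B) (Bsig : sigma_cstar B) (kH : star_hom k) (kS : sncpu k) :
  star_hom (cext Bsig kS).
Proof.
have [ch [[jH jN] _ _]] : sigma_cstar (csigma A) /\ [/\ sigma_star_hom (@cj A), True & True].
  by have [h1 h2 _ _] := cj_completion A.
have [fL f1 fC fN] := cext_sncpu Bsig kS; set f := cext Bsig kS in fL f1 fC fN *.
have fp := cp_positive fC; have fs := pos_st fL fp.
have fj a : f (cj a) = k a := cext_j Bsig kS a.
have [jL j1 jM jS] := jH; have [kL k1 kM kS'] := kH.
pose g (a : A) : prodcs (csigma A) B := (cj a, k a).
have gH : star_hom g.
  split.
  - by move=> c a b; congr pair; [apply: jL | apply: kL].
  - by congr pair.
  - by move=> a b; congr pair; [apply: jM | apply: kM].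
  - by move=> a; congr pair; [apply: jS | apply: kS'].
pose S := sigma_closure (fun x => exists a, x = g a).
(* The graph is a sigma-subspace: the first components have a supremum in the completion, and by
   normality its image under [f] is the supremum of the second ones. *)
have S_graph p : S p -> p.2 = f p.1.
  move: p; apply: (clo_ind (P := fun p : prodcs _ _ => p.2 = f p.1)); last by move=> a; rewrite /= fj.
  split; first split=> //.
  - by rewrite (clin0 fL).
  - by move=> c p q e1 e2; rewrite /= e1 e2 fL.
  - by move=> p e; rewrite /= e fs.
  move=> u s /prod_incr[i1 i2] [M hM] e us.
  have b1 : nbounded (fun n => (u n).1) by exists M => n; apply: le_trans (pnorm1 _) (hM n).
  have [t ut] := ch _ i1 b1; have := fN _ _ i1 b1 ut.
  rewrite (_ : (fun n => f (u n).1) = fun n => (u n).2); last by apply/funext => n; rewrite e.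
  by move=> h; rewrite (prod_sup_proj ut h us).
have graph_S y : S (y, f y).
  move: y; apply: csigma_ind; last by move=> a; rewrite fj; apply: clo_j.
  split; first split.
  - by rewrite (clin0 fL); apply: (csub0 (clo_csub gH)).
  - by move=> c y z hy hz; rewrite fL; apply: (csubL (clo_csub gH) c hy hz).
  - by move=> y hy; rewrite fs; apply: (clo_st hy).
  move=> u s iu bu hu us; apply: (@clo_sup _ _ g (fun n => (u n, f (u n)))) => //.
  - by apply/prod_incr; split=> //; apply: pos_incr.
  - have [M hM] := pos_nbounded fL f1 fp iu bu; have [K hK] := bu.
    exists (Num.max K M) => n; rewrite ge_max; apply/andP.
    by split; rewrite le_max; [rewrite hK | rewrite hM orbT].
  - by apply: prod_sup => //; apply: fN.
split=> // a b.
(* The product of two points of the graph lies in the algebra [S], hence on the graph again. *)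
by have := S_graph _ (csubM (clo_csub gH) (graph_S a) (graph_S b)).
Qed.

Theorem theorem3p52 (A : cstar) :
  exists (Asig : cstar) (j : A -> Asig),
    universal_sigma_completion j /\
    (forall B : cstar, sigma_cstar B ->
       forall phi : A -> B, sncpu phi ->
       exists psi : Asig -> B,
         [/\ sncpu psi, (forall a, psi (j a) = phi a) &
             (forall psi' : Asig -> B, sncpu psi' ->
                (forall a, psi' (j a) = phi a) -> forall x, psi' x = psi x)]).
Proof.
exists (csigma A), (@cj A); split.
  split=> [|C k [Csig [kH kN] _ _]]; first exact: cj_completion.
  have kS := hom_sncpu kH kN; exists (cext Csig kS); split; last exact: cext_j.
  by split; [exact: cext_hom | exact: cext_normal].
move=> B Bsig phi phiS; exists (cext Bsig phiS); split; [exact: cext_sncpu | exact: cext_j |].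
move=> psi' hpsi h; apply: sncpu_unique => // [|a]; first exact: cext_sncpu.
by rewrite h cext_j.
Qed.
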